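(* Under the assumptions of the context, let $K:S^m\times S^m\to\mathbb{R}$ be a continuous, symmetric, positive definite kernel which is $(\mu_t,B,\rho)$-Hölder for some $\rho\in(0,2]$ and nonnegative $B\in L^\infty(S^m)$. Let $\mathcal{H}(K)$ be the reproducing kernel Hilbert space of $K$ and $S$ its unit sphere, regarded as a subset of $L^2(S^m)$. Then $$d_n(S;L^2(S^m))=O\big((n+1)^{-1/2-\rho/(2m)}\big),\qquad n\to\infty.$$
   Context: Let $m\ge 2$, $S^m$ the unit sphere of $\mathbb{R}^{m+1}$, $\sigma_m$ its surface measure, $\omega_m=\sigma_m(S^m)$, $L^p(S^m)=L^p(S^m,\sigma_m)$. Fix a pole $\xi\in S^m$; $\mathcal{M}_\xi(S^m)$ is the space of finite regular signed Borel measures on $S^m$ invariant under rotations fixing $\xi$, normed by $|\mu|=|\mu|(S^m)/\omega_m$. For $x\in S^m$ let $\mathcal{O}_x$ be a rotation with $\mathcal{O}_x(x)=\xi$, and $(f*\mu)(x)=\frac{1}{\omega_m}\int_{S^m}f(y)\,d(\mu\circ\mathcal{O}_x)(y)$. $P_k^{\lambda}$ is the Gegenbauer polynomial of degree $k$ and index $\lambda$ normalized by $P_k^\lambda(1)=1$; the multiplier of $\mu$ is $\mu^k=\frac{1}{\omega_m}\int_{S^m}P_k^{(m-1)/2}(\xi\cdot y)\,d\mu(y)$. Standing assumptions: $\{\mu_t:t\in(0,\pi)\}\subset\mathcal{M}_\xi(S^m)$ is uniformly bounded; for each $t$ its multiplier is $\mu_t^k=c_{k,m}(v_m(t))^{-1}P^\beta_{\alpha(k)}(\cos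 t)(\sin t)^\gamma$ with nonzero reals $c_{k,m}$, $\alpha:\mathbb{Z}_+\to\mathbb{Z}_+$ strictly increasing, $\gamma>0$, $2\beta$ an integer $\ge\gamma$; the normalizing function $v_m:(0,\pi)\to(0,\infty)$ (either $v_m\equiv1$, or the $\sigma_m$-measure of the support of the density of $\mu_t$ when $\mu_t$ is given by an isotropic kernel) satisfies $v_m(t)\asymp t^{c(m)}$ on $(0,\pi)$ for some constant $c(m)$; and for each positive integer $l$ there is $q=q(l,m)>0$ with $ln\le\alpha(qn)$ for all $n\ge1$. A kernel $K$ is $(\mu_t,B,\rho)$-Hölder if $|(K(x,\cdot)*\mu_t)(y)-K(x,y)|\le B(x)t^\rho$ for all $t\in(0,\pi)$, $x,y\in S^m$. The Kolmogorov $n$-width of a subset $A$ of a Hilbert space $H$ is $d_n(A;H)=\inf_{V_n}\sup_{f\in A}\inf_{g\in V_n}\|f-g\|_H$, the first infimum over all $n$-dimensional subspaces $V_n\subset H$. *)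

(* Defs.v *)
From HB Require Import structures.
From mathcomp Require Import all_boot all_order all_algebra.
From mathcomp Require Import all_classical all_reals all_analysis.

Set Implicit Arguments.
Unset Strict Implicit.
Unset Printing Implicit Defensive.

Import Order.TTheory GRing.Theory Num.Theory.
Import numFieldNormedType.Exports.
Local Open Scope classical_set_scope.
Local Open Scope ring_scope.

Section Defs.
Variable R : realType.

Definition E (m : nat) := 'rV[R]_(m.+1).

Definition SM (m : nat) := g_sigma_algebraType (@open (E m)).

Definition dot (m : nat) (x y : E m) : R := \sum_(i < m.+1) x 0 i * y 0 i.

Definition sphere (m : nat) : set (SM m) := [set x : SM m | @dot m x x = 1].

Definition rotation (m : nat) (O : 'M[R]_(m.+1)) : Prop :=
  O^T *m O = 1%:M /\ \det O = 1.

(* action of the matrix O on a point x (column convention: x |-> O x) *)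
Definition act (m : nat) (O : 'M[R]_(m.+1)) (x : E m) : E m := x *m O^T.

(* Gegenbauer polynomials C_k^lam via the three-term recurrence:
   C_0 = 1, C_1 = 2 lam x,
   n C_n = 2 x (n + lam - 1) C_{n-1} - (n + 2 lam - 2) C_{n-2}.
   gegC_aux lam x k = (C_k(x), C_{k+1}(x)). *)
Fixpoint gegC_aux (lam x : R) (k : nat) : R * R :=
  match k with
  | O => (1, 2 * lam * x)
  | k'.+1 =>
      let: (a, b) := gegC_aux lam x k' in
      (b, (2 * x * (k'.+1%:R + lam) * b - (k'%:R + 2 * lam) * a) / k'.+2%:R)
  end.

Definition gegC (lam : R) (k : nat) (x : R) : R := (gegC_aux lam x k).1.

Definition geg (lam : R) (k : nat) (x : R) : R := gegC lam k x / gegC lam k 1.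

(* real-valued integral over D (finite measures, bounded integrands) *)
Definition RintS (m : nat) (mu : {measure set (SM m) -> \bar R})
  (D : set (SM m)) (f : SM m -> R) : R :=
  fine (\int[mu]_(x in D) (f x)%:E)%E.

Definition L2norm (m : nat) (sigma : {measure set (SM m) -> \bar R})
  (h : SM m -> R) : \bar R :=
  match (\int[sigma]_(x in @sphere m) ((h x) ^+ 2)%:E)%E with
  | r%:E => (Num.sqrt r)%:E
  | _ => +oo%E
  end.

Definition L2 (m : nat) (sigma : {measure set (SM m) -> \bar R}) :
  set (SM m -> R) :=
  [set h | measurable_fun (@sphere m) h /\ (L2norm sigma h < +oo)%E].

Definition span_fun (m n : nat) (vs : 'I_n -> SM m -> R) (a : 'I_n -> R) :
  SM m -> R := fun x => \sum_(i < n) a i * vs i x.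

Definition kolmogorov_width (m : nat) (sigma : {measure set (SM m) -> \bar R})
  (A : set (SM m -> R)) (n : nat) : \bar R :=
  ereal_inf [set ereal_sup
                   [set ereal_inf
                          [set L2norm sigma (fun x => f x - span_fun vs a x)
                          | a in [set: 'I_n -> R]]
                   | f in A]
            | vs in [set vs : 'I_n -> SM m -> R | forall i, L2 sigma (vs i)]].

(* Reproducing kernel Hilbert space (Moore-Aronszajn construction):
   elements of the pre-Hilbert space span{K(x,.) : x in S^m} are finite
   lists of (coefficient, point) pairs. *)
Definition pre_eval (m : nat) (K : E m -> E m -> R) (g : seq (R * E m))
  (y : E m) : R := \sum_(p <- g) p.1 * K p.2 y.

Definition pre_norm2 (m : nat) (K : E m -> E m -> R) (g : seq (R * E m)) : R :=
  \sum_(p <- g) \sum_(q <- g) p.1 * q.1 * K p.2 q.2.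

Definition pre_sub (m : nat) (g h : seq (R * E m)) : seq (R * E m) :=
  g ++ [seq (- p.1, p.2) | p <- h].

Definition rkhs_norm_is (m : nat) (K : E m -> E m -> R) (f : E m -> R) (r : R)
  : Prop :=
  exists g : nat -> seq (R * E m),
    (forall n p, p \in g n -> @sphere m p.2) /\
    (forall e : R, 0 < e -> exists N : nat, forall a b : nat,
        (N <= a)%N -> (N <= b)%N -> pre_norm2 K (pre_sub (g a) (g b)) < e) /\
    (forall y, @sphere m y -> pre_eval K (g n) y @[n --> \oo] --> f y) /\
    (Num.sqrt (pre_norm2 K (g n)) @[n --> \oo] --> r).

Definition rkhs_unit_sphere (m : nat) (K : E m -> E m -> R) : set (SM m -> R) :=
  [set f | rkhs_norm_is K f 1].

Definition pos_def_kernel (m : nat) (K : E m -> E m -> R) : Prop :=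
  forall (n : nat) (xs : 'I_n -> E m) (cs : 'I_n -> R),
    (forall i, @sphere m (xs i)) ->
    0 <= \sum_(i < n) \sum_(j < n) cs i * cs j * K (xs i) (xs j).

End Defs.

(* Main.v *)
(* Write I for integration over the sphere, P_k for the Gegenbauer polynomials of index
   (m-1)/2, and q_k >= 0 for the trace of the integral operator of K on the spherical
   harmonics of degree k. Rotation invariance of mu_t gives the product formula
   mu_t(P_k(w . z)) = P_k(w . xi) mu_t(P_k(xi . z)), so convolution with mu_t multiplies
   degree k by the multiplier mu_t^k. Testing the Hoelder condition against the square
   sum_k a_k^2 P_k (suitably normalized) of a nonnegative approximate identity
   sum_k a_k P_k yields |sum_k a_k^2 (1 - mu_t^k) q_k| <= C t^rho. Every degree with
   q_k > 0 has the same constant c_k, hence mu_t^k <= 1 + C t^rho, while the energy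
   estimate |P_n^beta(cos t)| <= 1/4 for n t large gives mu_t^k <= 1/2 for k > N = l/t.
   Hence sum_(k > N) a_k^2 q_k = O(N^-rho), which bounds sum_i <K g_i, g_i> for every
   orthonormal family g_i orthogonal to the polynomials of degree at most N.

   The unit sphere of the RKHS is then approximated greedily: starting from an
   orthonormal basis of those O(N^m) polynomials, as long as some f is at distance more
   than e from the current span, the normalized residual g satisfies <K g, g> > e^2
   because <f, h>^2 <= <K h, h>. With N^m steps, e^2 is of order N^(-rho-m).

   Integrals only ever see bounded uniformly continuous functions on the sphere, and are
   handled through uniform approximation by finite quadratures. *)

Require Import Defs.
From HB Require Import structures.
From mathcomp Require Import all_boot all_order all_algebra.
From mathcomp Require Import all_classical all_reals all_analysis.
From mathcomp Require finmap.
From mathcomp Require Import measurable_realfun ring lra zify.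
Set Implicit Arguments.
Unset Strict Implicit.
Unset Printing Implicit Defensive.
Import Order.TTheory GRing.Theory Num.Theory.
Import numFieldNormedType.Exports.
Local Open Scope classical_set_scope.
Local Open Scope ring_scope.

(** * Gegenbauer polynomials *)

Section GegenbauerPolynomials.
Variable R : realType.
Implicit Types (lam x : R) (k n : nat) (p f : {poly R}).

(** The hypotheses do not say how the constants c_k and the factor v match the normalization of the
    convolution. The Hoelder condition itself settles this: it forces mu_t^k to tend to 1 as t tends
    to 0 in every degree that K charges. The test function is a convolution square because two
    requirements must hold together. It has to be a nonnegative zonal function of integral 1, so
    that integrating the Hoelder bound against it costs nothing as its degree grows; and its
    coefficients have to be nonnegative, so that no cancellation can hide the tail. All bounds are
    uniform in the degree of the approximate identity, which can then be sent to infinity with N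
    fixed. A single angle t = L / N controls the whole tail beyond N. Sums of <K g_i, g_i> over
    orthonormal families take the place of eigenvalues, so no spectral decomposition of K enters. *)

Fixpoint gegC_poly_pair lam k : {poly R} * {poly R} :=
  match k with
  | O => (1, (2 * lam) *: 'X)
  | k'.+1 =>
      let: (a, b) := gegC_poly_pair lam k' in
      (b, k'.+2%:R^-1 *: ((2 * (k'.+1%:R + lam)) *: ('X * b)
                           - (k'%:R + 2 * lam) *: a))
  end.

Definition gegC_poly lam k : {poly R} := (gegC_poly_pair lam k).1.

Definition geg_poly lam k : {poly R} := (gegC lam k 1)^-1 *: gegC_poly lam k.

Lemma gegC_poly_pairE lam k :
  gegC_poly_pair lam k = (gegC_poly lam k, gegC_poly lam k.+1).
Proof. by rewrite /gegC_poly /=; case: (gegC_poly_pair lam k). Qed.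

Lemma gegC_poly0 lam : gegC_poly lam 0 = 1. Proof. by []. Qed.

Lemma gegC_poly1 lam : gegC_poly lam 1 = (2 * lam) *: 'X. Proof. by []. Qed.

Lemma gegC_polySS lam k : k.+2%:R *: gegC_poly lam k.+2 =
  (2 * (k.+1%:R + lam)) *: ('X * gegC_poly lam k.+1)
  - (k%:R + 2 * lam) *: gegC_poly lam k.
Proof.
rewrite {1}/gegC_poly /= gegC_poly_pairE /= scalerA mulfV ?scale1r//.
Qed.

Lemma horner_gegC_poly lam k x : (gegC_poly lam k).[x] = gegC lam k x.
Proof.
suff: ((gegC_poly lam k).[x], (gegC_poly lam k.+1).[x]) = gegC_aux lam x k.
  by rewrite /gegC => <-.
elim: k => [|k ih].
  by rewrite gegC_poly0 gegC_poly1 /= !hornerE.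
rewrite /= -ih; congr pair.
have /(congr1 (fun p => p.[x])) := gegC_polySS lam k.
rewrite hornerD hornerN !hornerZ hornerM hornerX => e.
apply: (@mulfI _ k.+2%:R); first by rewrite pnatr_eq0.
rewrite e [RHS]mulrC mulfVK ?pnatr_eq0//; ring.
Qed.

Lemma horner_geg_poly lam k x : (geg_poly lam k).[x] = geg lam k x.
Proof. by rewrite /geg_poly hornerZ horner_gegC_poly /geg mulrC. Qed.

(** The two ladder relations are proved together because the first one at [k.+1] needs the second
    one at [k]. They lead to the first-order relation [gegC_poly_deriv], and one more derivative
    gives the differential equation. *)
Lemma gegC_poly_deriv_rec lam k :
  ((gegC_poly lam k.+1)^`() =
     'X * (gegC_poly lam k)^`() + (k%:R + 2 * lam) *: gegC_poly lam k) *
  ('X * (gegC_poly lam k.+1)^`() - (gegC_poly lam k)^`() =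
     k.+1%:R *: gegC_poly lam k.+1).
Proof.
elim: k => [|k [ihA ihB]].
  rewrite gegC_poly0 gegC_poly1 derivZ derivX poly.derivE mulr0 !add0r subr0.
  by rewrite scale1r -scalerAr mulr1.
have k2 : (k.+2%:R : R) != 0 by rewrite pnatr_eq0.
have A : (gegC_poly lam k.+2)^`() =
     'X * (gegC_poly lam k.+1)^`() + (k.+1%:R + 2 * lam) *: gegC_poly lam k.+1.
  apply: (@scalerI _ _ k.+2%:R) => //.
  rewrite -derivZ gegC_polySS derivB !derivZ derivM derivX mul1r.
  have -> : (gegC_poly lam k)^`() =
     'X * (gegC_poly lam k.+1)^`() - k.+1%:R *: gegC_poly lam k.+1.
    by rewrite -ihB; ring.
  rewrite -!mul_polyC; ring.
split=> //.
have S := gegC_polySS lam k.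
have h : (1 - 'X ^+ 2) * (gegC_poly lam k.+1)^`() =
   (k%:R + 2 * lam) *: gegC_poly lam k - k.+1%:R *: ('X * gegC_poly lam k.+1).
  rewrite scalerAr -ihB mulrBr -[in RHS](addrK ('X * (gegC_poly lam k)^`()) (_ *: _)).
  rewrite [_ *: _ + _]addrC -ihA; ring.
rewrite A S; apply/eqP; rewrite -subr_eq0.
rewrite (_ : _ - _ = ((k%:R + 2 * lam) *: gegC_poly lam k
    - k.+1%:R *: ('X * gegC_poly lam k.+1)) -
    (1 - 'X ^+ 2) * (gegC_poly lam k.+1)^`()); first by rewrite h subrr.
rewrite -!mul_polyC; ring.
Qed.

Lemma gegC_poly_deriv lam k : (1 - 'X ^+ 2) * (gegC_poly lam k)^`() =
  (k%:R + 2 * lam) *: ('X * gegC_poly lam k) - k.+1%:R *: gegC_poly lam k.+1.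
Proof.
have [A B] := gegC_poly_deriv_rec lam k.
rewrite -B A -!mul_polyC; ring.
Qed.

(** The Laplace-Beltrami operator of the sphere of dimension [d], acting on functions of the height
    above the equator. *)
Definition geg_op (d : R) p : {poly R} :=
  (1 - 'X ^+ 2) * p^`()^`() - d *: ('X * p^`()).

Lemma geg_opZ d x p : geg_op d (x *: p) = x *: geg_op d p.
Proof. by rewrite /geg_op !derivZ -!mul_polyC; ring. Qed.

Lemma geg_opD d p f : geg_op d (p + f) = geg_op d p + geg_op d f.
Proof. by rewrite /geg_op !derivD -!mul_polyC; ring. Qed.

Lemma geg_op_sum d n (F : 'I_n -> {poly R}) :
  geg_op d (\sum_(i < n) F i) = \sum_(i < n) geg_op d (F i).
Proof.
elim/big_rec2: _ => [|i y1 y2 _ <-]; last by rewrite geg_opD.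
by rewrite /geg_op !poly.derivE !mulr0 scaler0 subr0.
Qed.

Lemma gegC_poly_ode lam k : geg_op (2 * lam + 1) (gegC_poly lam k) =
  - (k%:R * (k%:R + 2 * lam)) *: gegC_poly lam k.
Proof.
have := congr1 (fun p => p^`()) (gegC_poly_deriv lam k).
rewrite /= !poly.derivE /= => e.
have [A _] := gegC_poly_deriv_rec lam k.
rewrite A in e.
rewrite /geg_op (_ : (1 - 'X ^+ 2) * (gegC_poly lam k)^`()^`() =
  ((0 - 'X^1 *+ 2) * (gegC_poly lam k)^`() +
   (1 - 'X ^+ 2) * (gegC_poly lam k)^`()^`())
   + 2%:R *: ('X * (gegC_poly lam k)^`())); last by rewrite -mul_polyC; ring.
rewrite e -!mul_polyC; ring.
Qed.

Lemma geg_poly_ode lam k : geg_op (2 * lam + 1) (geg_poly lam k) =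
  - (k%:R * (k%:R + 2 * lam)) *: geg_poly lam k.
Proof. by rewrite geg_opZ gegC_poly_ode scalerA mulrC -scalerA. Qed.

Lemma gegC_at1_gt0 lam k : 0 < lam -> 0 < gegC lam k 1.
Proof.
move=> l0; elim: k => [|k ih]; first exact: ltr01.
have /(congr1 (fun p => p.[1])) := gegC_poly_deriv lam k.
rewrite !(hornerD,hornerN,hornerZ,hornerM,hornerX,hornerXn,hornerC).
rewrite !horner_gegC_poly ?expr1n ?mulr1 subrr mul0r mul1r => /esym/eqP.
rewrite subr_eq0 => /eqP e.
rewrite -(pmulr_rgt0 _ (ltr0Sn R k)) -e mulr_gt0//.
by rewrite ltr_wpDl ?ler0n// mulr_gt0.
Qed.

Lemma horner_geg_poly1 lam k : 0 < lam -> (geg_poly lam k).[1] = 1.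
Proof.
by move=> l0; rewrite horner_geg_poly /geg divff// gt_eqF// gegC_at1_gt0.
Qed.

Lemma size_gegC_poly lam k : 0 < lam -> size (gegC_poly lam k) = k.+1.
Proof.
move=> l0.
suff: (size (gegC_poly lam k) = k.+1) /\ (size (gegC_poly lam k.+1) = k.+2).
  by case.
elim: k => [|k [ih1 ih2]].
  rewrite gegC_poly0 size_poly1 gegC_poly1 size_scale ?size_polyX//.
  by rewrite gt_eqF// mulr_gt0.
split=> //.
have k2 : (k.+2%:R : R) != 0 by rewrite pnatr_eq0.
rewrite -(size_scale _ k2) gegC_polySS.
have s1 : size ((2 * (k.+1%:R + lam)) *: ('X * gegC_poly lam k.+1)) = k.+3.
  rewrite size_scale; last by rewrite gt_eqF// mulr_gt0// addr_gt0.
  by rewrite mulrC size_mulX ?ih2// -size_poly_eq0 ih2.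
rewrite size_polyDl s1// size_polyN.
apply: leq_ltn_trans (size_scale_leq _ _) _.
by rewrite ih1.
Qed.

Lemma size_geg_poly lam k : 0 < lam -> size (geg_poly lam k) = k.+1.
Proof.
move=> l0; rewrite size_scale ?size_gegC_poly//.
by rewrite invr_eq0 gt_eqF// gegC_at1_gt0.
Qed.

Lemma derivn_geg_op d p n : (geg_op d p)^`(n) =
  (1 - 'X ^+ 2) * p^`(n.+2) - (n.*2%:R + d) *: ('X * p^`(n.+1))
  - (n%:R * (n%:R - 1) + d * n%:R) *: p^`(n).
Proof.
elim: n => [|n ih].
  by rewrite !mul0r mulr0 !add0r scale0r subr0.
rewrite derivnS ih !poly.derivE -!derivnS doubleS -!mul_polyC.
rewrite -[in n.+1%:R]addn1 -[n.*2.+2]addn2 !natrD -muln2 natrM; ring.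
Qed.

Lemma poly_eq0_inj p (h : nat -> R) : injective h ->
  (forall n, p.[h n] = 0) -> p = 0.
Proof.
move=> hi hp; apply/eqP; apply: contraT => p0.
have := @max_poly_roots _ p (map h (iota 0 (size p))) p0.
rewrite size_map size_iota ltnn; apply.
  by apply/allP => x /mapP[n _ ->]; rewrite /root hp.
by rewrite map_inj_uniq// iota_uniq.
Qed.

Lemma poly_eq0_derivn p x : (forall n, p^`(n).[x] = 0) -> p = 0.
Proof.
move=> hp; apply: (@poly_eq0_inj _ (fun n => x + n%:R)).
  by move=> i j /addrI/eqP; rewrite eqr_nat => /eqP.
move=> n; rewrite nderiv_taylor; last exact: mulrC.
apply: big1 => i _; have := hp i.
rewrite nderivn_def hornerMn => /eqP; rewrite mulrn_eq0 => /orP[|/eqP->].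
  by rewrite eqn0Ngt fact_gt0.
by rewrite mul0r.
Qed.

(** The point 1 is singular: there the coefficient of the highest derivative vanishes, and the
    [n]-th derivative of the equation expresses [f^](n.+1).[1][through]f^[(n).[1]], with a factor
    [n.*2 + d] that is positive. So the value at 1 determines a polynomial solution. *)
Lemma geg_ode_unique (d L : R) f : 0 < d -> geg_op d f = L *: f ->
  f.[1] = 0 -> f = 0.
Proof.
move=> d0 e f1; apply: (@poly_eq0_derivn _ 1); elim=> // n ih.
have := congr1 (fun p => p^`(n).[1]) e.
rewrite derivn_geg_op derivnZ.
rewrite !(hornerD,hornerN,hornerZ,hornerM,hornerX,hornerXn,hornerC) ih.
rewrite ?expr1n ?mulr1 subrr mul0r !mulr0 mul1r add0r subr0 => /eqP.
rewrite oppr_eq0 mulf_eq0 => /orP[|/eqP//].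
by rewrite gt_eqF// ltr_wpDl.
Qed.

(* [zonal_coef d j] is the [2j]-th moment of a coordinate on the unit sphere of
   [R^d], divided by [(2j)!]. *)
Fixpoint zonal_coef (d : R) j : R :=
  if j is j'.+1 then zonal_coef d j' / (j.*2%:R * (j'.*2%:R + d)) else 1.

(** The average of p(x y + sqrt(1 - x^2) sqrt(1 - y^2) u) as a polynomial in y, where u is a
    coordinate of a uniform point of the unit sphere of R^d. Taylor expansion in u leaves only even
    orders, so the square roots disappear. *)
Definition geg_product d p x : {poly R} :=
  \sum_(j < size p) (zonal_coef d j * (1 - x ^+ 2) ^+ j) *:
    ((1 - 'X ^+ 2) ^+ j * (p^`(j.*2) \Po (x *: 'X))).

Lemma geg_op_product (d L : R) p x : 0 < d -> geg_op d p = L *: p ->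
  geg_op d (geg_product d p x) = L *: geg_product d p x.
Proof.
move=> d0 ep; rewrite /geg_product geg_op_sum scaler_sumr.
pose A : {poly R} := 1 - 'X ^+ 2.
(* The operator applied to the [j]-th summand gives [L] times that summand plus [U j - U j.+1]. The
   sum telescopes: [U 0] has a zero factor, and [U (size p)] contains a derivative of [p] of too
   high an order. *)
pose U j : {poly R} := (zonal_coef d j * (1 - x ^+ 2) ^+ j *
   (j.*2%:R * (j.*2%:R - 2 + d))) *: (A ^+ j.-1 * (p^`(j.*2) \Po (x *: 'X))).
have key (j : nat) : geg_op d ((zonal_coef d j * (1 - x ^+ 2) ^+ j) *:
    (A ^+ j * (p^`(j.*2) \Po (x *: 'X)))) =
    L *: ((zonal_coef d j * (1 - x ^+ 2) ^+ j) *: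
    (A ^+ j * (p^`(j.*2) \Po (x *: 'X)))) + U j - U j.+1.
  have -> : U j.+1 = (zonal_coef d j * (1 - x ^+ 2) ^+ j * (1 - x ^+ 2)) *:
      (A ^+ j * (p^`(j.*2.+2) \Po (x *: 'X))).
    rewrite /U; congr (_ *: _).
    rewrite [zonal_coef d _]/= doubleS exprSr.
    have -> : j.*2.+2%:R - 2 + d = j.*2%:R + d by rewrite -addn2 natrD; ring.
    have h : (j.*2.+2%:R * (j.*2%:R + d)) != 0.
      by rewrite mulf_neq0// ?pnatr_eq0// gt_eqF// ltr_wpDl.
    by rewrite [LHS]mulrAC mulfVK// mulrA.
  have hD : L *: p^`(j.*2) = (1 - 'X ^+ 2) * p^`(j.*2.+2)
     - (j.*2.*2%:R + d) *: ('X * p^`(j.*2.+1))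
     - (j.*2%:R * (j.*2%:R - 1) + d * j.*2%:R) *: p^`(j.*2).
    by rewrite -derivn_geg_op ep derivnZ.
  pose r i : {poly R} := p^`(i) \Po (x *: 'X).
  have hr i : (r i)^`() = x *: r i.+1.
    by rewrite /r deriv_comp -derivnS derivZ derivX mulrC -mul_polyC mulr1 mul_polyC.
  have hA : A^`() = - (2 *: 'X).
    by rewrite /A expr2 !poly.derivE -!mul_polyC; ring.
  have hc : L *: r j.*2 = (1 - (x *: 'X) ^+ 2) * r j.*2.+2
     - (j.*2.*2%:R + d) *: ((x *: 'X) * r j.*2.+1)
     - (j.*2%:R * (j.*2%:R - 1) + d * j.*2%:R) *: r j.*2.
    have /(congr1 (fun q => q \Po (x *: 'X))) := hD.
    by rewrite expr2 !(comp_polyB, comp_polyZ, comp_polyM, comp_polyX, comp_polyC).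
  rewrite /U -!/(r _) -/A geg_opZ [L *: _]scalerA [L * _]mulrC -[X in _ = X + _ - _]scalerA.
  rewrite scalerAr hc.
  rewrite -addrA [(_ * _) *: (A ^+ j.-1 * _)](_ : _ =
    (zonal_coef d j * (1 - x ^+ 2) ^+ j) *: ((j.*2%:R * (j.*2%:R - 2 + d)) *:
      (A ^+ j.-1 * r j.*2))); last by rewrite scalerA.
  rewrite -[(_ * (1 - x ^+ 2)) *: _]scalerA -scalerBr -scalerDr.
  congr (_ *: _); case: j {hD hc} => [|j] /=.
    rewrite /geg_op expr0 !mul1r hr derivZ hr.
    by rewrite double0 -!mul_polyC; ring.
  have hAn n : (A ^+ n.+1)^`() = - (2 * n.+1%:R) *: ('X * A ^+ n).
    by rewrite deriv_exp hA /= -mulr_natr -!mul_polyC; ring.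
  have E1 : (A ^+ j.+1 * r j.+1.*2)^`() =
     - (2 * j.+1%:R) *: ('X * A ^+ j * r j.+1.*2) + x *: (A ^+ j.+1 * r j.+1.*2.+1).
    by rewrite derivM hAn hr -scalerAl -scalerAr.
  rewrite /geg_op E1 derivD !derivZ !derivM derivX !hAn !hr mul1r.
  rewrite doubleS; move: (r _) (r _) (r _) => r0 r1 r2.
  case: j {E1} => [|j].
    by rewrite expr0 expr1 derivC double0 -!muln2 -!mul_polyC /A; ring.
  rewrite hAn !exprS; move: (A ^+ j) => Y.
  have -> : j.+1.*2.+2.*2%:R = 4 * j.+2%:R :> R by rewrite -!muln2; ring.
  have -> : j.+1.*2.+2%:R = 2 * j.+2%:R :> R by rewrite -!muln2; ring.
  have -> : j.+1%:R = j.+2%:R - 1 :> R by ring.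
  rewrite -!mul_polyC /A; move: (j.+2%:R) => J; ring.
rewrite (eq_bigr _ (fun (j : 'I_ _) _ => key j)) big_split /= big_split /=.
rewrite sumrN -[RHS]addr0 -!addrA; congr (_ + _).
rewrite -sumrB -(big_mkord xpredT (fun j => U j - U j.+1)).
rewrite (@telescope_sumr_eq _ _ _ (fun j => - U j))//; last first.
  by move=> j _; rewrite opprK addrC.
rewrite opprK /U double0 mul0r mulr0 scale0r addr0 derivn_poly0 ?comp_poly0.
  by rewrite mulr0 scaler0 oppr0.
by rewrite -addnn leq_addr.
Qed.

(** Both sides solve the same equation and agree at 1, where every summand of [geg_product] except
    [j = 0] vanishes; [geg_ode_unique] concludes. *)
Lemma geg_poly_product lam k x : 0 < lam ->
  geg_product (2 * lam + 1) (geg_poly lam k) x =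
  (geg_poly lam k).[x] *: geg_poly lam k.
Proof.
move=> l0; have d0 : 0 < 2 * lam + 1 by rewrite addr_gt0// mulr_gt0.
set d := 2 * lam + 1 in d0 *; set p := geg_poly lam k.
have e : geg_op d p = - (k%:R * (k%:R + 2 * lam)) *: p by exact: geg_poly_ode.
apply/eqP; rewrite -subr_eq0; apply/eqP.
apply: (geg_ode_unique d0 (L := - (k%:R * (k%:R + 2 * lam)))).
  rewrite geg_opD (geg_op_product _ d0 e) -(scaleNr p.[x]) geg_opZ e scalerDr; congr (_ + _).
  by rewrite scalerA [RHS]scalerA [X in X *: _]mulrC.
rewrite hornerD hornerN hornerZ horner_geg_poly1// mulr1.
rewrite /geg_product size_geg_poly// horner_sum big_ord_recl /= big1 => [|i _].
  by rewrite !expr0 !mul1r scale1r addr0 horner_comp !hornerE subrr.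
by rewrite hornerZ hornerM horner_exp hornerD hornerN hornerXn hornerC expr1n subrr expr0n /= mul0r
  mulr0.
Qed.

End GegenbauerPolynomials.

(** * Decay of Gegenbauer polynomials as functions of the angle *)

Section GegenbauerDecay.
Variable R : realType.
Implicit Types (lam x t : R) (k n : nat) (p f : {poly R}).

Lemma is_derive_ge (f df : R -> R) (a b : R) : a <= b ->
  (forall x, is_derive x 1 f (df x)) ->
  (forall x, a <= x <= b -> df x <= 0) -> f b <= f a.
Proof.
move=> ab hf hdf.
have cf : {within `[a, b], continuous f}.
  apply: continuous_subspaceT => x; apply: differentiable_continuous.
  by apply/derivable1_diffP; have := hf x => -[].
have [c cab e] := MVT_segment ab (fun x _ => hf x) cf.
rewrite -subr_le0 e mulr_le0_ge0 ?subr_ge0//.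
by apply: hdf; move: cab; rewrite in_itv.
Qed.

Lemma is_derive_horner_cos p t :
  is_derive t 1 (fun t => p.[cos t]) (- sin t * p^`().[cos t]).
Proof.
have := @is_derive1_comp _ (horner p) (@cos R) t _ _ (is_derive_poly p (cos t)) (is_derive_cos t).
by move=> h; apply: (is_derive_eq h); rewrite mulrC.
Qed.

(* The energy [y^2 + y'^2 / L] of the damped oscillator
   [y'' + N cot(t) y' + L y = 0] solved by [y(t) = p(cos t)], written as a
   polynomial in [cos t]; [geg_cross] adds the cross term that makes it decay. *)
Definition geg_energy (L : R) p : {poly R} :=
  p ^+ 2 + L^-1 *: ((1 - 'X ^+ 2) * p^`() ^+ 2).

Definition geg_cross (N L : R) p : {poly R} :=
  geg_energy L p - (N / L) *: ('X * p * p^`()).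

Lemma deriv_geg_energy (N L : R) p : L != 0 -> geg_op (N + 1) p = - L *: p ->
  (geg_energy L p)^`() = (2 * N / L) *: ('X * p^`() ^+ 2).
Proof.
move=> L0 e.
rewrite /geg_energy derivD derivZ !deriv_exp derivM deriv_exp !poly.derivE /=.
apply: (@scalerI _ _ L) => //.
rewrite scalerDr scalerA divff// scale1r scalerA [L * _]mulrC mulfVK//.
apply/eqP; rewrite -subr_eq0.
rewrite (_ : _ - _ = 2 *: (p^`() * (geg_op (N + 1) p + L *: p))).
  by rewrite e scaleNr addNr mulr0 scaler0.
rewrite /geg_op -!mul_polyC; ring.
Qed.

Lemma geg_energy_le1 (N L : R) p x : 0 <= N -> 0 < L ->
  geg_op (N + 1) p = - L *: p -> p.[1] = 1 -> 0 <= x <= 1 ->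
  (geg_energy L p).[x] <= 1.
Proof.
move=> N0 L0 e p1 /andP[x0 x1].
have -> : 1 = (geg_energy L p).[1].
  by rewrite /geg_energy hornerD hornerZ (hornerM (1 - 'X ^+ 2)) hornerD hornerN hornerXn hornerC
    expr1n subrr mul0r mulr0 addr0 horner_exp p1 expr1n.
rewrite -lerN2.
apply: (@is_derive_ge (fun x => - (geg_energy L p).[x])
  (fun x => - (geg_energy L p)^`().[x])) => //.
move=> t /andP[t0 t1]; rewrite (deriv_geg_energy _ e) ?gt_eqF//.
rewrite oppr_le0 hornerZ hornerM hornerX.
apply: mulr_ge0; first by apply: divr_ge0; [rewrite mulr_ge0|exact: ltW].
by rewrite horner_exp mulr_ge0 ?sqr_ge0// (le_trans x0).
Qed.

(** With G the cross energy at cos t, this reads sin t dG/dt = - N cos t G + (N / L) p p'. Up to the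
    last term, G therefore decays like sin^(-N). The energy alone would not show this, since its
    derivative involves only p'^2. *)
Lemma deriv_geg_cross (N L : R) p : L != 0 -> geg_op (N + 1) p = - L *: p ->
  (1 - 'X ^+ 2) * (geg_cross N L p)^`() =
  N *: ('X * geg_cross N L p) - (N / L) *: (p * p^`()).
Proof.
move=> L0 e; rewrite /geg_cross derivD mulrDr (deriv_geg_energy L0 e).
rewrite derivN derivZ !derivM derivX /geg_energy.
apply/eqP; rewrite -subr_eq0.
have hL : L^-1 * L = 1 by rewrite mulVf.
rewrite (_ : _ - _ = - (N / L) *: ('X * p * (geg_op (N + 1) p + L *: p))
   + (N * (L^-1 * L - 1)) *: ('X * p ^+ 2)).
  by rewrite e hL subrr mulr0 scale0r addr0 [- L *: p]scaleNr addNr mulr0 scaler0.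
rewrite /geg_op -!mul_polyC; ring.
Qed.

(** The energy has the form y^2 + w^2, and both bounds come from 2 |y w| <= y^2 + w^2. The threshold
    [2 * N] makes the coefficient of |y w| in the cross term at most 1/2. *)
Lemma geg_cross_bound (N L x : R) p : 0 <= N -> 0 < L -> 0 < 1 - x ^+ 2 ->
  0 <= x <= 1 -> 2 * N <= Num.sqrt L * Num.sqrt (1 - x ^+ 2) ->
  `|(geg_cross N L p).[x] - (geg_energy L p).[x]| <=
    (geg_energy L p).[x] / 4 /\
  `|p.[x] * p^`().[x]| * (2 * Num.sqrt (1 - x ^+ 2)) <=
    Num.sqrt L * (geg_energy L p).[x].
Proof.
move=> N0 L0 s0 /andP[x0 x1].
set s := Num.sqrt (1 - x ^+ 2); set l := Num.sqrt L => h.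
have s2 : s ^+ 2 = 1 - x ^+ 2 by rewrite sqr_sqrtr// ltW.
have l2 : l ^+ 2 = L by rewrite sqr_sqrtr// ltW.
have sp : 0 < s by rewrite sqrtr_gt0.
have lp : 0 < l by rewrite sqrtr_gt0.
rewrite /geg_cross hornerD hornerN [in X in `|X|]addrC addKr normrN hornerZ.
have -> : ('X * p * p^`()).[x] = x * (p.[x] * p^`().[x]) by rewrite !hornerM hornerX mulrA.
have -> : (geg_energy L p).[x] = p.[x] ^+ 2 + L^-1 * (s ^+ 2 * p^`().[x] ^+ 2).
  by rewrite hornerD hornerZ (hornerM (1 - 'X ^+ 2)) !horner_exp hornerD hornerN hornerXn hornerC s2.
rewrite -l2; move: (p.[x]) (p^`().[x]) => y z.
set w := s * z / l.
have -> : (l ^+ 2)^-1 * (s ^+ 2 * z ^+ 2) = w ^+ 2.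
  by rewrite /w !exprMn exprVn mulrC.
have hz : z = w * l / s by rewrite /w; field; rewrite !gt_eqF.
have yw : `|y * w| *+ 2 <= y ^+ 2 + w ^+ 2.
  rewrite normrM -[y ^+ 2]real_normK ?num_real// -[w ^+ 2]real_normK ?num_real//.
  by rewrite -subr_ge0 (_ : _ - _ = (`|y| - `|w|) ^+ 2) ?sqr_ge0//; ring.
have e : `|y * z| = `|y * w| * (l / s).
  rewrite (_ : y * z = y * w * (l / s)); last by rewrite {1}hz; ring.
  by rewrite [LHS]normrM (gtr0_norm (divr_gt0 lp sp)).
split; last first.
  rewrite e (_ : _ * _ * _ = l * (`|y * w| *+ 2)); last by field; rewrite gt_eqF.
  by rewrite ler_pM2l.
rewrite normrM [`|x * _|]normrM e (ger0_norm x0) (ger0_norm (_ : 0 <= N / l ^+ 2)); last first.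
  by rewrite divr_ge0// sqr_ge0.
apply: (@le_trans _ _ (2^-1 * `|y * w|)); last by lra.
rewrite (_ : N / l ^+ 2 * (x * (`|y * w| * (l / s))) = (N * x / (l * s)) * `|y * w|); last by
  field; rewrite !gt_eqF.
apply: ler_wpM2r => //.
rewrite ler_pdivrMr ?mulr_gt0//.
apply: (le_trans (_ : _ <= N)); first by rewrite ler_piMr.
lra.
Qed.

Lemma geg_energy_ge0 (L x : R) p : 0 <= L -> 0 <= 1 - x ^+ 2 ->
  p.[x] ^+ 2 <= (geg_energy L p).[x].
Proof.
move=> L0 s0; rewrite hornerD hornerZ (hornerM (1 - 'X ^+ 2)) !horner_exp.
rewrite hornerD hornerN hornerXn hornerC lerDl.
apply: mulr_ge0; rewrite ?invr_ge0//; apply: mulr_ge0 => //; exact: sqr_ge0.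
Qed.

(* With [L = l^2], the product [sin^(N-1) (sin + (2N/l) cos) * cross] is
   nonincreasing once [l sin t >= 2N]; it compares the energy at [t] with the
   energy at the angle where [l sin = 2N]. *)
Lemma geg_energy_decay (N' : nat) (L t : R) p : 0 < L ->
  geg_op (N'.+1%:R + 1) p = - L *: p -> p.[1] = 1 -> 0 <= t <= pi / 2 ->
  2 * N'.+1%:R <= Num.sqrt L * sin t ->
  (geg_energy L p).[cos t] <= 16 * N'.+1%:R / (Num.sqrt L * sin t).
Proof.
move=> L0 e p1 /andP[t0 t1] hst.
set N : R := N'.+1%:R in e hst *; have N0 : 0 < N by rewrite ltr0n.
set l : R := Num.sqrt L in hst *.
have lp : 0 < l by rewrite sqrtr_gt0.
have l2 : l ^+ 2 = L by rewrite sqr_sqrtr// ltW.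
pose K := 2 * N / l; have K0 : 0 < K by rewrite divr_gt0// mulr_gt0.
have Kst : K <= sin t by rewrite ler_pdivrMr// [sin t * l]mulrC.
have Kl : K * l = 2 * N by rewrite mulfVK// gt_eqF.
have NK : N = K * l / 2 by rewrite Kl mulrC mulKf.
clearbody K.
have K1 : K <= 1 by rewrite (le_trans Kst)// sin_le1.
have KI : -1 <= K <= 1 by apply/andP; split=> //; lra.
have pi2 : - (pi / 2) <= 0 :> R by rewrite oppr_le0 divr_ge0// pi_ge0.
pose t' := asin K; have st' : sin t' = K by rewrite asinK// in_itv.
have t'1 : t' <= pi / 2 by exact: asin_lepi2.
have tI : t \in `[- (pi / 2), pi / 2] by rewrite in_itv /= t1 (le_trans pi2).
have t't : t' <= t.
  rewrite leNgt; apply/negP => tt'.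
  have : sin t < sin t' by rewrite ltr_sin// in_itv /= t'1 asin_geNpi2.
  by rewrite st' ltNge Kst.
have t'0 : 0 <= t'.
  rewrite leNgt; apply/negP => tt'.
  have : sin t' < sin 0.
    by rewrite ltr_sin// in_itv /= ?t'1 ?asin_geNpi2// pi2 divr_ge0// pi_ge0.
  by rewrite st' sin0 ltNge ltW.
pose E x := (geg_energy L p).[cos x]; pose G x := (geg_cross N L p).[cos x].
have hin x : t' <= x <= t -> [/\ K <= sin x, 0 <= cos x <= 1,
   `|G x - E x| <= E x / 4 & `|p.[cos x] * p^`().[cos x]| * (2 * sin x) <= l * E x].
  move=> /andP[xa xb].
  have xI : x \in `[- (pi / 2), pi / 2].
    by rewrite in_itv /= (le_trans pi2)//= ?(le_trans xb)// (le_trans t'0).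
  have Kx : K <= sin x.
    rewrite -st' leNgt; apply/negP; rewrite ltr_sin// ?ltNge ?xa//.
    by rewrite in_itv /= t'1 asin_geNpi2.
  have sx : Num.sqrt (1 - cos x ^+ 2) = sin x.
    by rewrite -sin2cos2 sqrtr_sqr ger0_norm// (le_trans (ltW K0)).
  have cx : 0 <= cos x <= 1.
    by rewrite cos_le1 cos_ge0_pihalf//; move: xI; rewrite in_itv.
  have h1 : 0 < 1 - cos x ^+ 2 by rewrite -sin2cos2 exprn_gt0// (lt_le_trans K0).
  have h2 : 2 * N <= Num.sqrt L * Num.sqrt (1 - cos x ^+ 2).
    by rewrite sx -/l -Kl mulrC ler_pM2l.
  have [] := @geg_cross_bound N L (cos x) p (ltW N0) L0 h1 cx h2.
  by rewrite sx; split.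
(* The factor sin^N would cancel the main term - N cos G. Replacing one sine by [sin x + K * cos x]
   adds a term [- K * G], which outweighs the remaining product p p'. *)
pose F x := sin x ^+ N' * (sin x + K * cos x) * G x.
have Ft : F t <= F t'.
  pose dF x := sin x ^+ N' * (sin x + K * cos x) * (- sin x * (geg_cross N L p)^`().[cos x])
     + G x * (sin x ^+ N' * (cos x - K * sin x)
          + (sin x + K * cos x) * (N'%:R * sin x ^+ N'.-1 * cos x)).
  apply: (@is_derive_ge F dF) => // [x|x hx].
    have hG := is_derive_horner_cos (geg_cross N L p) x.
    have hs := is_deriveX N' (is_derive_sin x); rewrite exprfctE in hs.
    have hc := is_deriveD (is_derive_sin x) (is_deriveZ K (is_derive_cos x)).
    have hF := is_deriveM (is_deriveM hs hc) hG.
    apply: (is_derive_eq hF).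
    rewrite -[RHS]/(dF x) /dF /G /GRing.scale /= mulrN.
    by [].
  have [Kx /andP[cx0 cx1] hG hE] := hin x hx.
  have sp : 0 < sin x by rewrite (lt_le_trans K0).
  rewrite -(pmulr_rle0 _ sp).
  have := congr1 (fun q => q.[cos x]) (deriv_geg_cross (lt0r_neq0 L0) e).
  rewrite /dF; move: hG; rewrite /G; move: (geg_cross N L p) => g hG.
  rewrite !(hornerD, hornerN, hornerZ, hornerM, hornerX, hornerXn, hornerC) /=.
  have := cos2Dsin2 x.
  have hN : sin x * (N'%:R * sin x ^+ N'.-1) = N'%:R * sin x ^+ N'.
    by case: (N') => [|n]; rewrite ?mul0r ?mulr0//= exprS mulrCA.
  have NE : N'%:R = N - 1 by rewrite /N -natr1 addrK.
  have NL : N / L = K / (2 * l).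
    by rewrite -l2 NK; field; rewrite gt_eqF.
  have Sp : 0 < sin x ^+ N' by rewrite exprn_gt0.
  have Ep : 0 <= E x by move: hG (normr_ge0 (g.[cos x] - E x)); lra.
  move: hG hE hN Sp; rewrite NL NE.
  move: (p.[cos x]) (p^`().[cos x]) (g.[cos x]) (g^`().[cos x]) (sin x ^+ N').
  move: (E x) Ep sp (sin x ^+ N'.-1) cx0 cx1 Kx => E0.
  move: (sin x) (cos x) => s c E0p sp S' c0 c1 Kx y z W D S hW hyz hN Sp cs hD.
  have -> : s * (S * (s + K * c) * (- s * D) +
      W * (S * (c - K * s) + (s + K * c) * ((N - 1) * S' * c))) =
    S * (K / (2 * l) * ((s + K * c) * (y * z)) - K * W).
    rewrite (_ : s * _ = S * (s + K * c) * - ((1 - c * c) * D)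
      + W * (S * s * (c - K * s) + (s + K * c) * c * (s * ((N - 1) * S')))
      + S * (s + K * c) * D * (1 - (c ^+ 2 + s ^+ 2))); last by ring.
    rewrite hD hN cs subrr mulr0 addr0.
    have -> : K * W = K * W * (c ^+ 2 + s ^+ 2) by rewrite cs mulr1.
    ring.
  rewrite pmulr_rle0// subr_le0.
  have h1 : (s + K * c) * (y * z) <= l * E0.
    apply: le_trans hyz; rewrite [leRHS]mulrC.
    have hh : s + K * c <= 2 * s.
      have Kc : K * c <= K by rewrite ler_piMr// ltW.
      by lra.
    apply: (le_trans (ler_norm _)); rewrite normrM ler_wpM2r//.
    by rewrite ger0_norm// addr_ge0 ?mulr_ge0// ltW.
  have h2 : K / (2 * l) * ((s + K * c) * (y * z)) <= K * (E0 / 2).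
    apply: (le_trans (_ : _ <= K / (2 * l) * (l * E0))).
      by rewrite ler_pM2l// divr_gt0// mulr_gt0.
    by rewrite le_eqVlt; apply/orP; left; apply/eqP; field; rewrite gt_eqF.
  apply: (le_trans h2); rewrite ler_pM2l//.
  by move: hW; rewrite ler_norml => /andP[]; lra.
have [_ /andP[c0 c1] hG hE] := hin t' ltac:(by rewrite lexx t't).
have [_ /andP[c0t c1t] hGt hEt] := hin t ltac:(by rewrite lexx t't).
have E1 : E t' <= 1 by apply: (geg_energy_le1 (ltW N0) L0 e p1); rewrite c0.
have Ep : 0 <= E t by move: hGt (normr_ge0 (G t - E t)); lra.
have st : 0 < sin t by rewrite (lt_le_trans K0).
move: Ft hG hGt; rewrite /F st' -/(E t); move: (G t) (G t') (E t') E1 (E t) Ep.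
move=> Gt Gt' Et' E1 Et Ep Ft hG hGt.
have G1 : Gt' <= 5 / 4 by move: hG; rewrite ler_norml => /andP[]; lra.
have G2 : 3 / 4 * Et <= Gt by move: hGt; rewrite ler_norml => /andP[]; lra.
have key : sin t ^+ N' * (sin t * (3 / 4 * Et)) <= K ^+ N' * (5 / 2 * K).
  have h1 : sin t ^+ N' * (sin t * (3 / 4 * Et)) <= sin t ^+ N' * (sin t + K * cos t) * Gt.
    rewrite -[leRHS]mulrA ler_pM2l ?exprn_gt0//.
    apply: ler_pM => //; [exact: ltW|lra|].
    by rewrite lerDl mulr_ge0// ltW.
  apply: (le_trans h1); apply: (le_trans Ft).
  rewrite -[leLHS]mulrA ler_pM2l ?exprn_gt0//.
  have Kc : K * cos t' <= K by rewrite ler_piMr// ltW.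
  have Kc0 : 0 <= K * cos t' by rewrite mulr_ge0// ltW.
  apply: (le_trans (_ : _ <= (K + K * cos t') * (5 / 4))).
    by rewrite ler_wpM2l// addr_ge0// ltW.
  by lra.
have key2 : sin t * (3 / 4 * Et) <= 5 / 2 * K.
  rewrite -(ler_pM2l (exprn_gt0 N' st)); apply: (le_trans key).
  rewrite ler_pM2r ?mulr_gt0//.
  by apply: lerXn2r; rewrite // nnegrE ltW.
rewrite ler_pdivlMr ?mulr_gt0//.
rewrite (_ : Et * (l * sin t) = l * 4 / 3 * (sin t * (3 / 4 * Et))); last by field.
apply: (le_trans (_ : _ <= l * 4 / 3 * (5 / 2 * K))).
  by rewrite ler_pM2l// divr_gt0// mulr_gt0.
rewrite (_ : l * 4 / 3 * _ = 20 / 3 * N); last first.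
  by rewrite NK; field.
by lra.
Qed.

Lemma sin_ge_half : exists2 t0 : R, 0 < t0 <= 1 & forall t, 0 <= t <= t0 -> t / 2 <= sin t.
Proof.
have c1 : (@cos R) @ (0 : R) --> (1 : R) by rewrite -cos0; exact: continuous_cos.
have /cvgrPdist_lt /(_ 2^-1) := c1; rewrite invr_gt0 ltr0Sn => /(_ isT).
move=> /nbhs_ballP[d /= d0 hd].
exists (Num.min 1 (d / 2)).
  by rewrite lt_min ltr01 divr_gt0//= ge_min lexx.
move=> t /andP[t0 td].
rewrite -subr_le0 -[leRHS](_ : (fun x => x / 2 - sin x) 0 = 0); last first.
  by rewrite sin0 mul0r subr0.
apply: (@is_derive_ge (fun x => x / 2 - sin x) (fun x => 2^-1 - cos x)) => // x.
  have := is_deriveB (is_deriveZ 2^-1 (is_derive_id x 1)) (is_derive_sin x).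
  rewrite /GRing.scale /= mulr1; congr is_derive; apply/funext => y /=.
  by rewrite mulrC.
move=> /andP[x0 xt].
have : ball 0 d x.
  rewrite /ball /= sub0r normrN ger0_norm// (le_lt_trans xt)// (le_lt_trans td)//.
  by rewrite gt_min orbC ltr_pdivrMr// ltr_pMr// ltr1n.
by move=> /hd /=; rewrite ltr_norml => /andP[]; lra.
Qed.

End GegenbauerDecay.

Section S. Variable R : realType.

Lemma geg_poly_half_ode (N' n : nat) :
  geg_op (N'.+1%:R + 1) (geg_poly (N'.+1%:R / 2) n) =
  - (n%:R * (n%:R + N'.+1%:R)) *: geg_poly (N'.+1%:R / 2) n :> {poly R}.
Proof.
have := geg_poly_ode (N'.+1%:R / 2 : R) n.
by rewrite (_ : 2 * (N'.+1%:R / 2) = N'.+1%:R)// mulrC divfK.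
Qed.

Lemma geg_poly_half1 (N' n : nat) : (geg_poly (N'.+1%:R / 2 : R) n).[1] = 1.
Proof. by rewrite horner_geg_poly1// divr_gt0. Qed.

Lemma geg_poly_le1 (N' n : nat) (t : R) : 0 <= t <= pi / 2 ->
  `|(geg_poly (N'.+1%:R / 2) n).[cos t]| <= 1.
Proof.
move=> /andP[t0 t1].
have c01 : 0 <= cos t <= 1.
  rewrite cos_le1 andbT cos_ge0_pihalf// t1 andbT (le_trans _ t0)//.
  by rewrite oppr_le0 divr_ge0// pi_ge0.
(* In degree 0 the frequency [L] is zero and the energy degenerates. *)
case: n => [|n].
  by rewrite /geg_poly gegC_poly0 /gegC /= invr1 scale1r hornerC normr1.
have L0 : (0 : R) < n.+1%:R * (n.+1%:R + N'.+1%:R) by rewrite mulr_gt0// addr_gt0.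
have := geg_energy_le1 (ler0n _ _) L0 (geg_poly_half_ode N' n.+1) (geg_poly_half1 _ _) c01.
move: (geg_poly _ _) => p h.
rewrite -(@expr_le1 _ 2)// real_normK ?num_real//; apply: le_trans h.
by apply: geg_energy_ge0; [exact: ltW|rewrite -sin2cos2 sqr_ge0].
Qed.

Lemma geg_poly_small (N' : nat) : exists (l : nat) (t0 : R), [/\ 0 < t0, t0 <= 1 &
  forall (t : R) n, 0 < t <= t0 -> l%:R <= n%:R * t ->
    `|(geg_poly (N'.+1%:R / 2) n).[cos t]| <= 4^-1].
Proof.
have [t0 /andP[t0p t01] hs] := sin_ge_half R.
(* Since sin t >= t / 2, this threshold gives 256 N <= sqrt(L) sin t, and the decay bound 16 N /
   (256 N) is the square of 1/4. *)
exists (512 * N'.+1)%N, t0; split=> // t n /andP[tp tt0] hn.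
have st : t / 2 <= sin t by apply: hs; rewrite ltW.
have n0 : (0 < n)%N.
  rewrite lt0n; apply/eqP => n0; move: hn; rewrite n0 mul0r.
  by rewrite leNgt ltr0n.
set N : R := N'.+1%:R; have N0 : 0 < N by rewrite ltr0n.
set L : R := n%:R * (n%:R + N).
have nR : 0 < n%:R :> R by rewrite ltr0n.
have L0 : 0 < L by rewrite mulr_gt0// addr_gt0.
have lL : n%:R <= Num.sqrt L.
  rewrite -[leLHS]ger0_norm ?(ltW nR)// -sqrtr_sqr ler_wsqrtr// expr2.
  by rewrite ler_pM2l// lerDl ltW.
have ls : 256 * N <= Num.sqrt L * sin t.
  apply: (le_trans (_ : _ <= n%:R * (t / 2))); last first.
    by apply: ler_pM => //; rewrite ?divr_ge0// ltW.
  by move: hn; rewrite natrM -/N; lra.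
have tpi : 0 <= t <= pi / 2.
  rewrite ltW//= (le_trans tt0)// (le_trans t01)// ler_pdivlMr// mul1r.
  exact: pi_ge2.
have lsN : 2 * N <= Num.sqrt L * sin t by apply: le_trans ls; rewrite ler_pM2r// ler_nat.
have := geg_energy_decay L0 (geg_poly_half_ode N' n) (geg_poly_half1 _ _) tpi lsN.
rewrite -/N; move: (geg_poly _ _) => p h.
have ls0 : 0 < Num.sqrt L * sin t by apply: lt_le_trans ls; rewrite mulr_gt0.
have h2 : p.[cos t] ^+ 2 <= 4^-1 ^+ 2.
  apply: (le_trans (geg_energy_ge0 _ (ltW L0) _)).
    by rewrite -sin2cos2 sqr_ge0.
  apply: (le_trans h); rewrite ler_pdivrMr//.
  by apply: (le_trans (_ : _ <= 4^-1 ^+ 2 * (256 * N))); [lra|rewrite ler_pM2l].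
by rewrite -(@ler_pXn2r _ 2)// ?nnegrE ?invr_ge0// real_normK ?num_real.
Qed.

End S.

(** * Functionals on continuous functions of the sphere *)

Section UniformlyContinuous.
Variable R : realType.
Implicit Types (V : normedModType R).

Lemma eq_of_dist_le (a b C : R) : (forall e, 0 < e -> `|a - b| <= C * e) -> a = b.
Proof.
move=> h; apply/eqP; rewrite -subr_eq0 -normr_le0; apply/ler_addgt0Pr => e e0.
rewrite add0r.
have C0 : 0 < `|C| + 1 by rewrite ltr_pwDr.
apply: (le_trans (h (e / (`|C| + 1)) _)); first by rewrite divr_gt0.
rewrite mulrA ler_pdivrMr// mulrC ler_pM2l//.
by rewrite (le_trans (ler_norm _))// lerDl.
Qed.

(* Boundedness is part of the definition so that products stay uniformly
   continuous without appealing to compactness. *)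
Definition ucb V (A : set V) (f : V -> R) : Prop :=
  (exists C, forall x, A x -> `|f x| <= C) /\
  (forall e, 0 < e -> exists2 d, 0 < d & forall x y, A x -> A y ->
     `|x - y| <= d -> `|f x - f y| <= e).

Section Closure.
Context {V : normedModType R}.
Variable A : set V.
Implicit Types f g : V -> R.

Lemma ucb_eq f g : (forall x, A x -> f x = g x) -> ucb A f -> ucb A g.
Proof.
move=> fg [[C hC] hu]; split.
  by exists C => x Ax; rewrite -fg// hC.
move=> e /hu[d d0 hd]; exists d => // x y Ax Ay xy.
by rewrite -!fg// hd.
Qed.

Lemma ucb_cst a : ucb A (fun=> a).
Proof.
split; first by exists `|a|.
by move=> e e0; exists 1 => // x y _ _ _; rewrite subrr normr0 ltW.
Qed.

Lemma ucb_bound f : ucb A f -> exists2 C, 0 < C & forall x, A x -> `|f x| <= C.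
Proof.
move=> [[C hC] _]; exists (`|C| + 1); first by rewrite ltr_pwDr.
by move=> x /hC h; rewrite (le_trans h)// (le_trans (ler_norm _))// lerDl.
Qed.

Lemma ucb_add f g : ucb A f -> ucb A g -> ucb A (fun x => f x + g x).
Proof.
move=> [[C hC] hu] [[D hD] hv]; split.
  by exists (C + D) => x Ax; rewrite (le_trans (ler_normD _ _))// lerD// ?hC ?hD.
move=> e e0; have e2 : 0 < e / 2 by rewrite divr_gt0.
have [d d0 hd] := hu _ e2; have [d' d'0 hd'] := hv _ e2.
exists (Num.min d d'); first by rewrite lt_min d0.
move=> x y Ax Ay; rewrite le_min => /andP[xy xy'].
rewrite opprD addrACA (le_trans (ler_normD _ _))// [leRHS]splitr.
by rewrite lerD// ?hd ?hd'.
Qed.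

Lemma ucb_mul f g : ucb A f -> ucb A g -> ucb A (fun x => f x * g x).
Proof.
move=> uf ug; have [C C0 hC] := ucb_bound uf; have [D D0 hD] := ucb_bound ug.
have [_ hu] := uf; have [_ hv] := ug; split.
  by exists (C * D) => x Ax; rewrite normrM ler_pM// ?hC ?hD.
move=> e e0.
have [d d0 hd] := hu _ (divr_gt0 e0 (mulr_gt0 (ltr0Sn R 1) D0)).
have [d' d'0 hd'] := hv _ (divr_gt0 e0 (mulr_gt0 (ltr0Sn R 1) C0)).
exists (Num.min d d'); first by rewrite lt_min d0.
move=> x y Ax Ay; rewrite le_min => /andP[xy xy'].
rewrite (_ : _ - _ = (f x - f y) * g x + f y * (g x - g y)); last by ring.
rewrite (le_trans (ler_normD _ _))// !normrM.
apply: (le_trans (_ : _ <= e / (2 * D) * D + C * (e / (2 * C)))).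
  by apply: lerD; apply: ler_pM; rewrite ?hd ?hd' ?hC ?hD.
by rewrite le_eqVlt; apply/orP; left; apply/eqP; field; rewrite !gt_eqF.
Qed.

Lemma ucb_scale a f : ucb A f -> ucb A (fun x => a * f x).
Proof. exact/ucb_mul/ucb_cst. Qed.

Lemma ucb_opp f : ucb A f -> ucb A (fun x => - f x).
Proof. by move=> /(ucb_scale (-1)); apply: ucb_eq => x _; rewrite mulN1r. Qed.

Lemma ucb_sub f g : ucb A f -> ucb A g -> ucb A (fun x => f x - g x).
Proof. by move=> uf ug; apply: ucb_add => //; exact: ucb_opp. Qed.

Lemma ucb_sum (I : Type) (r : seq I) (P : pred I) (F : I -> V -> R) :
  (forall i, P i -> ucb A (F i)) -> ucb A (fun x => \sum_(i <- r | P i) F i x).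
Proof.
move=> hF; elim: r => [|i r ih].
  by apply: (ucb_eq _ (ucb_cst 0)) => x _; rewrite big_nil.
case Pi: (P i).
  by apply: (ucb_eq _ (ucb_add (hF i Pi) ih)) => x _; rewrite big_cons Pi.
by apply: (ucb_eq _ ih) => x _; rewrite big_cons Pi.
Qed.

Lemma ucb_exp f n : ucb A f -> ucb A (fun x => f x ^+ n).
Proof.
move=> uf; elim: n => [|n ih]; first exact: ucb_cst.
by apply: (ucb_eq _ (ucb_mul uf ih)) => x _; rewrite exprS.
Qed.

Lemma ucb_horner (p : {poly R}) f : ucb A f -> ucb A (fun x => p.[f x]).
Proof.
move=> uf.
have u : ucb A (fun x => \sum_(i < size p) p`_i * f x ^+ i).
  by apply: ucb_sum => i _; apply/ucb_scale/ucb_exp.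
by apply: (ucb_eq _ u) => x _; rewrite horner_coef.
Qed.

Lemma ucb_unif_lim f : (forall e, 0 < e ->
    exists2 g, ucb A g & forall x, A x -> `|f x - g x| <= e) -> ucb A f.
Proof.
move=> h; split.
  have [g [[C hC] _] hg] := h 1 ltr01; exists (1 + C) => x Ax.
  rewrite -[f x](subrK (g x)) (le_trans (ler_normD _ _))//.
  by rewrite lerD ?hg ?hC.
move=> e e0; have e3 : 0 < e / 3 by rewrite divr_gt0.
have [g [_ hu] hg] := h _ e3; have [d d0 hd] := hu _ e3.
exists d => // x y Ax Ay xy.
rewrite (_ : f x - f y = (f x - g x) + (g x - g y) + - (f y - g y)); last by ring.
rewrite (le_trans (ler_normD _ _))// normrN.
have h1 := hg _ Ax; have h2 := hg _ Ay; have h3 := hd _ _ Ax Ay xy.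
by have h4 := ler_normD (f x - g x) (g x - g y); lra.
Qed.

End Closure.

Lemma ucb_comp {V W : normedModType R} (A : set V) (B : set W) (g : W -> V) f (C : R) :
  (forall x, B x -> A (g x)) ->
  (forall x y, B x -> B y -> `|g x - g y| <= C * `|x - y|) -> ucb A f -> ucb B (f \o g).
Proof.
move=> BA gl [[D hD] hu]; split.
  by exists D => x /BA/hD.
move=> e /hu[d d0 hd]; have C0 : 0 < `|C| + 1 by rewrite ltr_pwDr.
exists (d / (`|C| + 1)); first by rewrite divr_gt0.
move=> x y Bx By; rewrite ler_pdivlMr// => xy; apply: hd; [exact: BA..|].
apply: le_trans (gl _ _ Bx By) (le_trans _ xy); rewrite mulrC ler_wpM2l//.
by rewrite (le_trans (ler_norm _))// lerDl.
Qed.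

End UniformlyContinuous.

Section QuadratureFunctionals.
Variables (R : realType) (m : nat).
Local Notation E := (E R m).
Local Notation Sp := (@sphere R m : set E).
Implicit Types (J : (E -> R) -> R) (w : seq (R * E)) (f g : E -> R) (pos : bool).

Definition discr w f : R := \sum_(p <- w) p.1 * f p.2.

Definition quadrature pos J (M d : R) w : Prop :=
  [/\ forall p, p \in w -> Sp p.2 /\ (pos -> 0 <= p.1),
      \sum_(p <- w) `|p.1| <= M &
      forall f e, ucb Sp f ->
        (forall x y, Sp x -> Sp y -> `|x - y| <= d -> `|f x - f y| <= e) ->
        `|J f - discr w f| <= M * e].

(* Functionals on the continuous functions on the sphere that are integrals
   against a measure of total variation at most [M] (nonnegative if [pos]),
   described through finite quadratures uniform over equicontinuous functions;
   this makes exchange of integrals and positivity reduce to finite sums. *)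
Definition quadratic_limit pos J (M : R) : Prop :=
  0 <= M /\ forall d, 0 < d -> exists w, quadrature pos J M d w.

Lemma discr_lin w a f g :
  discr w (fun x => a * f x + g x) = a * discr w f + discr w g.
Proof.
rewrite /discr mulr_sumr -big_split /=; apply: eq_bigr => p _; ring.
Qed.

Lemma discr_bound w f C : 0 <= C -> (forall p, p \in w -> Sp p.2) ->
  (forall x, Sp x -> `|f x| <= C) -> `|discr w f| <= (\sum_(p <- w) `|p.1|) * C.
Proof.
move=> C0 hw hf; rewrite /discr mulr_suml (le_trans (ler_norm_sum _ _ _))//.
rewrite big_seq [leRHS]big_seq; apply: ler_sum => p pw.
by rewrite normrM ler_wpM2l// hf//; apply: hw.
Qed.

Section Theory.
Variables (pos : bool) (J : (E -> R) -> R) (M : R).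
Hypothesis hJ : quadratic_limit pos J M.

Lemma quad_M_ge0 : 0 <= M. Proof. by case: hJ. Qed.

Lemma quadrature_ucb f e : 0 < e -> ucb Sp f ->
  exists2 d, 0 < d & forall d' w, d' <= d -> quadrature pos J M d' w ->
    `|J f - discr w f| <= M * e.
Proof.
move=> e0 uf; have [_ /(_ e e0)[d d0 hd]] := uf.
exists d => // d' w d'd [_ _]; apply => // x y Sx Sy xy.
by apply: hd => //; exact: le_trans d'd.
Qed.

(** One finite sum approximates [J] on three functions at once; linearity, extensionality and
    positivity then pass from finite sums to [J]. *)
Lemma quad_common f g h e : 0 < e -> ucb Sp f -> ucb Sp g -> ucb Sp h ->
  exists w, [/\ forall p, p \in w -> Sp p.2 /\ (pos -> 0 <= p.1),
    \sum_(p <- w) `|p.1| <= M, `|J f - discr w f| <= M * e,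
    `|J g - discr w g| <= M * e & `|J h - discr w h| <= M * e].
Proof.
move=> e0 uf ug uh.
have [d1 d10 h1] := quadrature_ucb e0 uf.
have [d2 d20 h2] := quadrature_ucb e0 ug.
have [d3 d30 h3] := quadrature_ucb e0 uh.
pose d := Num.min d1 (Num.min d2 d3).
have d0 : 0 < d by rewrite !lt_min d10 d20.
have [_ /(_ d d0)[w hw]] := hJ; have [w1 w2 _] := hw.
exists w; split=> //.
- by apply: (h1 d w _ hw); rewrite ge_min lexx.
- by apply: (h2 d w _ hw); rewrite !ge_min lexx orbT.
- by apply: (h3 d w _ hw); rewrite !ge_min lexx !orbT.
Qed.

Lemma quad_lin a f g : ucb Sp f -> ucb Sp g ->
  J (fun x => a * f x + g x) = a * J f + J g.
Proof.
move=> uf ug; have ufg := ucb_add (ucb_scale a uf) ug.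
apply: (@eq_of_dist_le _ _ _ (M * (2 + `|a|))) => e e0.
have [w [_ _ h1 h2]] := quad_common e0 uf ug ufg.
rewrite discr_lin; set X := J (fun x => _); set Y := J f; set Z := J g => h3.
have h4 : `|a * (Y - discr w f)| <= `|a| * (M * e) by rewrite normrM ler_wpM2l.
rewrite (_ : _ - _ = (X - (a * discr w f + discr w g))
  - a * (Y - discr w f) - (Z - discr w g)); last by ring.
have n1 := ler_normB ((X - (a * discr w f + discr w g))
  - a * (Y - discr w f)) (Z - discr w g).
have n2 := ler_normB (X - (a * discr w f + discr w g)) (a * (Y - discr w f)).
rewrite /Y /Z in h1 h2 h4 n1 n2 *; lra.
Qed.

Lemma quad_ext f g : ucb Sp f -> (forall x, Sp x -> f x = g x) -> J f = J g.
Proof.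
move=> uf fg; have ug := ucb_eq fg uf.
apply: (@eq_of_dist_le _ _ _ (M * 2)) => e e0.
have [w [w1 _ h1 h2 _]] := quad_common e0 uf ug ug.
have e1 : discr w f = discr w g.
  rewrite /discr big_seq [RHS]big_seq; apply: eq_bigr => p /w1[Sp2 _].
  by rewrite fg.
rewrite e1 in h1.
by have := ler_normB (J f - discr w g) (J g - discr w g); rewrite opprB addrA subrK; lra.
Qed.

Lemma quad_bound f C : 0 <= C -> ucb Sp f -> (forall x, Sp x -> `|f x| <= C) -> `|J f| <= M * C.
Proof.
move=> C0 uf hf.
apply/ler_addgt0Pr => e e0.
have M1 : 0 < M + 1 by rewrite ltr_wpDl// quad_M_ge0.
have [w [w1 w2 h1 _ _]] := quad_common (divr_gt0 e0 M1) uf uf uf.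
have h2 := discr_bound C0 (fun p pw => (w1 p pw).1) hf.
have h3 : (\sum_(p <- w) `|p.1|) * C <= M * C by rewrite ler_wpM2r.
have h4 : M * (e / (M + 1)) <= e.
  by rewrite mulrCA ler_piMr// ?(ltW e0)// ler_pdivrMr// mul1r lerDl.
have := ler_normD (J f - discr w f) (discr w f); rewrite subrK; lra.
Qed.

Lemma quad_ge0 f : pos -> ucb Sp f -> (forall x, Sp x -> 0 <= f x) -> 0 <= J f.
Proof.
move=> hp uf hf; rewrite -oppr_le0; apply/ler_addgt0Pr => e e0.
have M1 : 0 < M + 1 by rewrite ltr_wpDl// quad_M_ge0.
have [w [w1 w2 h1 _ _]] := quad_common (divr_gt0 e0 M1) uf uf uf.
have h4 : M * (e / (M + 1)) <= e.
  by rewrite mulrCA ler_piMr// ?(ltW e0)// ler_pdivrMr// mul1r lerDl.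
have h2 : 0 <= discr w f.
  rewrite /discr big_seq; apply: sumr_ge0 => p /w1[Sp2 p1].
  by rewrite mulr_ge0 ?hf ?p1.
by move: h1; rewrite ler_norml => /andP[]; lra.
Qed.

Lemma quad0 : J (fun=> 0) = 0.
Proof.
have := quad_lin 1 (ucb_cst Sp 0) (ucb_cst Sp 0).
have -> : (fun=> 1 * 0 + 0) = (fun=> 0) :> (E -> R) by apply/funext => x; ring.
by rewrite mul1r => h; lra.
Qed.

Lemma quadD f g : ucb Sp f -> ucb Sp g -> J (fun x => f x + g x) = J f + J g.
Proof.
move=> uf ug; have := quad_lin 1 uf ug; rewrite mul1r => <-.
by congr J; apply/funext => x; rewrite mul1r.
Qed.

Lemma quadZ a f : ucb Sp f -> J (fun x => a * f x) = a * J f.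
Proof.
move=> uf; have := quad_lin a uf (ucb_cst Sp 0); rewrite quad0 addr0 => <-.
by congr J; apply/funext => x; rewrite addr0.
Qed.

Lemma quadN f : ucb Sp f -> J (fun x => - f x) = - J f.
Proof.
move=> uf; have := quadZ (-1) uf; rewrite mulN1r => <-.
by congr J; apply/funext => x; rewrite mulN1r.
Qed.

Lemma quadB f g : ucb Sp f -> ucb Sp g -> J (fun x => f x - g x) = J f - J g.
Proof. by move=> uf ug; rewrite quadD ?quadN//; exact: ucb_opp. Qed.

Lemma quad_sum (I : Type) (r : seq I) (P : pred I) (F : I -> E -> R) :
  (forall i, P i -> ucb Sp (F i)) ->
  J (fun x => \sum_(i <- r | P i) F i x) = \sum_(i <- r | P i) J (F i).
Proof.
move=> hF; elim: r => [|i r ih].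
  by rewrite big_nil -[RHS]quad0; congr J; apply/funext => x; rewrite big_nil.
case Pi: (P i); rewrite big_cons Pi -ih.
  rewrite -quadD; [|exact: hF|exact: ucb_sum].
  by congr J; apply/funext => x; rewrite big_cons Pi.
by congr J; apply/funext => x; rewrite big_cons Pi.
Qed.

Lemma quad_le f g : pos -> ucb Sp f -> ucb Sp g ->
  (forall x, Sp x -> f x <= g x) -> J f <= J g.
Proof.
move=> hp uf ug fg; rewrite -subr_ge0 -quadB//.
by apply: quad_ge0 => //; [exact: ucb_sub|move=> x Sx; rewrite subr_ge0 fg].
Qed.

Lemma quad_norm_le f g : pos -> ucb Sp f -> ucb Sp g ->
  (forall x, Sp x -> `|f x| <= g x) -> `|J f| <= J g.
Proof.
move=> hp uf ug fg; rewrite ler_norml -quadN//.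
have h x : Sp x -> - g x <= f x <= g x by move=> /fg; rewrite ler_norml.
have ung := ucb_opp ug.
by apply/andP; split; apply: quad_le => // x /h/andP[].
Qed.

Lemma quad_dist f g C : 0 <= C -> ucb Sp f -> ucb Sp g ->
  (forall x, Sp x -> `|f x - g x| <= C) -> `|J f - J g| <= M * C.
Proof. by move=> C0 uf ug fg; rewrite -quadB// quad_bound//; exact: ucb_sub. Qed.

Lemma ucb_section (V : normedModType R) (A : set V) (F : V * E -> R) v :
  ucb (A `*` Sp) F -> A v -> ucb Sp (fun y => F (v, y)).
Proof.
move=> uF Av; apply: (@ucb_comp _ _ _ _ _ (fun y => (v, y)) F 1 _ _ uF) => //.
move=> x y _ _; rewrite mul1r prod_normE /= subrr normr0.
by rewrite ge_max lexx normr_ge0.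
Qed.

Lemma ucb_param (V : normedModType R) (A : set V) (F : V * E -> R) :
  ucb (A `*` Sp) F -> ucb A (fun v => J (fun y => F (v, y))).
Proof.
move=> uF; have [C C0 hC] := ucb_bound uF; split.
  exists (M * C) => v Av; apply: quad_bound; rewrite ?(ltW C0)//.
    exact: ucb_section uF Av.
  by move=> x Sx; apply: hC.
have [_ hu] := uF => e e0.
have M1 : 0 < M + 1 by rewrite ltr_wpDl// quad_M_ge0.
have [d d0 hd] := hu _ (divr_gt0 e0 M1); exists d => // x y Ax Ay xy.
have h4 : M * (e / (M + 1)) <= e.
  by rewrite mulrCA ler_piMr// ?(ltW e0)// ler_pdivrMr// mul1r lerDl.
apply: le_trans h4; apply: quad_dist.
- by rewrite divr_ge0// ltW.
- exact: ucb_section uF Ax.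
- exact: ucb_section uF Ay.
move=> z Sz; apply: hd => //.
by rewrite prod_normE /= subrr normr0 ge_max xy (le_trans _ xy).
Qed.

End Theory.

Section Fubini.
Variables (pos pos' : bool) (J J' : (E -> R) -> R) (M M' : R).
Hypotheses (hJ : quadratic_limit pos J M) (hJ' : quadratic_limit pos' J' M').

Lemma ucb_swap (F : E * E -> R) : ucb (Sp `*` Sp) F -> ucb (Sp `*` Sp) (fun p => F (p.2, p.1)).
Proof.
move=> uF; apply: (@ucb_comp _ _ _ _ _ (fun p : E * E => (p.2, p.1)) F 1 _ _ uF).
  by move=> p [].
by move=> x y _ _; rewrite mul1r !prod_normE /= maxC.
Qed.

(** The functions [fun y => F (x, y)] share one modulus of continuity, so a single quadrature
    replaces [J'] for all [x]; [J] commutes with the resulting finite sum. *)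
Lemma quad_fubini (F : E * E -> R) : ucb (Sp `*` Sp) F ->
  J (fun x => J' (fun y => F (x, y))) = J' (fun y => J (fun x => F (x, y))).
Proof.
move=> uF; have uF' := ucb_swap uF.
have u1 := ucb_param hJ' uF; have u2 := ucb_param hJ uF'.
have M0 := quad_M_ge0 hJ; have M'0 := quad_M_ge0 hJ'.
apply: (@eq_of_dist_le _ _ _ (2 * (M * M'))) => e e0.
have [_ /(_ e e0)[d d0 hd]] := uF.
have [_ /(_ d d0)[w [w1 w2 w3]]] := hJ'.
have sec y : Sp y -> ucb Sp (fun x => F (x, y)) by exact: ucb_section uF'.
have h1 : `|J (fun x => J' (fun y => F (x, y))) - J (fun x => discr w (fun y => F (x, y)))|
    <= M * (M' * e).
  apply: (quad_dist hJ) => //; first by rewrite mulr_ge0// ltW.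
    rewrite /discr; under eq_fun do rewrite big_seq; apply: ucb_sum => p /w1[Sp2 _].
    exact/ucb_scale/sec.
  move=> x Sx; apply: w3 => [|y z Sy Sz yz]; first exact: ucb_section uF Sx.
  by apply: hd => //; rewrite prod_normE /= subrr normr0 ge_max yz ltW.
have h2 : J (fun x => discr w (fun y => F (x, y))) = discr w (fun y => J (fun x => F (x, y))).
  rewrite /discr big_seq.
  under eq_bigr => p /w1[Sp2 _] do rewrite -(quadZ hJ _ (sec _ Sp2)).
  rewrite -(quad_sum hJ); last by move=> p /w1[Sp2 _]; exact/ucb_scale/sec.
  by congr J; apply/funext => x; rewrite big_seq.
have h3 : `|J' (fun y => J (fun x => F (x, y))) - discr w (fun y => J (fun x => F (x, y)))|
   <= M' * (M * e).
  apply: w3 => // y z Sy Sz yz; apply: (quad_dist hJ); rewrite ?(ltW e0)//; try exact: sec.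
  by move=> x Sx; apply: hd => //; rewrite prod_normE /= subrr normr0 ge_max yz ltW.
rewrite h2 in h1; rewrite distrC in h3.
have := ler_distD (discr w (fun y => J (fun x => F (x, y))))
  (J (fun x => J' (fun y => F (x, y)))) (J' (fun y => J (fun x => F (x, y)))).
lra.
Qed.

End Fubini.
End QuadratureFunctionals.

Section CompactUcb.
Variable R : realType.

Lemma compact_ucb (V : normedModType R) (A : set V) (f : V -> R) : compact A ->
  {within A, continuous f} -> ucb A f.
Proof.
move=> cA cf; split.
  have /compact_bounded[M [_ hM]] := continuous_compact cf cA.
  exists (M + 1) => x Ax; apply: (hM (M + 1)); first by rewrite ltrDl.
  by exists x.
move=> e e0; have e2 : 0 < e / 2 by rewrite divr_gt0.
have /compact_near_coveringP/near_covering_withinP := cA.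
move=> /(_ R 0^'+ (fun d x => forall y, A y -> `|x - y| <= d -> `|f x - f y| <= e)).
move=> /(_ _ _) [].
  move=> x Ax; have /subspace_continuousP/(_ x Ax) := cf.
  move=> /cvgrPdist_lt /(_ _ e2).
  rewrite near_withinE => /nbhs_ballP[r /= r0 hr].
  exists (ball x (r / 2), [set d | 0 < d < r / 2]) => /=.
    split; first by apply: nbhsx_ballx; rewrite divr_gt0.
    exists (r / 2); first by rewrite /= divr_gt0.
    move=> d /=; rewrite sub0r normrN => dr d0; rewrite d0 /=.
    by rewrite (le_lt_trans (ler_norm _)).
  move=> [x' d] /= [hx /andP[d0 dr]] Ax' y Ay x'y.
  have h1 : `|f x - f x'| < e / 2.
    apply: hr => //; apply: le_ball hx; by rewrite ler_pdivrMr// ler_pMr// ler1n.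
  have h2 : `|f x - f y| < e / 2.
    apply: hr => //; rewrite -ball_normE /= in hx *.
    have := ler_distD x' x y; lra.
  by rewrite distrC in h1; have := ler_distD (f x) (f x') (f y); lra.
move=> d /= d0 hd; exists (d / 2); first by rewrite divr_gt0.
move=> x y Ax Ay xy; apply: (hd (d / 2)) => //=.
- by rewrite sub0r normrN ger0_norm ?divr_ge0 ?(ltW d0)// ltr_pdivrMr// ltr_pMr// ltr1n.
- by rewrite divr_gt0.
Qed.

End CompactUcb.

(** * Inner product and rotations on the sphere *)

Section SphereGeometry.
Variables (R : realType) (m : nat).
Local Notation E := (E R m).
Local Notation Sp := (@sphere R m : set E).
Implicit Types (x y z : E) (O : 'M[R]_(m.+1)).

Lemma coord_le_norm x i : `|x 0 i| <= `|x|.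
Proof.
rewrite [leRHS]/Num.norm /= mx_normrE.
by apply: (le_bigmax _ (fun k => `|x k.1 k.2|) (0, i)).
Qed.

Lemma norm_le_coord x C : 0 <= C -> (forall i, `|x 0 i| <= C) -> `|x| <= C.
Proof.
move=> C0 h; rewrite [leLHS]/Num.norm /= mx_normrE.
apply/bigmax_leP; split=> //= -[i j] _ /=; rewrite ord1; exact: h.
Qed.

Lemma dotC x y : dot x y = dot y x.
Proof. by apply: eq_bigr => i _; rewrite mulrC. Qed.

Lemma dotDl x y z : dot (x + y) z = dot x z + dot y z.
Proof. by rewrite /dot -big_split; apply: eq_bigr => i _; rewrite mxE mulrDl. Qed.

Lemma dotZl a x y : dot (a *: x) y = a * dot x y.
Proof. by rewrite /dot mulr_sumr; apply: eq_bigr => i _; rewrite mxE mulrA. Qed.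

Lemma dotDr x y z : dot x (y + z) = dot x y + dot x z.
Proof. by rewrite dotC dotDl dotC (dotC z). Qed.

Lemma dotZr a x y : dot x (a *: y) = a * dot x y.
Proof. by rewrite dotC dotZl dotC. Qed.

Lemma dotNl x y : dot (- x) y = - dot x y.
Proof. by rewrite -scaleN1r dotZl mulN1r. Qed.

Lemma dotNr x y : dot x (- y) = - dot x y.
Proof. by rewrite dotC dotNl dotC. Qed.

Lemma dot_mx x y : dot x y = (x *m y^T) 0 0.
Proof. by rewrite mxE; apply: eq_bigr => i _; rewrite mxE. Qed.

Lemma dot_ge0 x : 0 <= dot x x.
Proof. by apply: sumr_ge0 => i _; rewrite -expr2 sqr_ge0. Qed.

Lemma dot_eq0 x : dot x x = 0 -> x = 0.
Proof.
move=> /eqP; rewrite psumr_eq0 => [/allP h|i _]; last by rewrite -expr2 sqr_ge0.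
apply/rowP => i; rewrite mxE.
by have := h i (mem_index_enum i); rewrite /= -expr2 sqrf_eq0 => /eqP.
Qed.

Lemma sphere_coord x i : Sp x -> `|x 0 i| <= 1.
Proof.
move=> Sx; rewrite -(@expr_le1 _ 2)// real_normK ?num_real//.
rewrite -Sx /dot (bigD1 i)//= -expr2 lerDl.
by apply: sumr_ge0 => j _; rewrite -expr2 sqr_ge0.
Qed.

Lemma sphere_norm x : Sp x -> `|x| <= 1.
Proof. by move=> Sx; apply: norm_le_coord => // i; exact: sphere_coord. Qed.

Lemma sphere_dot x y : Sp x -> Sp y -> -1 <= dot x y <= 1.
Proof.
move=> Sx Sy; have h1 := dot_ge0 (x + y); have h2 := dot_ge0 (x - y).
rewrite !(dotDl, dotDr, dotNl, dotNr) in h1 h2.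
rewrite (dotC y x) /sphere /= in Sx Sy h1 h2 *; rewrite Sx Sy in h1 h2.
by apply/andP; split; lra.
Qed.

(** The norm on [E] is the maximum norm, so only an inequality holds here; [cap_dot] is the
    converse, with the factor [m.+1]. *)
Lemma dist_dot x y : Sp x -> Sp y -> `|x - y| ^+ 2 <= 2 - 2 * dot x y.
Proof.
move=> Sx Sy.
have -> : 2 - 2 * dot x y = dot (x - y) (x - y).
  rewrite !(dotDl, dotDr, dotNl, dotNr) (dotC y x).
  by rewrite /sphere /= in Sx Sy; rewrite Sx Sy; ring.
have h i : (x - y) 0 i ^+ 2 <= dot (x - y) (x - y).
  by rewrite /dot (bigD1 i)//= expr2 lerDl; apply: sumr_ge0 => j _; rewrite -expr2 sqr_ge0.
rewrite -[leRHS]sqr_sqrtr ?dot_ge0// ler_pXn2r ?nnegrE ?sqrtr_ge0//.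
apply: norm_le_coord => [|i]; first exact: sqrtr_ge0.
by rewrite -sqrtr_sqr ler_wsqrtr.
Qed.

Lemma act_dot O x y : O^T *m O = 1%:M -> dot (act O x) (act O y) = dot x y.
Proof.
move=> hO; rewrite !dot_mx /act trmx_mul trmxK mulmxA -(mulmxA x) hO.
by rewrite mulmx1.
Qed.

Lemma orthogonal_tr O : O^T *m O = 1%:M -> O *m O^T = 1%:M.
Proof. exact: mulmx1C. Qed.

Lemma act_trK O x : O^T *m O = 1%:M -> act O^T (act O x) = x.
Proof. by move=> hO; rewrite /act trmxK -mulmxA hO mulmx1. Qed.

Lemma actK O x : O^T *m O = 1%:M -> act O (act O^T x) = x.
Proof.
by move=> /orthogonal_tr hO; rewrite /act trmxK -mulmxA hO mulmx1.
Qed.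

Lemma rotation_tr O : rotation O -> rotation O^T.
Proof. by move=> [h d]; split; rewrite ?trmxK ?det_tr//; exact: orthogonal_tr. Qed.

Lemma act_sphere O x : rotation O -> Sp x -> Sp (act O x).
Proof. by move=> [hO _] Sx; rewrite /sphere /= act_dot. Qed.

Lemma act_dot_tr O x y : rotation O -> dot x (act O y) = dot (act O^T x) y.
Proof. by move=> [hO _]; rewrite -{1}(actK x hO) act_dot. Qed.

Lemma ucb_coord i : ucb Sp (fun x => x 0 i).
Proof.
split; first by exists 1 => x; exact: sphere_coord.
move=> e e0; exists e => // x y _ _; apply: le_trans.
by have := coord_le_norm (x - y) i; rewrite !mxE.
Qed.

(** Composition with Lipschitz maps preserves [ucb]; this notion allows functions of several points
    to be assembled from functions on the sphere. *)
Definition sphere_valued (V : normedModType R) (A : set V) (a : V -> E) : Prop :=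
  (forall v, A v -> Sp (a v)) /\
  exists C, forall v w, A v -> A w -> `|a v - a w| <= C * `|v - w|.

Lemma ucb_sphere_valued (V : normedModType R) (A : set V) a f :
  sphere_valued A a -> ucb Sp f -> ucb A (fun v => f (a v)).
Proof. by move=> [h1 [C h2]] uf; exact: (ucb_comp h1 h2 uf). Qed.

Lemma ucb_sphere_valued2 (V : normedModType R) (A : set V) a b (F : E * E -> R) :
  sphere_valued A a -> sphere_valued A b -> ucb (Sp `*` Sp) F ->
  ucb A (fun v => F (a v, b v)).
Proof.
move=> [h1 [C h2]] [h3 [D h4]] uF.
apply: (@ucb_comp _ _ _ _ _ (fun v => (a v, b v)) F (Num.max C D) _ _ uF).
  by move=> x Ax; split; [exact: h1|exact: h3].
move=> x y Ax Ay; rewrite prod_normE /= ge_max.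
apply/andP; split.
  by apply: (le_trans (h2 _ _ Ax Ay)); rewrite ler_wpM2r// le_max lexx.
by apply: (le_trans (h4 _ _ Ax Ay)); rewrite ler_wpM2r// le_max lexx orbT.
Qed.

Lemma ucb_dot (V : normedModType R) (A : set V) a b :
  sphere_valued A a -> sphere_valued A b -> ucb A (fun v => dot (a v) (b v)).
Proof.
by move=> ha hb; apply: ucb_sum => i _; apply: ucb_mul;
  apply: (ucb_sphere_valued _ (ucb_coord i)).
Qed.

Lemma sphere_valued_id : sphere_valued Sp id.
Proof. by split=> //; exists 1 => x y _ _; rewrite mul1r. Qed.

Lemma sphere_valued_cst (V : normedModType R) (A : set V) x : Sp x ->
  sphere_valued A (fun=> x).
Proof. by split=> //; exists 0 => y z _ _; rewrite subrr normr0 mul0r. Qed.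

Lemma sphere_valued_fst (V : normedModType R) (A : set V) a :
  sphere_valued A a -> sphere_valued (A `*` Sp) (fun p => a p.1).
Proof.
move=> [h1 [C h2]]; split; first by move=> p [/h1].
exists `|C| => x y [Ax _] [Ay _]; apply: (le_trans (h2 _ _ Ax Ay)).
apply: (le_trans (_ : _ <= `|C| * `|x.1 - y.1|)).
  by rewrite ler_wpM2r// ler_norm.
by rewrite ler_wpM2l// prod_normE /= le_max lexx.
Qed.

Lemma sphere_valued_snd (V : normedModType R) (A : set V) :
  sphere_valued (A `*` Sp) (fun p => p.2).
Proof.
split; first by move=> p [].
by exists 1 => x y _ _; rewrite mul1r prod_normE /= le_max lexx orbT.
Qed.

Lemma act_norm O x : `|act O x| <= (\sum_i \sum_j `|O i j|) * `|x|.
Proof.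
have s0 i : 0 <= \sum_j `|O i j| by apply: sumr_ge0.
apply: norm_le_coord => [|i]; first by rewrite mulr_ge0// sumr_ge0.
rewrite mxE (le_trans (ler_norm_sum _ _ _))//.
apply: (le_trans (_ : _ <= (\sum_j `|O i j|) * `|x|)).
  rewrite mulr_suml; apply: ler_sum => j _; rewrite normrM mxE mulrC.
  by rewrite ler_wpM2l// coord_le_norm.
by rewrite ler_wpM2r// [leRHS](bigD1 i)//= lerDl sumr_ge0.
Qed.

Lemma sphere_valued_act (V : normedModType R) (A : set V) O a : rotation O ->
  sphere_valued A a -> sphere_valued A (fun v => act O (a v)).
Proof.
move=> hO [h1 [C h2]]; split; first by move=> v /h1; exact: act_sphere.
exists ((\sum_i \sum_j `|O i j|) * C) => v w Av Aw.
rewrite -mulrA (_ : _ - _ = act O (a v - a w)); last by rewrite /act mulmxBl.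
apply: (le_trans (act_norm _ _)); rewrite ler_wpM2l ?h2//.
by apply: sumr_ge0 => i _; apply: sumr_ge0.
Qed.

Lemma sphere_closed : closed Sp.
Proof.
have -> : Sp = (fun x => dot x x) @^-1` [set 1] by [].
apply: closed_comp; last exact: closed_eq.
move=> x _; apply: (@continuous_big R _ +%R 0 xpredT _ E (index_enum 'I_m.+1)
  (fun i x => x 0 i * x 0 i)) => [|i _ y].
  exact: add_continuous.
have h : continuous (fun M : 'rV[R]_(m.+1) => M 0 i) by exact: coord_continuous.
exact: (cvgM (h y) (h y)).
Qed.

Lemma sphere_compact : compact Sp.
Proof.
apply: bounded_closed_compact sphere_closed.
exists 1; split; first exact: num_real.
move=> C C1 x Sx; exact: le_trans (sphere_norm Sx) (ltW C1).
Qed.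

End SphereGeometry.

(** * Integrals against finite Borel measures as limits of quadratures *)

Section SphereIntegration.
Variables (R : realType) (m : nat).
Local Notation E := (E R m).
Local Notation SM := (SM R m).
Local Notation Sp := (@sphere R m : set E).
Local Notation measureS := {measure set SM -> \bar R}.
Implicit Types (mu : measureS) (f g : E -> R).

Lemma open_measurable_sphere (A : set E) : open A -> measurable (A : set SM).
Proof. by move=> oA; apply: sub_sigma_algebra. Qed.

Lemma sphere_measurable : measurable (@sphere R m).
Proof.
have -> : @sphere R m = ~` (~` Sp) by rewrite setCK.
apply: measurableC; apply: open_measurable_sphere.
by rewrite openC; exact: sphere_closed.
Qed.

Lemma ball_measurable (c : E) d : measurable (ball c d : set SM).
Proof. by apply: open_measurable_sphere; exact: ball_open. Qed.

Lemma act_measurable (O : 'M[R]_(m.+1)) : measurable_fun setT (act O : SM -> SM).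
Proof.
apply: (@measurability _ _ SM SM setT _ (@open E)) => //.
move=> _ [A oA <-]; rewrite setTI; apply: open_measurable_sphere.
rewrite openE => x /= Ax.
have /nbhs_ballP[r /= r0 hr] : nbhs (act O x) A by exact: open_nbhs_nbhs.
have C0 : 0 < (\sum_i \sum_j `|O i j|) + 1.
  by rewrite ltr_wpDl//; apply: sumr_ge0 => i _; apply: sumr_ge0.
apply/nbhs_ballP; exists (r / ((\sum_i \sum_j `|O i j|) + 1)) => /=.
  by rewrite divr_gt0.
move=> y; rewrite -ball_normE /= => xy; apply: hr; rewrite -ball_normE /=.
rewrite (_ : _ - _ = act O (x - y)); last by rewrite /act mulmxBl.
apply: (le_lt_trans (act_norm _ _)).
apply: (le_lt_trans (_ : _ <= ((\sum_i \sum_j `|O i j|) + 1) * `|x - y|)).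
  by rewrite ler_wpM2r// lerDl.
by rewrite mulrC -ltr_pdivlMr.
Qed.

Lemma ucb_measurable f : ucb Sp f -> measurable_fun (@sphere R m) (f : SM -> R).
Proof.
move=> [_ hf]; apply: (measurability _ (RGenOInfty.measurableE R)).
move=> _ [_ [a ->] <-].
(* [f] is controlled only along the sphere, so its superlevel set is written as the trace of an open
   set: the union of the balls on whose trace [f] exceeds [a]. *)
pose U : set E := \bigcup_(p in [set p : E * R |
  forall z, Sp z -> ball p.1 p.2 z -> a < f z]) ball p.1 p.2.
have -> : (@sphere R m `&` f @^-1` `]a, +oo[)%classic = (@sphere R m `&` U)%classic.
  apply/seteqP; split=> x [Sx].
    rewrite /= in_itv /= andbT => ax; split=> //.
    have e0 : 0 < (f x - a) / 2 by rewrite divr_gt0// subr_gt0.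
    have [d d0 hd] := hf _ e0; exists (x, d) => /=; last exact: ballxx.
    move=> z Sz; rewrite -ball_normE /= => xz.
    have := hd x z Sx Sz (ltW xz); rewrite ler_norml => /andP[_]; lra.
  by move=> [p hp px]; split=> //=; rewrite in_itv /= andbT; exact: hp.
apply: measurableI; first exact: sphere_measurable.
apply: open_measurable_sphere; apply: bigcup_open => p _; exact: ball_open.
Qed.

Lemma finite_measure_lty mu (A : set SM) : (mu setT < +oo)%E -> measurable A ->
  (mu A < +oo)%E.
Proof.
move=> fin mA; apply: le_lt_trans fin.
by apply: le_measure; rewrite ?inE//; exact: measurableT.
Qed.

Lemma ucb_integrable mu f : (mu setT < +oo)%E -> ucb Sp f ->
  mu.-integrable (@sphere R m) (EFin \o (f : SM -> R)).
Proof.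
move=> fin uf; apply: measurable_bounded_integrable.
- exact: sphere_measurable.
- by apply: finite_measure_lty => //; exact: sphere_measurable.
- exact: ucb_measurable.
have [[C hC] _] := uf.
exists C; split; first exact: num_real.
by move=> D CD x Sx; rewrite /= (le_trans (hC x Sx))// ltW.
Qed.

(** The pieces and their nodes depend on the cover alone, so that different measures can be compared
    on the same nodes. *)
Fixpoint cover_pieces (d : R) (D : set SM) (cs : seq E) : seq (set SM * E) :=
  if cs is c :: cs' then
    (D `&` ball c d, c) :: cover_pieces d (D `\` ball c d) cs'
  else [::].

Lemma cover_pieces_eq d D cs (g h : set SM -> R) f : measurable D ->
  (forall A, measurable A -> g A = h A) ->
  \sum_(p <- cover_pieces d D cs) g p.1 * f p.2 =
  \sum_(p <- cover_pieces d D cs) h p.1 * f p.2.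
Proof.
move=> + gh; elim: cs D => [|c cs ih] D mD /=; first by rewrite !big_nil.
rewrite !big_cons /= gh; last by apply: measurableI => //; exact: ball_measurable.
by rewrite ih//; apply: measurableD => //; exact: ball_measurable.
Qed.

(** Taking preimages under [phi] makes this a statement about the image of [mu] under [phi]. With
    [phi] a rotation or the identity, a change of variables becomes a comparison of two quadratures
    on common nodes. *)
Lemma cover_pieces_quadrature mu (phi : SM -> SM) d D cs :
  (mu setT < +oo)%E -> measurable_fun setT phi ->
  measurable D -> D `<=` @sphere R m ->
  (forall x, D x -> exists2 c, c \in cs & ball c d x) ->
  (forall c, c \in cs -> Sp c) ->
  \sum_(p <- cover_pieces d D cs) fine (mu (phi @^-1` p.1)) =
    fine (mu (phi @^-1` D)) /\
  forall f e, ucb Sp f ->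
    (forall x y, Sp x -> Sp y -> `|x - y| <= d -> `|f x - f y| <= e) ->
    `|RintS mu (phi @^-1` D) (f \o phi) -
      \sum_(p <- cover_pieces d D cs) fine (mu (phi @^-1` p.1)) * f p.2|
    <= fine (mu (phi @^-1` D)) * e.
Proof.
move=> fin mphi; elim: cs D => [|c cs ih] D mD DS cov hcs.
  have -> : D = set0 by apply/seteqP; split=> // x /cov[].
  rewrite preimage_set0 measure0; split=> [|f e _ _]; first by rewrite big_nil.
  by rewrite /RintS integral_set0 big_nil subrr normr0 mul0r.
have mB := @ball_measurable c d.
have mD1 : measurable (D `&` (ball c d : set SM)) by exact: measurableI.
have mD2 : measurable (D `\` (ball c d : set SM)) by exact: measurableD.
have mp A : measurable A -> measurable (phi @^-1` A).
  by move=> mA; rewrite -[_ @^-1` _]setTI; exact: mphi.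
have finA A : measurable A -> mu A \is a fin_num.
  by move=> mA; rewrite ge0_fin_numE// finite_measure_lty.
have [] := ih _ mD2 _ _ _.
- by move=> x [/DS].
- move=> x [Dx nb]; have [c' + hc'] := cov x Dx.
  by rewrite inE => /predU1P[e|c'cs]; [rewrite e in hc'|exists c'].
- by move=> c' c'cs; apply: hcs; rewrite inE c'cs orbT.
move=> ih1 ih2.
have eD : phi @^-1` D = (phi @^-1` (D `&` (ball c d : set SM))) `|`
    (phi @^-1` (D `\` (ball c d : set SM))).
  by rewrite -preimage_setU setUIDK.
have dis : [disjoint phi @^-1` (D `&` (ball c d : set SM)) &
    phi @^-1` (D `\` (ball c d : set SM))].
  by apply/disj_setPS => x [[_ hx] [_ /(_ hx)]].
have muD : fine (mu (phi @^-1` D)) = fine (mu (phi @^-1` (D `&` (ball c d : set SM))))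
    + fine (mu (phi @^-1` (D `\` (ball c d : set SM)))).
  rewrite {1}eD measureU ?fineD//; try by [apply: finA; exact: mp|exact: mp].
  exact/disj_set2P.
split; first by rewrite /= big_cons /= ih1 muD.
move=> f e uf he /=; rewrite big_cons /=.
have int : mu.-integrable (phi @^-1` D) (EFin \o (f \o phi)).
  apply: measurable_bounded_integrable; first exact: mp.
  - by apply: finite_measure_lty => //; exact: mp.
  - apply: (measurable_comp (F := @sphere R m)) => //.
    + exact: sphere_measurable.
    + by move=> _ [x Dx <-]; exact: DS.
    + exact: ucb_measurable.
    + exact: measurable_funS mphi.
  have [[C hC] _] := uf; exists C; split; first exact: num_real.
  by move=> C' CC' x Dx; rewrite /= (le_trans (hC _ (DS _ Dx)))// ltW.
have -> : RintS mu (phi @^-1` D) (f \o phi) =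
   RintS mu (phi @^-1` (D `&` (ball c d : set SM))) (f \o phi) +
   RintS mu (phi @^-1` (D `\` (ball c d : set SM))) (f \o phi).
  rewrite {1}eD; apply: Rintegral_setU => //; try exact: mp.
  by rewrite -eD.
have h2 := ih2 f e uf he; rewrite muD mulrDl.
set A := phi @^-1` (D `&` (ball c d : set SM)).
have mA : measurable A by exact: mp.
have intA : mu.-integrable A (EFin \o (f \o phi)).
  by apply: integrableS int => //; [exact: mp|move=> x []].
have finAc r : mu.-integrable A (EFin \o (fun=> r)).
  apply: measurable_bounded_integrable => //; first exact: finite_measure_lty.
  by exists `|r|; split=> [|D' rD' x _]; [exact: num_real|rewrite /= ltW].
suff h1 : `|RintS mu A (f \o phi) - fine (mu A) * f c| <= fine (mu A) * e.
  rewrite opprD addrACA (le_trans (ler_normD _ _))//.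
  by rewrite lerD.
rewrite (mulrC _ (f c)) -(Rintegral_cst mu mA (f c)).
rewrite -[RintS _ _ _]/(\int[mu]_(x in A) ((f \o phi) x))%R -RintegralB//.
have intB : mu.-integrable A (EFin \o (fun x => (f \o phi) x - f c)).
  exact: (integrableB mA intA (finAc (f c))).
apply: (le_trans (le_normr_Rintegral mA intB)).
rewrite mulrC -(Rintegral_cst mu mA e); apply: le_Rintegral => //.
  exact: integrable_norm intB.
move=> x [Dx]; rewrite -ball_normE /= => cx.
rewrite distrC; apply: he; [exact: hcs (mem_head _ _)|exact: DS|exact: ltW].
Qed.

Lemma sphere_cover d : 0 < d -> exists cs : seq E,
  (forall c, c \in cs -> Sp c) /\
  forall x, Sp x -> exists2 c, c \in cs & ball c d x.
Proof.
move=> d0; have := @sphere_compact R m; rewrite compact_cover.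
move=> /(_ E Sp (fun c => ball c d)) [].
- by move=> c _; exact: ball_open.
- by move=> x Sx; exists x => //; exact: ballxx.
move=> D hD hcov; exists (finmap.enum_fset D); split=> [c cD|x /hcov[c cD cx]].
  by have := hD c cD; rewrite inE.
by exists c.
Qed.

Definition sphere_int mu f : R := RintS mu (@sphere R m) f.

Lemma sphere_int_quadratic mu : (mu setT < +oo)%E ->
  quadratic_limit true (sphere_int mu) (fine (mu (@sphere R m))).
Proof.
move=> fin; split=> [|d d0]; first exact: fine_ge0.
have [cs [hcs cov]] := sphere_cover d0.
have [h1 h2] := @cover_pieces_quadrature mu id d _ cs fin (@measurable_id _ _ _)
  sphere_measurable (@subset_refl _ _) cov hcs.
exists [seq (fine (mu p.1), p.2) | p <- cover_pieces d (@sphere R m) cs]; split.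
- move=> _ /mapP[p hp ->] /=; split; last by move=> _; exact: fine_ge0.
  apply: hcs; move: hp; move: (@sphere R m) => D.
  elim: (cs) D => //= c cs' ih D; rewrite inE => /predU1P[->|/ih]; first exact: mem_head.
  by rewrite inE orbC => ->.
- rewrite big_map; under eq_bigr do rewrite ger0_norm ?fine_ge0//.
  by rewrite h1.
- move=> f e uf he; have := h2 f e uf he.
  by rewrite /discr big_map.
Qed.

Lemma sphere_int_act mu1 mu2 (O : 'M[R]_(m.+1)) f :
  (mu1 setT < +oo)%E -> (mu2 setT < +oo)%E -> rotation O ->
  (forall A : set SM, measurable A ->
    fine (mu1 (act O @^-1` A)) - fine (mu2 (act O @^-1` A)) =
    fine (mu1 A) - fine (mu2 A)) -> ucb Sp f ->
  sphere_int mu1 (fun z => f (act O z)) - sphere_int mu2 (fun z => f (act O z)) =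
  sphere_int mu1 f - sphere_int mu2 f.
Proof.
move=> fin1 fin2 hO inv uf.
have eS : (act O : SM -> SM) @^-1` (@sphere R m) = @sphere R m.
  apply/seteqP; split=> x /=; last exact: act_sphere.
  by move=> /(act_sphere (rotation_tr hO)); rewrite act_trK//; case: hO.
pose M i := fine ((if i then mu1 else mu2) (@sphere R m)).
apply: (@eq_of_dist_le _ _ _ (2 * (M true + M false))) => e e0.
have [_ /(_ e e0)[d d0 hd]] := uf.
have [cs [hcs cov]] := sphere_cover d0.
have h mu phi (fin : (mu setT < +oo)%E) (mphi : measurable_fun setT phi) :=
  (@cover_pieces_quadrature mu phi d _ cs fin mphi
  sphere_measurable (@subset_refl _ _) cov hcs).2 f e uf hd.
have h1 := h _ _ fin1 (act_measurable O); have h2 := h _ _ fin2 (act_measurable O).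
have h3 := h _ _ fin1 (@measurable_id _ _ _); have h4 := h _ _ fin2 (@measurable_id _ _ _).
rewrite eS in h1 h2.
have e5 (g g' : set SM -> R) : \sum_(p <- cover_pieces d (@sphere R m) cs)
    (g p.1 - g' p.1) * f p.2 = \sum_(p <- cover_pieces d (@sphere R m) cs) g p.1 * f p.2
    - \sum_(p <- cover_pieces d (@sphere R m) cs) g' p.1 * f p.2.
  by rewrite -sumrB; apply: eq_bigr => p _; rewrite mulrBl.
have h5 := cover_pieces_eq d cs f sphere_measurable inv.
have h6 := e5 (fun A => fine (mu1 (act O @^-1` A))) (fun A => fine (mu2 (act O @^-1` A))).
have h7 := e5 (fun A => fine (mu1 A)) (fun A => fine (mu2 A)).
rewrite h5 h7 in h6; move: {h5 h7 e5} h6 => h5; move: h1 h2 h3 h4 h5; rewrite /M /sphere_int /=.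
rewrite !ler_norml => /andP[+ +] /andP[+ +] /andP[+ +] /andP[+ +]; lra.
Qed.

(** This is how the merely essential bound on [B] enters. *)
Lemma sphere_int_ae_le mu f C : (mu setT < +oo)%E -> ucb Sp f -> 0 <= C ->
  (\forall x \ae mu, @sphere R m x -> `|f x| <= C) ->
  `|sphere_int mu f| <= C * fine (mu (@sphere R m)).
Proof.
move=> fin uf C0 hf.
have int := ucb_integrable fin uf.
apply: (le_trans (le_normr_Rintegral sphere_measurable int)).
rewrite -(Rintegral_cst mu sphere_measurable C) /Rintegral; apply: fine_le.
- by apply: integrable_fin_num; [exact: sphere_measurable|exact: integrable_norm int].
- apply: integrable_fin_num; first exact: sphere_measurable.
  apply: measurable_bounded_integrable => //; [exact: sphere_measurable| |].
    by apply: finite_measure_lty => //; exact: sphere_measurable.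
  by exists `|C|; split=> [|D' rD' x _]; [exact: num_real|rewrite /= ltW].
apply: ae_ge0_le_integral => //.
- exact: sphere_measurable.
apply/measurable_EFinP; apply: measurableT_comp => //; exact: ucb_measurable.
Qed.

End SphereIntegration.

Section FunctionalOperations.
Variables (R : realType) (m : nat).
Local Notation E := (E R m).
Local Notation Sp := (@sphere R m : set E).

Lemma quadratic_limit_sub pos1 pos2 (J1 J2 : (E -> R) -> R) M1 M2 :
  quadratic_limit pos1 J1 M1 -> quadratic_limit pos2 J2 M2 ->
  quadratic_limit false (fun f => J1 f - J2 f) (M1 + M2).
Proof.
move=> [M10 h1] [M20 h2]; split=> [|d d0]; first exact: addr_ge0.
have [w1 [a1 a2 a3]] := h1 d d0; have [w2 [b1 b2 b3]] := h2 d d0.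
exists (w1 ++ [seq (- p.1, p.2) | p <- w2]); split.
- move=> p; rewrite mem_cat => /orP[/a1[]//|/mapP[q /b1[Sq _] ->]].
  by split.
- rewrite big_cat big_map /=; under [X in _ + X]eq_bigr do rewrite normrN.
  exact: lerD.
- move=> f e uf he; rewrite /discr big_cat big_map /=.
  have -> : \sum_(p <- w2) - p.1 * f p.2 = - discr w2 f.
    by rewrite -sumrN; apply: eq_bigr => p _; rewrite mulNr.
  rewrite -/(discr w1 f) opprD opprK mulrDl.
  have := a3 f e uf he; have := b3 f e uf he.
  have -> : J1 f - J2 f + (- discr w1 f + discr w2 f) =
    (J1 f - discr w1 f) - (J2 f - discr w2 f) by ring.
  by have := ler_normB (J1 f - discr w1 f) (J2 f - discr w2 f); lra.
Qed.

End FunctionalOperations.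

(** * Rotations and the zonal product formula *)

Section Rotations.
Variables (R : realType) (m : nat).
Local Notation E := (E R m).
Local Notation Sp := (@sphere R m : set E).
Implicit Types (x y z a b e : E) (O : 'M[R]_(m.+1)).

Definition reflection a : 'M[R]_(m.+1) := 1%:M - (2 *: (a^T *m a)).

Lemma reflection_tr a : (reflection a)^T = reflection a.
Proof. by rewrite /reflection linearB linearZ /= trmx_mul trmxK trmx1. Qed.

Lemma act_reflection a x : act (reflection a) x = x - (2 * dot x a) *: a.
Proof.
rewrite /act reflection_tr /reflection mulmxBr mulmx1 -scalemxAr mulmxA.
by rewrite [x *m a^T]mx11_scalar -dot_mx mul_scalar_mx scalerA.
Qed.

Lemma act_reflection_dot a x y :
  dot (act (reflection a) x) y = dot x (act (reflection a) y).
Proof.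
rewrite !act_reflection dotDl dotNl dotZl dotDr dotNr dotZr (dotC y a); ring.
Qed.

Lemma reflectionK a : Sp a -> reflection a *m reflection a = 1%:M.
Proof.
move=> Sa; rewrite {1}/reflection mulmxBl mul1mx -scalemxAl -mulmxA.
have -> : a *m reflection a = - a.
  have := act_reflection a a; rewrite /act reflection_tr Sa mulr1 => ->.
  by rewrite -[X in X - _]scale1r -scalerBl (_ : 1 - 2 = -1) ?scaleN1r//; ring.
by rewrite mulmxN scalerN opprK subrK.
Qed.

Lemma act_comp O O' x : act (O *m O') x = act O (act O' x).
Proof. by rewrite /act trmx_mul mulmxA. Qed.

Lemma act1 x : act (1%:M) x = x.
Proof. by rewrite /act trmx1 mulmx1. Qed.

Lemma act_inj_mx O O' : (forall x, act O x = act O' x) -> O = O'.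
Proof.
move=> h; rewrite -(trmxK O) -(trmxK O'); congr trmx; apply/row_matrixP => i.
by rewrite !rowE; exact: h.
Qed.

Lemma unit_normalize x : x != 0 -> Sp ((Num.sqrt (dot x x))^-1 *: x).
Proof.
move=> x0; have h : 0 < dot x x.
  by rewrite lt_neqAle dot_ge0 andbT eq_sym; apply: contra x0 => /eqP/dot_eq0->.
rewrite /sphere /= dotZl dotZr mulrA -expr2 exprVn sqr_sqrtr ?dot_ge0//.
by rewrite mulVf// gt_eqF.
Qed.

Lemma reflection_swap x y : Sp x -> Sp y -> x != y ->
  exists2 a, Sp a & act (reflection a) x = y /\
    forall v, dot v (x - y) = 0 -> act (reflection a) v = v.
Proof.
move=> Sx Sy xy; have d0 : x - y != 0 by rewrite subr_eq0.
have Sa := unit_normalize d0.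
exists ((Num.sqrt (dot (x - y) (x - y)))^-1 *: (x - y)) => //; split.
  rewrite act_reflection dotZr scalerA.
  have h : dot (x - y) (x - y) = 2 * dot x (x - y).
    rewrite !(dotDl, dotDr, dotNl, dotNr) (dotC y x).
    by rewrite /sphere /= in Sx Sy; rewrite Sx Sy; ring.
  have h0 : 0 < dot (x - y) (x - y).
    rewrite lt_neqAle dot_ge0 andbT eq_sym; apply: contra d0 => /eqP/dot_eq0->//.
  have -> : 2 * ((Num.sqrt (dot (x - y) (x - y)))^-1 * dot x (x - y)) /
     Num.sqrt (dot (x - y) (x - y)) = 1.
    set r := Num.sqrt _; have r2 : r * r = dot (x - y) (x - y).
      by rewrite -expr2 sqr_sqrtr// dot_ge0.
    have r0 : r != 0 by apply: contraTneq h0 => r0; rewrite -r2 r0 mul0r ltxx.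
    rewrite (_ : _ / _ = (2 * dot x (x - y)) / (r * r)); last by field.
    by rewrite -h -r2 divff// mulf_neq0.
  by rewrite scale1r opprB addrC subrK.
by move=> v hv; rewrite act_reflection dotZr hv !mulr0 scale0r subr0.
Qed.

(** Any two reflections are conjugate by a third one, and each is an involution; hence their
    determinants are equal with square 1, and neither has to be computed. *)
Lemma det_reflection2 a b : Sp a -> Sp b -> \det (reflection a) * \det (reflection b) = 1.
Proof.
move=> Sa Sb.
have sq c : Sp c -> \det (reflection c) * \det (reflection c) = 1.
  by move=> Sc; rewrite -det_mulmx reflectionK// det1.
have [->|ab] := eqVneq a b; first exact: sq.
have [c Sc [hc _]] := reflection_swap Sa Sb ab.
have e : reflection b = reflection c *m (reflection a *m reflection c).
  apply: act_inj_mx => x; rewrite !act_comp.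
  have -> : act (reflection a) (act (reflection c) x) =
     act (reflection c) x - (2 * dot x b) *: a.
    by rewrite act_reflection -hc act_reflection_dot.
  rewrite [RHS]/act mulmxBl -scalemxAl -!/(act _ _) hc -act_comp reflectionK// act1.
  by rewrite act_reflection.
rewrite e !det_mulmx.
rewrite (_ : _ * _ = (\det (reflection a) * \det (reflection a)) * (\det (reflection c) * \det
  (reflection c))); last by ring.
by rewrite !sq// mulr1.
Qed.

(** The reflection exchanging [x] and [y] is followed by the reflection along [b], which corrects
    the determinant and leaves [y] in place because [b] is orthogonal to it. *)
Lemma rotation_exists x y b : Sp x -> Sp y -> Sp b -> dot b y = 0 ->
  exists O, [/\ rotation O, act O x = y &
    forall v, dot v (x - y) = 0 -> dot v b = 0 -> act O v = v].
Proof.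
move=> Sx Sy Sb by0; have [<-|xy] := eqVneq x y.
  exists 1%:M; split=> [||v _ _]; rewrite ?act1//.
  by split; rewrite ?trmx1 ?mulmx1 ?det1.
have [a Sa [h1 h2]] := reflection_swap Sx Sy xy.
have hb v : dot v b = 0 -> act (reflection b) v = v.
  by move=> vb; rewrite act_reflection vb mulr0 scale0r subr0.
exists (reflection b *m reflection a); split.
- split; last by rewrite det_mulmx det_reflection2.
  rewrite trmx_mul !reflection_tr mulmxA -(mulmxA (reflection a)).
  by rewrite reflectionK// mulmx1 reflectionK.
- by rewrite act_comp h1 hb// dotC.
- by move=> v v1 v2; rewrite act_comp h2// hb.
Qed.

Lemma unit_orthogonal2 x y : (2 <= m)%N ->
  exists b, [/\ Sp b, dot b x = 0 & dot b y = 0].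
Proof.
move=> hm; pose A := row_mx x^T y^T : 'M[R]_(m.+1, 1 + 1).
have : kermx A != 0.
  rewrite -mxrank_eq0 mxrank_ker -lt0n subn_gt0.
  by rewrite (leq_ltn_trans (rank_leq_col A)).
move=> /rowV0Pn[v /sub_kermxP hv v0].
exists ((Num.sqrt (dot v v))^-1 *: v); split; first exact: unit_normalize.
  have := congr1 (fun M => lsubmx M 0 0) hv.
  by rewrite mul_mx_row row_mxKl -dot_mx dotZl mxE mxE => ->; rewrite mulr0.
have := congr1 (fun M => rsubmx M 0 0) hv.
by rewrite mul_mx_row row_mxKr -dot_mx dotZl mxE mxE => ->; rewrite mulr0.
Qed.

Lemma rotation_to x y : (2 <= m)%N -> Sp x -> Sp y ->
  exists2 O, rotation O & act O x = y.
Proof.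
move=> hm Sx Sy; have [b [Sb b0 _]] := unit_orthogonal2 y y hm.
by have [Q [hO e _]] := rotation_exists Sx Sy Sb b0; exists Q.
Qed.

Lemma rotation_fixing x e e' : (2 <= m)%N -> Sp x -> Sp e -> Sp e' ->
  dot x e = 0 -> dot x e' = 0 ->
  exists O, [/\ rotation O, act O x = x & act O e = e'].
Proof.
move=> hm Sx Se Se' xe xe'; have [b [Sb b1 b2]] := unit_orthogonal2 x e' hm.
have [Q [hO h1 h2]] := rotation_exists Se Se' Sb b2; exists Q; split=> //.
by apply: h2; [rewrite dotDr dotNr xe xe' subrr|rewrite dotC].
Qed.

End Rotations.

(** * Moments of functionals invariant around a pole *)

Section ZonalAverages.
Variables (R : realType) (m : nat).
Local Notation E := (E R m).
Local Notation Sp := (@sphere R m : set E).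
Implicit Types (x y z e : E) (O : 'M[R]_(m.+1)) (f g : E -> R) (p q : {poly R}).

(** Only linearity and dependence on the values on the sphere are asked for, because the product
    formula is also applied to an integral with a zonal weight. *)
Definition sphere_linear (J : (E -> R) -> R) : Prop :=
  (forall a f g, ucb Sp f -> ucb Sp g ->
     J (fun x => a * f x + g x) = a * J f + J g) /\
  (forall f g, ucb Sp f -> (forall x, Sp x -> f x = g x) -> J f = J g).

Definition fixing_invariant (J : (E -> R) -> R) x : Prop :=
  forall O, rotation O -> act O x = x -> forall f, ucb Sp f ->
    J (fun z => f (act O z)) = J f.

Lemma quadratic_limit_linear pos J M : quadratic_limit pos J M -> sphere_linear J.
Proof. by move=> h; split=> [a f g|f g]; [exact: (quad_lin h a)|move=> uf; exact: (quad_ext h uf)]. Qed.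

Lemma ucb_dot_cst x : Sp x -> ucb Sp (fun z => dot z x).
Proof.
by move=> Sx; apply: ucb_dot; [exact: sphere_valued_id|exact: sphere_valued_cst].
Qed.

Section Theory.
Variable (J : (E -> R) -> R) (xi : E).
Hypotheses (hJ : sphere_linear J) (Sxi : Sp xi) (hm : (2 <= m)%N)
  (inv : fixing_invariant J xi).

Lemma sphere_linear0 : J (fun=> 0) = 0.
Proof.
have [h _] := hJ; have := h 1 _ _ (ucb_cst Sp 0) (ucb_cst Sp 0).
have -> : (fun=> 1 * 0 + 0) = (fun=> 0) :> (E -> R) by apply/funext => x; ring.
by rewrite mul1r => h'; lra.
Qed.

Lemma sphere_linearZ a f : ucb Sp f -> J (fun x => a * f x) = a * J f.
Proof.
move=> uf; have [h _] := hJ; have := h a _ _ uf (ucb_cst Sp 0).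
rewrite sphere_linear0 addr0 => <-.
by congr J; apply/funext => x; rewrite addr0.
Qed.

Lemma sphere_linear_sum n (F : 'I_n -> E -> R) :
  (forall i, ucb Sp (F i)) ->
  J (fun x => \sum_(i < n) F i x) = \sum_(i < n) J (F i).
Proof.
have [h _] := hJ; elim: n F => [|n ih] F uF.
  by rewrite big_ord0 -[RHS]sphere_linear0; congr J; apply/funext => x; rewrite big_ord0.
rewrite big_ord_recl -ih// -[J (F ord0)]mul1r -h//; last exact: ucb_sum.
by congr J; apply/funext => x; rewrite big_ord_recl mul1r.
Qed.

Lemma ucb_moment g e n : Sp e -> ucb Sp g -> ucb Sp (fun z => g z * dot z e ^+ n).
Proof. by move=> Se ug; apply: ucb_mul => //; apply/ucb_exp/ucb_dot_cst. Qed.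

Lemma ucb_zonal p : ucb Sp (fun z => p.[dot z xi]).
Proof. by apply/ucb_horner/ucb_dot_cst. Qed.

Lemma moment_direction p e e' n : Sp e -> Sp e' -> dot xi e = 0 -> dot xi e' = 0 ->
  J (fun z => p.[dot z xi] * dot z e ^+ n) = J (fun z => p.[dot z xi] * dot z e' ^+ n).
Proof.
move=> Se Se' he he'; have [Q [hQ Qx Qe]] := rotation_fixing hm Sxi Se Se' he he'.
have uf := ucb_moment n Se' (ucb_zonal p).
rewrite -(inv hQ Qx uf); congr J; apply/funext => z /=.
by rewrite -{2}Qx -Qe !act_dot//; case: hQ.
Qed.

Lemma moment_odd p e n : Sp e -> dot xi e = 0 ->
  J (fun z => p.[dot z xi] * dot z e ^+ n.*2.+1) = 0.
Proof.
move=> Se he; have Sne : Sp (- e) by rewrite /sphere /= dotNl dotNr opprK.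
have hne : dot xi (- e) = 0 by rewrite dotNr he oppr0.
have := moment_direction p n.*2.+1 Se Sne he hne.
set f := fun z => _.
have -> : (fun z => p.[dot z xi] * dot z (- e) ^+ n.*2.+1) = (fun z => -1 * f z).
  apply/funext => z; rewrite /f dotNr exprNn -signr_odd /= odd_double expr1.
  by ring.
by rewrite sphere_linearZ ?mulN1r => [h|]; [lra|exact: ucb_moment (ucb_zonal p)].
Qed.

(* Comparing the coefficients of [b ^ 2] in the identity
   [J (g (z1 + b z2) ^ (2 j + 2)) = (1 + b ^ 2) ^ (j + 1) J (g z1 ^ (2 j + 2))]. *)
Lemma moment_mixed p e e' j : Sp e -> Sp e' -> dot xi e = 0 -> dot xi e' = 0 ->
  dot e e' = 0 ->
  j.*2.+1%:R * J (fun z => p.[dot z xi] * (dot z e ^+ j.*2 * dot z e' ^+ 2)) =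
  J (fun z => p.[dot z xi] * dot z e ^+ j.*2.+2).
Proof.
move=> Se Se' he he' hee'.
pose n := j.*2.+2.
have un i : ucb Sp (fun z => p.[dot z xi] * (dot z e ^+ (n - i) * dot z e' ^+ i)).
  by apply: ucb_mul; [exact: ucb_zonal|apply: ucb_mul; apply/ucb_exp/ucb_dot_cst].
pose A : {poly R} := \sum_(i < n.+1)
  (J (fun z => p.[dot z xi] * (dot z e ^+ (n - i) * dot z e' ^+ i)) *+ 'C(n, i)) *: 'X^i.
pose M := J (fun z => p.[dot z xi] * dot z e ^+ n).
have key b : A.[b] = M * (1 + b ^+ 2) ^+ j.+1.
  have s0 : 0 < 1 + b ^+ 2 by rewrite ltr_pwDl// sqr_ge0.
  pose s := Num.sqrt (1 + b ^+ 2); have sp : 0 < s by rewrite sqrtr_gt0.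
  have s2 : s ^+ 2 = 1 + b ^+ 2 by rewrite sqr_sqrtr// ltW.
  pose eb := s^-1 *: (e + b *: e').
  have Seb : Sp eb.
    rewrite /sphere /= in Se Se' *.
    rewrite /eb dotZl dotZr !(dotDl, dotDr, dotZl, dotZr) (dotC e' e) hee' Se Se'.
    rewrite !mulr0 addr0 add0r mulr1 mulrA -expr2 exprVn s2 mulrC -expr2.
    by rewrite divff// gt_eqF.
  have heb : dot xi eb = 0 by rewrite dotZr dotDr dotZr he he' mulr0 addr0 mulr0.
  rewrite /M (moment_direction p n Se Seb he heb).
  have sn : (1 + b ^+ 2) ^+ j.+1 = s ^+ n by rewrite -s2 -exprM mul2n doubleS.
  rewrite mulrC -sphere_linearZ; last exact: ucb_moment (ucb_zonal p).
  transitivity (J (fun z => \sum_(i < n.+1) (b ^+ i *+ 'C(n, i)) *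
      (p.[dot z xi] * (dot z e ^+ (n - i) * dot z e' ^+ i)))).
    rewrite sphere_linear_sum => [|i]; last exact: ucb_scale (un i).
    rewrite horner_sum; apply: eq_bigr => i _.
    rewrite hornerZ hornerXn (sphere_linearZ _ (un i)); move: (J _) => X.
    by rewrite !mulrnAl mulrC.
  congr J; apply/funext => z; rewrite sn mulrCA -exprMn.
  rewrite dotZr mulVKf ?gt_eqF// dotDr dotZr exprDn mulr_sumr.
  apply: eq_bigr => i _; rewrite exprMn mulrnAr mulrnAl; congr (_ *+ _).
  by rewrite [LHS]mulrCA; congr (_ * _); rewrite [LHS]mulrCA.
have AE : A = M *: (1 + 'X^2) ^+ j.+1.
  apply/eqP; rewrite -subr_eq0; apply/eqP.
  apply: (@poly_eq0_inj _ _ (fun n => n%:R)) => [a b /eqP|k].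
    by rewrite eqr_nat => /eqP.
  by rewrite hornerD hornerN hornerZ key horner_exp hornerD hornerXn hornerC subrr.
(* On the left this coefficient is 'C(2j+2, 2) = (j+1)(2j+1) times the mixed moment, on the right
   (j+1) times [M]. *)
have := congr1 (fun q : {poly R} => q`_2) AE.
rewrite coefZ /A coef_sum.
rewrite (bigD1 (inord 2 : 'I_n.+1))//= big1 => [|i hi]; last first.
  rewrite coefZ coefXn; case: eqP => [i2|]; last by rewrite mulr0.
  by move: hi; rewrite -val_eqE /= inordK// -i2 eqxx.
rewrite addr0 coefZ coefXn inordK// eqxx mulr1.
have j1 : (1 < j.+2)%N by [].
rewrite exprDn coef_sum (bigD1 (inord 1 : 'I_j.+2))//= big1 => [|i hi]; last first.
  rewrite expr1n mul1r coefMn -exprM coefXn eqn_leq.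
  case: (ltngtP 2 (2 * i)%N) => //=; rewrite ?mul0rn// => i2.
  by move: hi; rewrite -val_eqE /= inordK//; lia.
rewrite inordK// expr1n mul1r expr1 coefMn coefXn eqxx addr0 bin1.
have -> : 'C(n, 2) = (j.+1 * j.*2.+1)%N.
  by rewrite bin2 /n -doubleS -doubleMl doubleK.
rewrite /M /n subSS subSS subn0; set X := J _; set Y := J _ => h.
have jn : j.+1%:R != 0 :> R by rewrite pnatr_eq0.
apply: (mulfI jn); rewrite mulrA -natrM mulr_natl h; exact: mulrC.
Qed.

Lemma dot_delta i k : dot (delta_mx 0 i : E) (delta_mx 0 k) = (i == k)%:R.
Proof.
rewrite /dot (bigD1 i)//= big1 => [|l li].
  by rewrite !mxE !eqxx mul1r addr0.
by rewrite !mxE !eqxx /= (negbTE li) mul0r.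
Qed.

Lemma dot_delta_r z i : dot z (delta_mx 0 i) = z 0 i.
Proof.
rewrite /dot (bigD1 i)//= big1 => [|l li]; first by rewrite !mxE !eqxx mulr1 addr0.
by rewrite !mxE (negbTE li) andbF mulr0.
Qed.

(** In an orthonormal frame starting with [xi], the squares of the other m coordinates add up to 1 -
    (z . xi)^2. One of them reproduces the moment X on the left, and by [moment_mixed] each of the
    other m - 1 gives X / (2j+1); the total is X (2j + m) / (2j + 1). *)
Lemma moment_step p e j : Sp e -> dot xi e = 0 ->
  J (fun z => p.[dot z xi] * dot z e ^+ j.*2.+2) =
  j.*2.+1%:R / (j.*2%:R + m%:R) *
    J (fun z => (p * (1 - 'X^2)).[dot z xi] * dot z e ^+ j.*2).
Proof.
move=> Se he.
have Sd : Sp (delta_mx 0 0) by rewrite /sphere /= dot_delta eqxx.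
have [Q hQ Qxi] := rotation_to hm Sd Sxi.
pose u i := act Q (delta_mx 0 i).
have udot i k : dot (u i) (u k) = (i == k)%:R.
  by rewrite act_dot ?dot_delta//; case: hQ.
have uS i : Sp (u i) by rewrite /sphere /= udot eqxx.
have u0 : u 0 = xi by [].
have uxi i : i != 0 -> dot xi (u i) = 0.
  by move=> i0; rewrite -u0 udot eq_sym (negbTE i0).
have pars z : Sp z -> \sum_i dot z (u i) ^+ 2 = 1.
  move=> Sz; have : dot (act Q^T z) (act Q^T z) = 1.
    by rewrite act_dot//; have [] := rotation_tr hQ.
  move=> <-; apply: eq_bigr => i _.
  by rewrite /u act_dot_tr// dot_delta_r expr2.
have m1 : (1 < m.+1)%N by rewrite ltnS ltnW.
pose k1 : 'I_m.+1 := Ordinal m1.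
have k10 : k1 != 0 by [].
rewrite (moment_direction p j.*2.+2 Se (uS k1) he (uxi _ k10)).
rewrite (moment_direction _ j.*2 Se (uS k1) he (uxi _ k10)).
set X := J _.
have uf i : ucb Sp (fun z => p.[dot z xi] * (dot z (u k1) ^+ j.*2 * dot z (u i) ^+ 2)).
  by apply: ucb_mul; [exact: ucb_zonal|apply: ucb_mul; apply/ucb_exp/ucb_dot_cst].
have -> : J (fun z => (p * (1 - 'X^2)).[dot z xi] * dot z (u k1) ^+ j.*2) =
    \sum_(i < m) J (fun z => p.[dot z xi] * (dot z (u k1) ^+ j.*2 * dot z (u (lift 0 i)) ^+ 2)).
  rewrite -sphere_linear_sum// ; have [_ h] := hJ; apply: h.
    by apply: ucb_moment => //; exact: ucb_zonal.
  move=> z Sz; rewrite hornerM hornerD hornerN hornerXn hornerC.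
  rewrite -(pars z Sz) big_ord_recl u0 addrC addKr -mulrA mulr_suml mulr_sumr.
  by apply: eq_bigr => i _; rewrite [X in _ * X]mulrC.
have m0 : (0 < m)%N by exact: ltnW.
have k1E : k1 = lift 0 (Ordinal m0) by apply/val_inj.
rewrite (bigD1 (Ordinal m0))//= -k1E.
have -> : J (fun z => p.[dot z xi] * (dot z (u k1) ^+ j.*2 * dot z (u k1) ^+ 2)) = X.
  by rewrite /X; congr J; apply/funext => z; rewrite -exprD addn2.
have j1 : j.*2.+1%:R != 0 :> R by rewrite pnatr_eq0.
rewrite (eq_bigr (fun=> X / j.*2.+1%:R)); last first.
  move=> i i0; have hi : dot (u k1) (u (lift 0 i)) = 0.
    by rewrite udot k1E (inj_eq lift_inj) eq_sym (negbTE i0).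
  rewrite /X -(moment_mixed p j (uS k1) (uS (lift 0 i)) (uxi _ k10) (uxi _ _) hi)//.
  by rewrite mulrAC divff// mul1r.
rewrite sumr_const cardC1 card_ord -[_ *+ m.-1]mulr_natr.
have -> : (m.-1)%:R = m%:R - 1 :> R by rewrite -{2}(prednK m0) -natr1 addrK.
have jm : (j.*2%:R + m%:R : R) != 0 by rewrite -natrD pnatr_eq0 addn_eq0 negb_and orbC -lt0n m0.
move: X => X; rewrite -natr1 in j1 *; move: (j.*2%:R) j1 jm => r j1 jm; field.
by rewrite jm j1.
Qed.

Lemma moment_even p e j : Sp e -> dot xi e = 0 ->
  J (fun z => p.[dot z xi] * dot z e ^+ j.*2) =
  zonal_coef m%:R j * (j.*2)`!%:R * J (fun z => (p * (1 - 'X^2) ^+ j).[dot z xi]).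
Proof.
move=> Se he; elim: j p => [|j ih] p.
  rewrite double0 fact0 /= !mul1r; congr J; apply/funext => z.
  by rewrite !expr0 !mulr1.
rewrite doubleS (moment_step p j Se he) ih (exprS (1 - 'X^2) j) [p * (_ * _)]mulrA mulrA.
congr (_ * _).
have m0 : (0 < m)%N by exact: ltnW.
have jm : (j.*2%:R + m%:R : R) != 0 by rewrite -natrD pnatr_eq0 addn_eq0 negb_and orbC -lt0n m0.
rewrite /= doubleS !factS !natrM; field.
by rewrite jm -natrD pnatr_eq0.
Qed.

(** Write w = a xi + b e with e a unit vector orthogonal to xi, and expand the polynomial at a (z .
    xi) in powers of b (z . e). Odd moments vanish and even ones become powers of 1 - (z . xi)^2.
    What remains is [geg_product], which factors by [geg_poly_product]. *)
Lemma zonal_product (lam : R) k w : 2 * lam + 1 = m%:R -> 0 < lam -> Sp w ->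
  J (fun z => (geg_poly lam k).[dot w z]) =
  (geg_poly lam k).[dot w xi] * J (fun z => (geg_poly lam k).[dot z xi]).
Proof.
move=> elam lam0 Sw; set p := geg_poly lam k; set a := dot w xi.
have Sxi1 : dot xi xi = 1 := Sxi; have Sw1 : dot w w = 1 := Sw.
have [e [Se he [b wE b2]]] : exists e, [/\ Sp e, dot xi e = 0 &
    exists2 b, w = a *: xi + b *: e & b ^+ 2 = 1 - a ^+ 2].
  have h : dot (w - a *: xi) (w - a *: xi) = 1 - a ^+ 2.
    rewrite !(dotDl, dotDr, dotNl, dotNr, dotZl, dotZr) (dotC xi w) -/a.
    by rewrite Sxi1 Sw1; ring.
  have [d0|d0] := eqVneq (w - a *: xi) 0.
    have [e [Se e1 _]] := unit_orthogonal2 xi xi hm.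
    exists e; split=> //; first by rewrite dotC.
    exists 0; first by rewrite scale0r addr0; apply/eqP; rewrite -subr_eq0 d0.
    by rewrite -h d0 /dot expr0n /= big1// => i _; rewrite mxE mul0r.
  exists ((Num.sqrt (dot (w - a *: xi) (w - a *: xi)))^-1 *: (w - a *: xi)).
  have s0 : Num.sqrt (dot (w - a *: xi) (w - a *: xi)) != 0.
    apply: contra d0 => /eqP s0; apply/eqP/dot_eq0.
    by rewrite -[LHS]sqr_sqrtr ?dot_ge0// s0 expr0n.
  split; first exact: unit_normalize.
    rewrite dotZr; move: (_^-1) => r; rewrite dotDr dotNr dotZr (dotC xi w) -/a.
    by rewrite Sxi1 mulr1 subrr mulr0.
  exists (Num.sqrt (dot (w - a *: xi) (w - a *: xi))).
    by rewrite scalerA divff// scale1r addrC subrK.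
  by rewrite sqr_sqrtr ?dot_ge0.
have term n : J (fun z => p^`(n).[a * dot z xi] * dot z e ^+ n) =
    J (fun z => (p^`(n) \Po (a *: 'X)).[dot z xi] * dot z e ^+ n).
  by congr J; apply/funext => z; rewrite horner_comp hornerZ hornerX.
have uterm n : ucb Sp (fun z => (p^`(n) \Po (a *: 'X)).[dot z xi] * dot z e ^+ n).
  by apply: ucb_moment => //; exact: ucb_zonal.
pose c n := b ^+ n / n`!%:R.
have nf n : n`!%:R != 0 :> R by rewrite pnatr_eq0 -lt0n fact_gt0.
(* The Taylor sum is prolonged by vanishing derivatives to twice the size of [p], so that even and
   odd orders can be paired. *)
have e1 : J (fun z => p.[dot w z]) =
    \sum_(n < (size p).*2) c n * J (fun z => (p^`(n) \Po (a *: 'X)).[dot z xi] * dot z e ^+ n).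
  under [RHS]eq_bigr => n _ do rewrite -(sphere_linearZ (c n) (uterm n)).
  rewrite -sphere_linear_sum => [|n]; last exact/ucb_scale/uterm.
  congr J; apply/funext => z.
  rewrite wE dotDl !dotZl (dotC xi) (dotC e) nderiv_taylor; last exact: mulrC.
  rewrite -addnn big_split_ord /= [X in _ = _ + X]big1 ?addr0 => [|i _].
    apply: eq_bigr => i _; rewrite horner_comp hornerZ hornerX nderivn_def hornerMn.
    rewrite exprMn /c ; move: (_.[_]) (dot z e ^+ i) (b ^+ i) => u v r.
    rewrite -[u *+ _]mulr_natr; move: (nf i); move: (i`!%:R) => q q0; field. exact: q0.
  by rewrite derivn_poly0 ?leq_addr// comp_poly0 horner0 mul0r mulr0.
have -> : p.[a] * J (fun z => p.[dot z xi]) = J (fun z => (geg_product m%:R p a).[dot z xi]).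
  rewrite -elam geg_poly_product// -sphere_linearZ; last exact: ucb_zonal.
  by congr J; apply/funext => z; rewrite hornerZ.
rewrite e1.
have split2 (F : nat -> R) n : \sum_(i < n.*2) F i = \sum_(i < n) (F i.*2 + F i.*2.+1).
  elim: n => [|n ih]; first by rewrite !big_ord0.
  by rewrite doubleS !big_ord_recr /= ih addrA.
rewrite (split2 (fun n => c n * J (fun z => (p^`(n) \Po (a *: 'X)).[dot z xi] * dot z e ^+ n))).
pose G (j : nat) z := (zonal_coef m%:R j * (1 - a ^+ 2) ^+ j) *
    ((p^`(j.*2) \Po (a *: 'X)) * (1 - 'X^2) ^+ j).[dot z xi].
have uG j : ucb Sp (G j) by apply/ucb_scale/ucb_zonal.
transitivity (J (fun z => \sum_(j < size p) G j z)).
  rewrite sphere_linear_sum//; apply: eq_bigr => j _.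
  rewrite moment_odd// mulr0 addr0 moment_even// /G sphere_linearZ; last exact: ucb_zonal.
  rewrite mulrA; congr (_ * _); rewrite /c -b2 -exprM mul2n.
  by rewrite mulrCA mulfVK.
congr J; apply/funext => z; rewrite /geg_product horner_sum.
by apply: eq_bigr => j _; rewrite hornerZ [X in _ = _ * X.[_]]mulrC.
Qed.

End Theory.

End ZonalAverages.

(** * Zonal convolution *)

Section GegenbauerExpansion.
Variable R : realType.

Lemma geg_poly_expansion (lam : R) n (p : {poly R}) : 0 < lam -> (size p <= n)%N ->
  exists a : nat -> R, p = \sum_(k < n) a k *: geg_poly lam k.
Proof.
move=> l0; elim: n p => [|n ih] p sp.
  exists (fun=> 0); rewrite big_ord0; apply/eqP; by rewrite -size_poly_leq0.
pose c := p`_n / lead_coef (geg_poly lam n).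
have lc0 : lead_coef (geg_poly lam n) != 0.
  by rewrite lead_coef_eq0 -size_poly_eq0 size_geg_poly.
have [|a ha] := ih (p - c *: geg_poly lam n).
  apply/leq_sizeP => j; rewrite coefB coefZ leq_eqVlt => /predU1P[<-|nj].
    have -> : (geg_poly lam n)`_n = lead_coef (geg_poly lam n).
      by rewrite lead_coefE size_geg_poly.
    by rewrite /c mulfVK// subrr.
  rewrite [p`_j]nth_default ?(leq_trans sp)// sub0r.
  by rewrite (_ : _`_j = 0) ?mulr0 ?oppr0// nth_default// size_geg_poly.
exists (fun k => if k == n then c else a k).
rewrite big_ord_recr /= eqxx -[LHS](subrK (c *: geg_poly lam n)) {1}ha.
congr (_ + _); apply: eq_bigr => i _.
by rewrite ltn_eqF.
Qed.

End GegenbauerExpansion.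

(** * Orthogonality and a polynomial approximate identity *)

Section InvariantIntegral.
Variables (R : realType) (m : nat).
Local Notation E := (E R m).
Local Notation Sp := (@sphere R m : set E).
Variables (I : (E -> R) -> R) (w lam : R).
Hypotheses (hm : (2 <= m)%N) (hI : quadratic_limit true I w) (w0 : 0 < w)
  (I1 : I (fun=> 1) = w) (elam : 2 * lam + 1 = m%:R) (lam0 : 0 < lam)
  (invI : forall O : 'M[R]_(m.+1), rotation O -> forall f, ucb Sp f ->
     I (fun z => f (act O z)) = I f).
Implicit Types (x y z : E) (f g : E -> R) (p q : {poly R}).
Local Notation P := (geg_poly lam).

Lemma sphere_nonempty : exists x : E, Sp x.
Proof. by exists (delta_mx 0 0); rewrite /sphere /= dot_delta eqxx. Qed.

Lemma ucb_zonal_r p y : Sp y -> ucb Sp (fun z => p.[dot z y]).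
Proof. by move=> Sy; apply/ucb_horner/ucb_dot_cst. Qed.

Lemma ucb_zonal_l p x : Sp x -> ucb Sp (fun z => p.[dot x z]).
Proof.
move=> Sx; apply: (ucb_eq _ (ucb_zonal_r p Sx)) => z _.
by rewrite dotC.
Qed.

Lemma zonal_int_const p x y : Sp x -> Sp y ->
  I (fun z => p.[dot z x]) = I (fun z => p.[dot z y]).
Proof.
move=> Sx Sy; have [Q hQ e] := rotation_to hm Sx Sy.
rewrite -(invI hQ (ucb_zonal_r p Sy)); congr I; apply/funext => z /=.
by rewrite -e act_dot//; case: hQ.
Qed.

Lemma sphere_dot_surj y (s : R) : Sp y -> -1 <= s <= 1 ->
  exists2 x, Sp x & dot x y = s.
Proof.
move=> Sy hs; have [e [Se e1 _]] := unit_orthogonal2 y y hm.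
have s2 : 0 <= 1 - s ^+ 2.
  by rewrite subr_ge0 -real_normK ?num_real// expr_le1// ler_norml.
exists (s *: y + Num.sqrt (1 - s ^+ 2) *: e).
  rewrite /sphere /= in Sy Se *; rewrite !(dotDl, dotDr, dotZl, dotZr) (dotC y e) e1 Sy Se.
  by rewrite !mulr0 addr0 add0r !mulr1 -!expr2 sqr_sqrtr//; ring.
by rewrite dotDl !dotZl e1 Sy mulr0 addr0 mulr1.
Qed.

Definition zonal_gram k l y : R := I (fun z => (P k * P l).[dot z y]).

(** Integration against the weight P_l(z . y) is invariant under the rotations fixing [y], so the
    product formula applies with pole [y]. *)
Lemma zonal_convolution k l x y : Sp x -> Sp y ->
  I (fun z => (P k).[dot x z] * (P l).[dot z y]) = (P k).[dot x y] * zonal_gram k l y.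
Proof.
move=> Sx Sy; pose J f := I (fun z => f z * (P l).[dot z y]).
have uP := ucb_zonal_r (P l) Sy.
have hJ : sphere_linear J.
  split=> [a f g uf ug|f g uf fg].
    rewrite /J -(quad_lin hI) ?ucb_mul//; try exact: ucb_mul.
    by congr I; apply/funext => z; rewrite mulrDl mulrA.
  by apply: (quad_ext hI) => [|z Sz]; [exact: ucb_mul|rewrite fg].
have inv : fixing_invariant J y.
  move=> Q hQ Qy f uf; rewrite /J -(invI hQ (ucb_mul uf uP)).
  congr I; apply/funext => z; congr (_ * _.[_]).
  by rewrite -{2}Qy act_dot//; case: hQ.
have := zonal_product hJ Sy hm inv k elam lam0 Sx; rewrite {1}/J => ->.
by congr (_ * _); rewrite /J /zonal_gram; congr I; apply/funext => z; rewrite hornerM.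
Qed.

Lemma zonal_gram_const k l x y : Sp x -> Sp y -> zonal_gram k l x = zonal_gram k l y.
Proof. exact: zonal_int_const. Qed.

(** The convolution of P_k and P_l is a multiple of P_k and, by symmetry, the same multiple of P_l.
    If that multiple were not zero the two polynomials would agree on [-1, 1], although their
    degrees differ. *)
Lemma zonal_orthogonal k l y : Sp y -> k != l -> zonal_gram k l y = 0.
Proof.
move=> Sy kl; apply: contraTeq isT => E0.
have h x : Sp x -> (P k - P l).[dot x y] = 0.
  move=> Sx; apply: (mulIf E0); rewrite mul0r hornerD hornerN mulrBl.
  rewrite -(zonal_convolution k l Sx Sy).
  have -> : zonal_gram k l y = zonal_gram l k x.
    by rewrite (zonal_gram_const l k Sx Sy) /zonal_gram mulrC.
  rewrite (dotC x y) -(zonal_convolution l k Sy Sx); apply/eqP; rewrite subr_eq0.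
  by apply/eqP; congr I; apply/funext => z; rewrite mulrC (dotC x) (dotC z y).
have : P k - P l = 0.
  apply: (@poly_eq0_inj _ _ (fun n => n.+1%:R^-1)) => [i j /invr_inj/eqP|n].
    by rewrite eqr_nat eqSS => /eqP.
  have [|x Sx <-] := @sphere_dot_surj y (n.+1%:R^-1) Sy; last exact: h.
  rewrite (le_trans (_ : -1 <= 0)) ?lerN10 ?invr_ge0//=.
  by rewrite invf_le1// ler1n.
move=> /eqP; rewrite subr_eq0 => /eqP/(congr1 (fun p : {poly R} => size p)).
by rewrite !size_geg_poly// => -[/eqP]; rewrite (negbTE kl).
Qed.

Lemma cap_dot (c z : E) : Sp c -> Sp z -> 2 - 2 * dot c z <= m.+1%:R * `|c - z| ^+ 2.
Proof.
move=> Sc Sz.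
have -> : 2 - 2 * dot c z = dot (c - z) (c - z).
  rewrite /sphere /= in Sc Sz.
  by rewrite !(dotDl, dotDr, dotNl, dotNr) (dotC z c) Sc Sz; ring.
apply: (le_trans (_ : _ <= \sum_(i < m.+1) `|c - z| ^+ 2)); last first.
  by rewrite sumr_const card_ord mulr_natl.
apply: ler_sum => i _.
by rewrite -expr2 -real_normK ?num_real// ler_pXn2r ?nnegrE// coord_le_norm.
Qed.

(* Finitely many caps of a given size cover the sphere, and by invariance a
   zonal function has the same integral around each of their centers. *)
Lemma zonal_int_lower (eta : R) : 0 < eta -> exists2 ka, 0 < ka &
  forall q c, 0 <= c -> (forall s, -1 <= s <= 1 -> 0 <= q.[s]) ->
    (forall s, 1 - eta <= s <= 1 -> c <= q.[s]) ->
    forall x, Sp x -> c * ka <= I (fun z => q.[dot z x]).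
Proof.
move=> eta0; pose d := Num.min 1 (eta / m.+1%:R).
have d0 : 0 < d by rewrite lt_min ltr01 divr_gt0.
have [cs [hcs cov]] := @sphere_cover R m d d0.
exists (w / (size cs).+1%:R); first by rewrite divr_gt0.
move=> q c c0 q0 qc x Sx.
have uq y : y \in cs -> ucb Sp (fun z => q.[dot z y]) by move=> /hcs; exact: ucb_zonal_r.
have Iq : 0 <= I (fun z => q.[dot z x]).
  by apply: (quad_ge0 hI) => // [|z Sz]; [exact: ucb_zonal_r|exact/q0/sphere_dot].
have : c * w <= (size cs)%:R * I (fun z => q.[dot z x]).
  rewrite (_ : _ * I _ = \sum_(y <- cs) I (fun z => q.[dot z x])); last first.
    by rewrite big_const_seq count_predT iter_addr_0 mulr_natl.
  rewrite (_ : \sum_(y <- cs) I (fun z => q.[dot z x]) =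
      I (fun z => \sum_(y <- cs | y \in cs) q.[dot z y])); last first.
    rewrite (quad_sum hI) // big_seq; apply: eq_bigr => y /hcs Sy.
    exact: zonal_int_const.
  rewrite -I1 -(quadZ hI _ (ucb_cst _ _)).
  apply: (quad_le hI) => //; [exact: ucb_cst|exact: ucb_sum|].
  move=> z Sz; rewrite mulr1 -big_seq; have [y ycs hy] := cov z Sz.
  rewrite (big_rem y)//= (le_trans (_ : _ <= q.[dot z y]))//.
    apply: qc; have /andP[_ ->] := sphere_dot Sz (hcs y ycs); rewrite andbT.
    have := cap_dot (hcs y ycs) Sz; rewrite (dotC y z).
    have yz : `|y - z| <= d by move: hy; rewrite -ball_normE /= => /ltW.
    have h1 : `|y - z| ^+ 2 <= d.
      apply: (le_trans (_ : _ <= 1 * `|y - z|)); last by rewrite mul1r.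
      by rewrite expr2 ler_wpM2r// (le_trans yz)// ge_min lexx.
    have h2 : m.+1%:R * `|y - z| ^+ 2 <= eta.
      rewrite mulrC -ler_pdivlMr// (le_trans h1)//.
      by rewrite ge_min lexx orbT.
    lra.
  rewrite lerDl big_seq; apply: sumr_ge0 => y' y'cs.
  by apply/q0/sphere_dot => //; apply: hcs; exact: mem_rem y'cs.
move=> h; rewrite mulrA ler_pdivrMr// [leRHS]mulrC (le_trans h)//.
by rewrite ler_wpM2r// ler_nat.
Qed.

Definition bump_poly M : {poly R} := (2^-1 *: (1 + 'X)) ^+ M.

Definition bump_mass M : R := I (fun z => (bump_poly M).[dot z (delta_mx 0 0)]).

Definition approx_kernel M : {poly R} := (bump_mass M)^-1 *: bump_poly M.

Lemma horner_bump M (s : R) : (bump_poly M).[s] = ((1 + s) / 2) ^+ M.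
Proof. by rewrite horner_exp hornerZ hornerD hornerX hornerC mulrC. Qed.

Lemma bump_mass_gt0 M : 0 < bump_mass M.
Proof.
have [ka ka0 h] := zonal_int_lower (ltr01 : 0 < (1 : R)).
have S0 : Sp (delta_mx 0 0 : E) by rewrite /sphere /= dot_delta eqxx.
have hb : (2^-1) ^+ M * ka <= bump_mass M.
  apply: h => //.
  - by move=> s /andP[s1 _]; rewrite horner_bump exprn_ge0//; lra.
  - by move=> s /andP[s1 _]; rewrite horner_bump; apply: lerXn2r; rewrite ?nnegrE; lra.
by apply: lt_le_trans hb; rewrite mulr_gt0// exprn_gt0// invr_gt0.
Qed.

Lemma approx_kernel_ge0 M (s : R) : -1 <= s <= 1 -> 0 <= (approx_kernel M).[s].
Proof.
move=> /andP[s1 _]; rewrite hornerZ mulr_ge0 ?invr_ge0 ?(ltW (bump_mass_gt0 _))//.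
by rewrite horner_bump exprn_ge0//; lra.
Qed.

Lemma approx_kernel_int M x : Sp x -> I (fun z => (approx_kernel M).[dot z x]) = 1.
Proof.
move=> Sx; have S0 : Sp (delta_mx 0 0 : E) by rewrite /sphere /= dot_delta eqxx.
rewrite (zonal_int_const _ Sx S0).
rewrite -[RHS](mulVf (lt0r_neq0 (bump_mass_gt0 M))) /bump_mass.
rewrite -(quadZ hI _ (ucb_zonal_r _ S0)).
by congr I; apply/funext => z; rewrite hornerZ.
Qed.

Lemma size_approx_kernel M : (size (approx_kernel M) <= M.+1)%N.
Proof.
rewrite (leq_trans (size_scale_leq _ _))// (leq_trans (size_poly_exp_leq _ _))//.
rewrite ltnS -[leqRHS]mul1n leq_mul2r.
have : (size (2^-1 *: (1 + 'X) : {poly R}) <= 2)%N.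
  by rewrite (leq_trans (size_scale_leq _ _))// addrC size_XaddC.
by case: (size _) => [|[|[|]]] //=; rewrite orbT.
Qed.

Lemma geometric_small (r e : R) : 0 <= r < 1 -> 0 < e ->
  exists M0, forall M, (M0 <= M)%N -> r ^+ M <= e.
Proof.
move=> /andP[r0 r1] e0.
have : (fun n => r ^+ n) @ \oo --> (0 : R) by apply: cvg_expr; rewrite ger0_norm.
move=> /cvgrPdist_le /(_ e e0)[M0 _ h]; exists M0 => M /h /=.
by rewrite sub0r normrN ger0_norm// exprn_ge0.
Qed.

(** Outside the cap of height [eta] the bump is at most (1 - eta/2)^M, while the smaller cap of
    height eta/2 already gives it mass at least [ka] times (1 - eta/4)^M. The ratio decays
    geometrically, and [M0] depends on [f] only through [C], [d] and [e]. *)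
Lemma approx_kernel_cvg (C d e : R) : 0 <= C -> 0 < d -> 0 < e ->
  exists M0, forall M, (M0 <= M)%N -> forall f, ucb Sp f ->
    (forall x, Sp x -> `|f x| <= C) ->
    (forall x y, Sp x -> Sp y -> `|x - y| <= d -> `|f x - f y| <= e) ->
    forall x, Sp x ->
      `|I (fun z => (approx_kernel M).[dot z x] * f z) - f x| <= 2 * e.
Proof.
move=> C0 d0 e0; pose eta := Num.min 1 (d ^+ 2 / 2).
have eta0 : 0 < eta by rewrite lt_min ltr01 divr_gt0// exprn_gt0.
have eta1 : eta <= 1 by rewrite ge_min lexx.
have [ka ka0 hka] := zonal_int_lower (divr_gt0 eta0 (ltr0Sn R 1)).
pose r := (1 - eta / 2) / (1 - eta / 4).
have r01 : 0 <= r < 1.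
  by rewrite divr_ge0 ?ltr_pdivrMr//=; lra.
have eps0 : 0 < e * ka / (2 * C * w + 1).
  by rewrite divr_gt0 ?mulr_gt0// ltr_wpDl// !mulr_ge0// ltW.
have [M0 hM0] := geometric_small r01 eps0.
exists M0 => M /hM0 hM f uf fC fd x Sx.
have S0 : Sp (delta_mx 0 0 : E) by rewrite /sphere /= dot_delta eqxx.
have mass : (1 - eta / 4) ^+ M * ka <= bump_mass M.
  apply: hka => // [|s /andP[s1 _]|s /andP[s1 _]].
  - by rewrite exprn_ge0//; lra.
  - by rewrite horner_bump exprn_ge0//; lra.
  - by rewrite horner_bump; apply: lerXn2r; rewrite ?nnegrE; lra.
have mass0 := bump_mass_gt0 M.
pose b := (1 - eta / 2) ^+ M / bump_mass M.
have b0 : 0 <= b by rewrite divr_ge0 ?exprn_ge0 ?(ltW mass0)//; lra.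
have bC : 2 * C * w * b <= e.
  have b1 : b <= r ^+ M / ka.
    rewrite /b /r expr_div_n -mulrA -invfM; apply: ler_wpM2l.
      by rewrite exprn_ge0//; lra.
    by rewrite lef_pV2// posrE mulr_gt0// exprn_gt0//; lra.
  have b2 : b <= e / (2 * C * w + 1).
    rewrite (le_trans b1)// ler_pdivrMr// (le_trans hM)//.
    by rewrite mulrAC.
  have D0 : 0 <= 2 * C * w by rewrite !mulr_ge0// ltW.
  apply: (le_trans (ler_wpM2l D0 b2)); rewrite mulrCA ler_piMr ?(ltW e0)//.
  by rewrite ler_pdivrMr ?ltr_wpDl// mul1r lerDl.
have uG := ucb_zonal_r (approx_kernel M) Sx.
have ufx : ucb Sp (fun z => f z - f x) by apply: ucb_sub => //; exact: ucb_cst.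
have -> : I (fun z => (approx_kernel M).[dot z x] * f z) - f x =
    I (fun z => (approx_kernel M).[dot z x] * (f z - f x)).
  rewrite -[X in _ - X]mulr1 -(approx_kernel_int M Sx) -(quadZ hI)//.
  rewrite -(quadB hI) ?ucb_mul//; last exact: ucb_scale; last exact: ucb_mul.
  by congr I; apply/funext => z; rewrite mulrBr [f x * _]mulrC.
have uB : ucb Sp (fun z => e * (approx_kernel M).[dot z x] + 2 * C * b).
  by apply: ucb_add; [exact: ucb_scale|exact: ucb_cst].
have -> : 2 * e = I (fun z => e * (approx_kernel M).[dot z x]) + e.
  by rewrite (quadZ hI)// approx_kernel_int// mulr1; ring.
apply: (le_trans (quad_norm_le hI isT (ucb_mul uG ufx) uB _)).
  move=> z Sz; have zx := sphere_dot Sz Sx.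
  have G0 := approx_kernel_ge0 M zx.
  rewrite normrM (ger0_norm G0).
  have [xz|xz] := leP `|z - x| d.
    rewrite mulrC (le_trans (ler_wpM2r G0 (fd z x Sz Sx xz)))// lerDl.
    by apply: mulr_ge0 => //; apply: mulr_ge0.
  have hs : dot z x <= 1 - eta.
    have h1 := dist_dot Sz Sx.
    have h2 : d ^+ 2 <= `|z - x| ^+ 2 by rewrite ler_pXn2r ?nnegrE ?(ltW d0) ?(ltW xz).
    have h3 : eta <= d ^+ 2 / 2 by rewrite ge_min lexx orbT.
    lra.
  have Gb : (approx_kernel M).[dot z x] <= b.
    rewrite hornerZ horner_bump mulrC /b; apply: ler_wpM2r.
      by rewrite invr_ge0 ltW.
    by move/andP: zx => [zx _]; apply: lerXn2r; rewrite ?nnegrE; lra.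
  have h2C : `|f z - f x| <= 2 * C.
    by rewrite (le_trans (ler_normB _ _))//; have := fC z Sz; have := fC x Sx; lra.
  apply: (le_trans (_ : _ <= 2 * C * b)); last by rewrite lerDr mulr_ge0// ltW.
  by rewrite mulrC; apply: ler_pM.
rewrite (quadD hI); [|exact: ucb_scale|exact: ucb_cst].
rewrite lerD2l; have := quadZ hI (2 * C * b) (ucb_cst Sp 1); rewrite mulr1 I1 => ->.
by rewrite mulrAC.
Qed.

End InvariantIntegral.

(** * Convolution with a measure invariant around the pole *)

Section ZonalConvolution.
Variables (R : realType) (m : nat).
Local Notation E := (E R m).
Local Notation Sp := (@sphere R m : set E).
Variables (I : (E -> R) -> R) (w lam : R).
Hypotheses (hm : (2 <= m)%N) (hI : quadratic_limit true I w) (w0 : 0 < w)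
  (I1 : I (fun=> 1) = w) (elam : 2 * lam + 1 = m%:R) (lam0 : 0 < lam)
  (invI : forall O : 'M[R]_(m.+1), rotation O -> forall f, ucb Sp f ->
     I (fun z => f (act O z)) = I f).
Implicit Types (x y z : E) (f g : E -> R) (p q : {poly R}).
Local Notation P := (geg_poly lam).

Lemma ucb_dot2 : ucb (Sp `*` Sp) (fun v : E * E => dot v.2 v.1).
Proof.
apply: ucb_dot; first exact: sphere_valued_snd.
exact: (sphere_valued_fst (@sphere_valued_id R m)).
Qed.

Lemma ucb_fst f : ucb Sp f -> ucb (Sp `*` Sp) (fun v : E * E => f v.1).
Proof. by move=> uf; exact: (ucb_sphere_valued (sphere_valued_fst (@sphere_valued_id R m)) uf). Qed.

Lemma ucb_snd f : ucb Sp f -> ucb (Sp `*` Sp) (fun v : E * E => f v.2).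
Proof. by move=> uf; exact: (ucb_sphere_valued (@sphere_valued_snd R m _ Sp) uf). Qed.

Definition band k f y : R := I (fun z => (P k).[dot z y] * f z).

Lemma ucb_band k f : ucb Sp f -> ucb Sp (band k f).
Proof.
move=> uf; apply: (@ucb_param _ _ _ _ _ hI _ _ (fun v : E * E => (P k).[dot v.2 v.1] * f v.2)).
by apply: ucb_mul; [exact/ucb_horner/ucb_dot2|exact: ucb_snd].
Qed.

Lemma band_orthogonal k l f x : ucb Sp f -> Sp x -> k != l ->
  I (fun y => band k f y * (P l).[dot x y]) = 0.
Proof.
move=> uf Sx kl.
transitivity (I (fun y => I (fun z => f z * ((P k).[dot z y] * (P l).[dot x y])))).
  apply: (quad_ext hI) => [|y Sy].
    by apply: ucb_mul; [exact: ucb_band|exact: ucb_zonal_l].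
  rewrite mulrC /band -(quadZ hI); last first.
    by apply: ucb_mul => //; exact: ucb_zonal_r.
  by congr I; apply/funext => z; rewrite [LHS]mulrCA [LHS]mulrA [RHS]mulrC.
rewrite (quad_fubini hI hI (F := fun v : E * E => f v.2 * ((P k).[dot v.2 v.1] * (P l).[dot x
  v.1]))); last first.
  apply: ucb_mul; first exact: ucb_snd.
  apply: ucb_mul; first exact/ucb_horner/ucb_dot2.
  by apply: (ucb_fst (f := fun y => (P l).[dot x y])); exact: ucb_zonal_l.
rewrite -[RHS](quad0 hI); apply: (quad_ext hI); last first.
  move=> z Sz /=; rewrite (quadZ hI).
    have := zonal_convolution hm hI elam lam0 invI k l Sz Sx.
    rewrite (zonal_orthogonal hm hI elam lam0 invI Sx kl) mulr0.
    under [X in I X = _ -> _]eq_fun => y do rewrite (dotC y x).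
    by move=> ->; rewrite mulr0.
  by apply: ucb_mul; exact: ucb_zonal_l.
apply: (@ucb_param _ _ _ _ _ hI _ _ (fun v : E * E => f v.1 * ((P k).[dot v.1 v.2] * (P l).[dot x
  v.2]))).
apply: ucb_mul; first exact: ucb_fst.
apply: ucb_mul.
  apply: (ucb_eq (f := fun v : E * E => (P k).[dot v.2 v.1])) => [v _|]; first by rewrite dotC.
  exact/ucb_horner/ucb_dot2.
by apply: (ucb_snd (f := fun y => (P l).[dot x y])); exact: ucb_zonal_l.
Qed.

(** Averaging against the approximate identity is, after its expansion in Gegenbauer polynomials, a
    finite combination of bands. *)
Lemma band_approx f e : ucb Sp f -> 0 < e -> exists n (a : nat -> R),
  forall y, Sp y -> `|f y - \sum_(k < n) a k * band k f y| <= e.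
Proof.
move=> uf e0; have [C C0 hC] := ucb_bound uf; have [_ hu] := uf.
have e2 : 0 < e / 2 by rewrite divr_gt0.
have [d d0 hd] := hu _ e2.
have [M hM] := approx_kernel_cvg hm hI w0 I1 invI (ltW C0) d0 e2.
have [a ha] := geg_poly_expansion lam0 (size_approx_kernel I M).
exists M.+1, a => y Sy; have := hM M (leqnn M) f uf hC hd y Sy.
rewrite distrC mulrC divfK//; congr (`|_ - _| <= _).
transitivity (I (fun z => \sum_(k < M.+1) a k * ((P k).[dot z y] * f z))).
  congr I; apply/funext => z; rewrite ha horner_sum mulr_suml.
  by apply: eq_bigr => k _; rewrite hornerZ mulrA.
have u k : ucb Sp (fun z => (P k).[dot z y] * f z).
  by apply: ucb_mul => //; exact: ucb_zonal_r.
rewrite (quad_sum hI) => [|k _]; last exact: ucb_scale.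
by apply: eq_bigr => k _; rewrite (quadZ hI).
Qed.

Variables (posJ : bool) (J : (E -> R) -> R) (MJ : R) (xi : E) (rot : E -> 'M[R]_(m.+1)).
Hypotheses (hJ : quadratic_limit posJ J MJ) (Sxi : Sp xi) (invJ : fixing_invariant J xi)
  (hrot : forall y, Sp y -> rotation (rot y) /\ act (rot y) y = xi).

(** The integral of [f] against mu \o O_y after a change of variables; the transpose is the inverse
    rotation. *)
Definition zonal_conv f y : R := w^-1 * J (fun z => f (act (rot y)^T z)).

Definition zonal_multiplier k : R := w^-1 * J (fun z => (P k).[dot xi z]).

Lemma ucb_act Q f : rotation Q -> ucb Sp f -> ucb Sp (fun z => f (act Q z)).
Proof.
by move=> hQ uf; exact: (ucb_sphere_valued (sphere_valued_act hQ (@sphere_valued_id R m)) uf).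
Qed.

Lemma zonal_conv_geg k x y : Sp x -> Sp y ->
  zonal_conv (fun z => (P k).[dot x z]) y = zonal_multiplier k * (P k).[dot x y].
Proof.
move=> Sx Sy; have [hQ Qy] := hrot Sy; rewrite /zonal_conv /zonal_multiplier.
rewrite -mulrA; congr (_ * _).
transitivity (J (fun z => (P k).[dot (act (rot y) x) z])).
  congr J; apply/funext => z; rewrite act_dot_tr ?trmxK//; exact: rotation_tr.
rewrite (zonal_product (quadratic_limit_linear hJ) Sxi hm invJ k elam lam0 (act_sphere hQ Sx)).
rewrite -[X in dot _ X]Qy act_dot; last by case: hQ.
rewrite mulrC; congr (_ * _); congr J; apply/funext => z.
by rewrite (dotC z).
Qed.

Lemma zonal_conv_band k f y : ucb Sp f -> Sp y ->
  zonal_conv (band k f) y = zonal_multiplier k * band k f y.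
Proof.
move=> uf Sy; have [hQ Qy] := hrot Sy; have hQt := rotation_tr hQ.
pose F (v : E * E) := (P k).[dot v.2 (act (rot y)^T v.1)] * f v.2.
have uF : ucb (Sp `*` Sp) F.
  apply: ucb_mul; last exact: ucb_snd.
  apply: ucb_horner; apply: ucb_dot; first exact: sphere_valued_snd.
  exact: (sphere_valued_act hQt (sphere_valued_fst (@sphere_valued_id R m))).
rewrite {1}/zonal_conv [J _](_ : _ = J (fun x => I (fun z => F (x, z))))//.
have u2 := ucb_param hJ (ucb_swap uF).
rewrite (quad_fubini hJ hI uF) -(quadZ hI); last exact: u2.
rewrite /band -(quadZ hI); last by apply: ucb_mul => //; exact: ucb_zonal_r.
apply: (quad_ext hI); first exact: (ucb_scale _ u2).
move=> z Sz; rewrite mulrA -(zonal_conv_geg k Sz Sy) /zonal_conv -mulrA; congr (_ * _).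
have u1 : ucb Sp (fun x => (P k).[dot z (act (rot y)^T x)]).
  by apply: (ucb_act (f := fun x => (P k).[dot z x]) hQt); exact: ucb_zonal_l.
rewrite mulrC -(quadZ hJ)//; congr J; apply/funext => x.
by rewrite mulrC.
Qed.

Lemma zonal_conv_sum n (a : nat -> R) f y : ucb Sp f -> Sp y ->
  zonal_conv (fun z => \sum_(k < n) a k * band k f z) y =
  \sum_(k < n) a k * zonal_multiplier k * band k f y.
Proof.
move=> uf Sy; have [hQ Qy] := hrot Sy; have hQt := rotation_tr hQ.
have u k : ucb Sp (fun z => band k f (act (rot y)^T z)).
  by apply: ucb_act => //; exact: ucb_band.
rewrite /zonal_conv (quad_sum hJ) => [|k _]; last exact/ucb_scale/u.
rewrite mulr_sumr; apply: eq_bigr => k _.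
by rewrite (quadZ hJ)// mulrCA -mulrA -zonal_conv_band.
Qed.

Lemma zonal_conv_dist f g C y : 0 <= C -> ucb Sp f -> ucb Sp g -> Sp y ->
  (forall x, Sp x -> `|f x - g x| <= C) ->
  `|zonal_conv f y - zonal_conv g y| <= w^-1 * MJ * C.
Proof.
move=> C0 uf ug Sy fg; have [hQ Qy] := hrot Sy; have hQt := rotation_tr hQ.
rewrite -mulrBr normrM ger0_norm ?invr_ge0 ?(ltW w0)// -mulrA.
rewrite ler_wpM2l ?invr_ge0 ?(ltW w0)//.
apply: (quad_dist hJ) => //; try exact: ucb_act.
by move=> x Sx; apply: fg; exact: act_sphere.
Qed.

(** The choice [rot] need not depend continuously on the point, so regularity cannot be read off the
    definition. It holds on bands, which are only multiplied by constants, and passes to uniform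
    limits. *)
Lemma ucb_zonal_conv f : ucb Sp f -> ucb Sp (zonal_conv f).
Proof.
move=> uf; apply: ucb_unif_lim => e e0.
have MJ0 := quad_M_ge0 hJ.
have K0 : 0 < w^-1 * MJ + 1 by rewrite ltr_wpDl// mulr_ge0// invr_ge0 ltW.
have [n [a ha]] := band_approx uf (divr_gt0 e0 K0).
exists (fun y => \sum_(k < n) a k * zonal_multiplier k * band k f y).
  by apply: ucb_sum => k _; apply: ucb_scale; exact: ucb_band.
move=> y Sy; rewrite -zonal_conv_sum//.
apply: (le_trans (zonal_conv_dist _ _ _ Sy ha)) => //.
- by rewrite divr_ge0// ltW.
- by apply: ucb_sum => k _; apply: ucb_scale; exact: ucb_band.
by rewrite mulrCA ler_piMr ?(ltW e0)// ler_pdivrMr// mul1r lerDl.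
Qed.

(** For a finite combination of bands, orthogonality leaves only degree [l]. The general case
    follows by uniform approximation, since convolution is bounded for the uniform norm. *)
Lemma zonal_conv_multiplier f l x : ucb Sp f -> Sp x ->
  I (fun y => zonal_conv f y * (P l).[dot x y]) =
  zonal_multiplier l * I (fun y => f y * (P l).[dot x y]).
Proof.
move=> uf Sx; have uP := ucb_zonal_l (P l) Sx; have [C C0 hC] := ucb_bound uP.
have uTf := ucb_zonal_conv uf.
apply: (@eq_of_dist_le _ _ _ (w * (w^-1 * MJ * C) + `|zonal_multiplier l| * (w * C))) => e e0.
have [n [a ha]] := band_approx uf e0.
pose g z := \sum_(k < n) a k * band k f z.
pose h z := \sum_(k < n) a k * zonal_multiplier k * band k f z.
have ug : ucb Sp g by apply: ucb_sum => k _; apply: ucb_scale; exact: ucb_band.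
have uh : ucb Sp h by apply: ucb_sum => k _; apply: ucb_scale; exact: ucb_band.
have ub k : ucb Sp (fun y => band k f y * (P l).[dot x y]).
  by apply: ucb_mul => //; exact: ucb_band.
have e1 : I (fun y => h y * (P l).[dot x y]) =
    zonal_multiplier l * I (fun y => g y * (P l).[dot x y]).
  have -> : I (fun y => h y * (P l).[dot x y]) =
      \sum_(k < n) a k * zonal_multiplier k * I (fun y => band k f y * (P l).[dot x y]).
    transitivity (I (fun y => \sum_(k < n) a k * zonal_multiplier k * (band k f y * (P l).[dot x y]))).
      by congr I; apply/funext => y; rewrite mulr_suml; apply: eq_bigr => k _; rewrite mulrA.
    rewrite (quad_sum hI) => [|k _]; last exact: ucb_scale.
    by apply: eq_bigr => k _; rewrite (quadZ hI).
  have -> : I (fun y => g y * (P l).[dot x y]) =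
      \sum_(k < n) a k * I (fun y => band k f y * (P l).[dot x y]).
    transitivity (I (fun y => \sum_(k < n) a k * (band k f y * (P l).[dot x y]))).
      by congr I; apply/funext => y; rewrite mulr_suml; apply: eq_bigr => k _; rewrite mulrA.
    rewrite (quad_sum hI) => [|k _]; last exact: ucb_scale.
    by apply: eq_bigr => k _; rewrite (quadZ hI).
  rewrite mulr_sumr; apply: eq_bigr => k _.
  have [->|kl] := eqVneq (k : nat) l; first by rewrite [RHS]mulrCA mulrA.
  by rewrite band_orthogonal// !mulr0.
have h1 : `|I (fun y => zonal_conv f y * (P l).[dot x y]) - I (fun y => h y * (P l).[dot x y])|
    <= w * (w^-1 * MJ * e * C).
  have B0 : 0 <= w^-1 * MJ * e.
    by rewrite !mulr_ge0 ?invr_ge0 ?(ltW w0) ?(quad_M_ge0 hJ)// ltW.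
  apply: (quad_dist hI); [exact: mulr_ge0 B0 (ltW C0)|exact: ucb_mul|exact: ucb_mul|].
  move=> y Sy; rewrite -mulrBl normrM; apply: ler_pM => //; last exact: hC.
  by rewrite /h -zonal_conv_sum//; apply: zonal_conv_dist => //; exact: ltW.
have h2 : `|I (fun y => f y * (P l).[dot x y]) - I (fun y => g y * (P l).[dot x y])|
    <= w * (e * C).
  apply: (quad_dist hI); [exact: mulr_ge0 (ltW e0) (ltW C0)|exact: ucb_mul|exact: ucb_mul|].
  by move=> y Sy; rewrite -mulrBl normrM; apply: ler_pM => //; [exact: ha|exact: hC].
rewrite e1 in h1; move: h1 h2.
move: (I _) (I _) (I _) (zonal_multiplier l) => D B A mu h1 h2.
have h3 : `|mu * (B - D)| <= `|mu| * (w * (e * C)).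
  by rewrite normrM ler_wpM2l// distrC.
have h4 := ler_normD (A - mu * B) (mu * (B - D)).
have -> : A - mu * D = A - mu * B + mu * (B - D) by ring.
apply: (le_trans h4); apply: (le_trans (lerD h1 h3)).
by rewrite le_eqVlt; apply/orP; left; apply/eqP; ring.
Qed.

End ZonalConvolution.

(** * Traces of the kernel *)

Lemma quadratic_discriminant (R : realType) (A b c : R) : 0 <= A -> 0 <= c ->
  (forall t, 0 <= A + 2 * (t * b) + t ^+ 2 * c) -> b ^+ 2 <= A * c.
Proof.
move=> A0 c0 key; have [c00|cn0] := eqVneq c 0.
  (* If [c = 0] the expression is affine in [t], and this [t] makes it equal to -1 unless
     [b = 0]. *)
  rewrite c00 mulr0; have := key (- (A + 1) / (2 * b)).
  have [->|b0] := eqVneq b 0; first by rewrite expr0n.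
  rewrite c00 mulr0 addr0 (_ : 2 * _ = - (A + 1)); first by lra.
  by field.
have cp : 0 < c by rewrite lt_neqAle eq_sym cn0.
have := key (- b / c).
rewrite (_ : _ + _ + _ = A - b ^+ 2 / c); last by field.
by rewrite subr_ge0 ler_pdivrMr.
Qed.

Section KernelForm.
Variables (R : realType) (m : nat).
Local Notation E := (E R m).
Local Notation Sp := (@sphere R m : set E).
Variables (I : (E -> R) -> R) (w : R) (K : E -> E -> R).
Hypotheses (hI : quadratic_limit true I w) (w0 : 0 < w) (I1 : I (fun=> 1) = w)
  (uK : ucb (Sp `*` Sp) (fun v : E * E => K v.1 v.2))
  (symK : forall x y, Sp x -> Sp y -> K x y = K y x)
  (pdK : forall s : seq (R * E), (forall p, p \in s -> Sp p.2) -> 0 <= pre_norm2 K s).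
Implicit Types (x y z : E) (f g h : E -> R) (s : seq (R * E)).

Definition kernel_form f : R := I (fun x => I (fun y => K x y * (f x * f y))).

Definition kernel_pair s f : R := \sum_(p <- s) p.1 * I (fun y => K p.2 y * f y).

Lemma ucb_kernel_r x : Sp x -> ucb Sp (K x).
Proof. by move=> Sx; exact: (ucb_section uK Sx). Qed.

Lemma ucb_form2 f : ucb Sp f -> ucb (Sp `*` Sp) (fun v : E * E => K v.1 v.2 * (f v.1 * f v.2)).
Proof.
by move=> uf; apply: ucb_mul => //; apply: ucb_mul; [exact: ucb_fst|exact: ucb_snd].
Qed.

Lemma pre_norm2_cat s s' : (forall p, p \in s -> Sp p.2) -> (forall p, p \in s' -> Sp p.2) ->
  pre_norm2 K (s ++ s') = pre_norm2 K s
    + 2 * (\sum_(p <- s) p.1 * \sum_(q <- s') q.1 * K p.2 q.2) + pre_norm2 K s'.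
Proof.
move=> hs hs'; rewrite /pre_norm2 big_cat /=.
under eq_bigr => p _ do rewrite big_cat /=.
under [X in _ + X]eq_bigr => p _ do rewrite big_cat /=.
rewrite !big_split /=.
have -> : \sum_(p <- s') \sum_(q <- s) p.1 * q.1 * K p.2 q.2 =
    \sum_(p <- s) \sum_(q <- s') p.1 * q.1 * K p.2 q.2.
  rewrite exchange_big /= big_seq [RHS]big_seq; apply: eq_bigr => p /hs Sp2.
  rewrite big_seq [RHS]big_seq; apply: eq_bigr => q /hs' Sq2.
  by rewrite symK// [q.1 * _]mulrC.
have -> : \sum_(p <- s) p.1 * (\sum_(q <- s') q.1 * K p.2 q.2) =
    \sum_(p <- s) \sum_(q <- s') p.1 * q.1 * K p.2 q.2.
  by apply: eq_bigr => p _; rewrite mulr_sumr; apply: eq_bigr => q _; rewrite mulrA.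
ring.
Qed.

(* The quadratic form of [K] at the measure [sum_p p.1 delta_(p.2) + h dsigma],
   obtained from finite point masses by quadrature. *)
Lemma mixed_form_ge0 s h : (forall p, p \in s -> Sp p.2) -> ucb Sp h ->
  0 <= pre_norm2 K s + 2 * kernel_pair s h + kernel_form h.
Proof.
move=> hs uh; pose A : R := \sum_(p <- s) `|p.1|.
have A0 : 0 <= A by apply: sumr_ge0.
have B0 : 0 < 2 * (w * w) + 2 * (w * A) + 1 by rewrite ltr_wpDl// addr_ge0 ?mulr_ge0// ltW.
suff key (e : R) : 0 < e -> 0 <= pre_norm2 K s + 2 * kernel_pair s h + kernel_form h +
    (2 * (w * w) + 2 * (w * A)) * e.
  rewrite -oppr_le0; apply/ler_addgt0Pr => e e0.
  have := key _ (divr_gt0 e0 B0).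
  have : (2 * (w * w) + 2 * (w * A)) * (e / (2 * (w * w) + 2 * (w * A) + 1)) <= e.
    by rewrite mulrCA ler_piMr ?(ltW e0)// ler_pdivrMr// mul1r lerDl.
  lra.
move=> e0; pose F (v : E * E) := K v.1 v.2 * (h v.1 * h v.2).
have uF : ucb (Sp `*` Sp) F by exact: ucb_form2.
pose G (v : E * E) := K v.1 v.2 * h v.2.
have uG : ucb (Sp `*` Sp) G by apply: ucb_mul => //; exact: ucb_snd.
have [_ /(_ e e0)[d1 d10 hd1]] := uF; have [_ /(_ e e0)[d2 d20 hd2]] := uG.
pose d := Num.min d1 d2; have d0 : 0 < d by rewrite lt_min d10.
have [_ /(_ d d0)[W [W1 W2 W3]]] := hI.
have W0 p : p \in W -> Sp p.2 by move=> /W1[].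
have hF1 x : Sp x -> `|I (fun y => F (x, y)) - discr W (fun y => F (x, y))| <= w * e.
  move=> Sx; apply: W3; first exact: ucb_section uF Sx.
  move=> y z Sy Sz yz; apply: hd1 => //.
  rewrite prod_normE /= subrr normr0 ge_max (ltW d10) (le_trans yz)//.
  by rewrite ge_min lexx.
have uFs y : Sp y -> ucb Sp (fun x => F (x, y)) by exact: (ucb_section (ucb_swap uF)).
have uD : ucb Sp (fun x => discr W (fun y => F (x, y))).
  rewrite /discr; under eq_fun do rewrite big_seq; apply: ucb_sum => p /W0 Sp2.
  exact/ucb_scale/uFs.
have hF2 : `|kernel_form h - I (fun x => discr W (fun y => F (x, y)))| <= w * (w * e).
  apply: (quad_dist hI) => //; first by rewrite mulr_ge0 ?ltW.
  exact: (ucb_param hI uF).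
have hF3 : `|I (fun x => discr W (fun y => F (x, y)))
    - discr W (fun x => discr W (fun y => F (x, y)))| <= w * (w * e).
  apply: W3 => // x x' Sx Sx' xx'.
  have -> : discr W (fun y => F (x, y)) - discr W (fun y => F (x', y)) =
      discr W (fun y => F (x, y) - F (x', y)).
    by rewrite /discr -sumrB; apply: eq_bigr => p _; rewrite mulrBr.
  apply: (le_trans (discr_bound (ltW e0) W0 _)); last by rewrite ler_wpM2r// ltW.
  move=> y Sy; apply: hd1 => //.
  rewrite prod_normE /= subrr normr0 ge_max (ltW d10) andbT (le_trans xx')//.
  by rewrite ge_min lexx.
have hG : `|kernel_pair s h - \sum_(p <- s) p.1 * discr W (fun y => G (p.2, y))| <= A * (w * e).
  rewrite /kernel_pair -sumrB (le_trans (ler_norm_sum _ _ _))// mulr_suml.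
  rewrite big_seq [leRHS]big_seq; apply: ler_sum => p /hs Sp2.
  rewrite -mulrBr normrM ler_wpM2l//; apply: W3; first exact: ucb_section uG Sp2.
  move=> y z Sy Sz yz; apply: (hd2 (p.2, y) (p.2, z)) => //.
  rewrite prod_normE /= subrr normr0 ge_max (ltW d20) (le_trans yz)//.
  by rewrite ge_min lexx orbT.
pose s' := [seq (p.1 * h p.2, p.2) | p <- W].
have hs' p : p \in s' -> Sp p.2 by move=> /mapP[q /W0 Sq ->].
have hss p : p \in s ++ s' -> Sp p.2 by rewrite mem_cat => /orP[/hs|/hs'].
have := pdK hss; rewrite pre_norm2_cat//.
have -> : \sum_(p <- s) p.1 * (\sum_(q <- s') q.1 * K p.2 q.2) =
    \sum_(p <- s) p.1 * discr W (fun y => G (p.2, y)).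
  apply: eq_bigr => p _; rewrite /s' big_map; congr (_ * _).
  by apply: eq_bigr => q _; rewrite /= -mulrA [h _ * _]mulrC.
have -> : pre_norm2 K s' = discr W (fun x => discr W (fun y => F (x, y))).
  rewrite /pre_norm2 /s' big_map; apply: eq_bigr => p _; rewrite big_map mulr_sumr.
  by apply: eq_bigr => q _; rewrite /F /=; ring.
move: hF2 hF3 hG; rewrite !ler_norml => /andP[+ _] /andP[+ _] /andP[+ _]; lra.
Qed.

Lemma kernel_form_ge0 h : ucb Sp h -> 0 <= kernel_form h.
Proof.
move=> uh; have := @mixed_form_ge0 [::] h _ uh.
rewrite /pre_norm2 /kernel_pair !big_nil mulr0 !add0r; exact.
Qed.

Lemma kernel_formZ a h : ucb Sp h -> kernel_form (fun x => a * h x) = a ^+ 2 * kernel_form h.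
Proof.
move=> uh; have uF := ucb_form2 uh.
rewrite /kernel_form -(quadZ hI); last exact: (ucb_param hI uF).
apply: (quad_ext hI).
  apply: (ucb_param hI (F := fun v : E * E => K v.1 v.2 * ((a * h v.1) * (a * h v.2)))).
  by apply: (@ucb_form2 (fun x => a * h x)); exact: ucb_scale.
move=> x Sx; rewrite -(quadZ hI); last exact: (ucb_section uF Sx).
by congr I; apply/funext => y; ring.
Qed.

(** Cauchy-Schwarz for the energy of [K] between point masses and a density, from the positivity of
    the mixed form at all multiples of [h]. *)
Lemma kernel_pair_le s h : (forall p, p \in s -> Sp p.2) -> ucb Sp h ->
  kernel_pair s h ^+ 2 <= pre_norm2 K s * kernel_form h.
Proof.
move=> hs uh.
have key a : 0 <= pre_norm2 K s + 2 * (a * kernel_pair s h) + a ^+ 2 * kernel_form h.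
  have := mixed_form_ge0 hs (ucb_scale a uh); rewrite kernel_formZ//.
  suff -> : kernel_pair s (fun x => a * h x) = a * kernel_pair s h by [].
  rewrite /kernel_pair mulr_sumr big_seq [RHS]big_seq; apply: eq_bigr => p /hs Sp2.
  rewrite mulrCA; congr (_ * _); rewrite -(quadZ hI).
    by congr I; apply/funext => y; rewrite mulrCA.
  by apply: ucb_mul => //; exact: ucb_kernel_r.
apply: quadratic_discriminant key; [exact: pdK|exact: kernel_form_ge0].
Qed.

Lemma kernel_form_dist f g C e : 0 <= C -> 0 <= e <= 1 -> ucb Sp f -> ucb Sp g ->
  (forall x, Sp x -> `|g x| <= C) -> (forall x, Sp x -> `|f x - g x| <= e) ->
  forall CK, (forall x y, Sp x -> Sp y -> `|K x y| <= CK) ->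
  `|kernel_form f - kernel_form g| <= w * (w * (CK * ((2 * C + 1) * e))).
Proof.
move=> C0 /andP[e0 e1] uf ug gC fg CK hCK.
have CK0 : 0 <= CK.
  by have [x Sx] := sphere_nonempty R m; apply: le_trans (hCK x x Sx Sx).
have b0 : 0 <= CK * ((2 * C + 1) * e) by rewrite !mulr_ge0// addr_ge0// mulr_ge0.
apply: (quad_dist hI); [by rewrite mulr_ge0// ltW|exact: (ucb_param hI (ucb_form2 uf))|exact:
  (ucb_param hI (ucb_form2 ug))|].
move=> x Sx; apply: (quad_dist hI) => //;
  [exact: (ucb_section (ucb_form2 uf) Sx)|exact: (ucb_section (ucb_form2 ug) Sx)|].
move=> y Sy; rewrite -mulrBr normrM; apply: ler_pM => //; first exact: hCK.
rewrite (_ : _ - _ = (f x - g x) * (f y - g y) + (f x - g x) * g y + g x * (f y - g y)); last by ring.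
apply: (le_trans (ler_normD _ _)); apply: (le_trans (lerD (ler_normD _ _) (lexx _))).
rewrite !normrM.
have h1 : `|f x - g x| * `|f y - g y| <= e * 1.
  by apply: ler_pM => //; [exact: fg|exact: le_trans (fg y Sy) e1].
have h2 : `|f x - g x| * `|g y| <= e * C by apply: ler_pM => //; [exact: fg|exact: gC].
have h3 : `|g x| * `|f y - g y| <= C * e by apply: ler_pM => //; [exact: gC|exact: fg].
lra.
Qed.

Lemma norm_triple (a b c : E) : `|((a, b), c)| = Num.max (Num.max `|a| `|b|) `|c| :> R.
Proof. by rewrite !prod_normE. Qed.

Lemma ucb_triple (T : (E * E) * E -> R) : ucb ((Sp `*` Sp) `*` Sp) T ->
  ucb (Sp `*` Sp) (fun v : E * E => I (fun y => T ((v.2, y), v.1))).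
Proof.
move=> uT; apply: (ucb_param hI (F := fun v : (E * E) * E => T ((v.1.2, v.2), v.1.1))).
apply: (@ucb_comp _ _ _ _ _ (fun v : (E * E) * E => ((v.1.2, v.2), v.1.1)) T 1 _ _ uT).
  by move=> [[a b] c] [[]].
move=> [[a b] c] [[a' b'] c'] _ _; rewrite mul1r.
rewrite -[X in `|X| <= _]/((b - b', c - c'), a - a').
rewrite -[X in _ <= `|X|]/((a - a', b - b'), c - c') !norm_triple.
by rewrite maxC maxA.
Qed.

Lemma quad_triple (T : (E * E) * E -> R) : ucb ((Sp `*` Sp) `*` Sp) T ->
  I (fun z => I (fun x => I (fun y => T ((x, y), z)))) =
  I (fun x => I (fun y => I (fun z => T ((x, y), z)))).
Proof.
move=> uT; have uF1 := ucb_triple uT.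
rewrite (quad_fubini hI hI uF1); apply: (quad_ext hI).
  exact: (ucb_param hI (ucb_swap uF1)).
move=> x Sx /=; apply: (quad_fubini hI hI (F := fun v : E * E => T ((x, v.2), v.1))).
apply: (@ucb_comp _ _ _ _ _ (fun v : E * E => ((x, v.2), v.1)) T 1 _ _ uT).
  by move=> v [].
move=> [a b] [a' b'] _ _; rewrite mul1r.
rewrite -[X in `|X| <= _]/((x - x, b - b'), a - a').
rewrite -[X in _ <= `|X|]/(a - a', b - b') norm_triple prod_normE /= subrr normr0.
by rewrite !ge_max !le_max normr_ge0 !lexx orbT.
Qed.

End KernelForm.

(** * Traces of the kernel on spherical harmonics *)

Section KernelSpectrum.
Variables (R : realType) (m : nat).
Local Notation E := (E R m).
Local Notation Sp := (@sphere R m : set E).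
Variables (I : (E -> R) -> R) (w lam : R) (K : E -> E -> R).
Hypotheses (hm : (2 <= m)%N) (hI : quadratic_limit true I w) (w0 : 0 < w)
  (I1 : I (fun=> 1) = w) (elam : 2 * lam + 1 = m%:R) (lam0 : 0 < lam)
  (invI : forall O : 'M[R]_(m.+1), rotation O -> forall f, ucb Sp f ->
     I (fun z => f (act O z)) = I f)
  (uK : ucb (Sp `*` Sp) (fun v : E * E => K v.1 v.2))
  (symK : forall x y, Sp x -> Sp y -> K x y = K y x)
  (pdK : forall s : seq (R * E), (forall p, p \in s -> Sp p.2) -> 0 <= pre_norm2 K s).
Implicit Types (x y z : E) (f g h : E -> R) (p : {poly R}).
Local Notation P := (geg_poly lam).
Local Notation north := (delta_mx 0 0 : E).

Definition zonal_norm k : R := zonal_gram I lam k k north.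

Definition zonal_trace p : R := I (fun x => I (fun y => K x y * p.[dot x y])).

(* Up to the normalization of [P k], the trace of the integral operator with
   kernel [K] on the spherical harmonics of degree [k]. *)
Definition degree_trace k : R := zonal_norm k * zonal_trace (P k).

Lemma north_sphere : Sp north. Proof. by rewrite /sphere /= dot_delta eqxx. Qed.

Lemma ucb_dot12 : ucb (Sp `*` Sp) (fun v : E * E => dot v.1 v.2).
Proof. by apply: (ucb_eq _ (@ucb_dot2 R m)) => v _; rewrite dotC. Qed.

Lemma ucb_zonal_trace p : ucb (Sp `*` Sp) (fun v : E * E => K v.1 v.2 * p.[dot v.1 v.2]).
Proof. by apply: ucb_mul => //; exact/ucb_horner/ucb_dot12. Qed.

Lemma zonal_trace_sum n (a : nat -> R) (F : nat -> {poly R}) :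
  zonal_trace (\sum_(k < n) a k *: F k) = \sum_(k < n) a k * zonal_trace (F k).
Proof.
have u k := ucb_zonal_trace (F k).
transitivity (I (fun x => \sum_(k < n) a k * I (fun y => K x y * (F k).[dot x y]))).
  apply: (quad_ext hI); first exact: (ucb_param hI (ucb_zonal_trace _)).
  move=> x Sx; have us k := ucb_section (u k) Sx.
  transitivity (I (fun y => \sum_(k < n) a k * (K x y * (F k).[dot x y]))).
    congr I; apply/funext => y; rewrite horner_sum mulr_sumr.
    by apply: eq_bigr => k _; rewrite hornerZ mulrCA.
  rewrite (quad_sum hI) => [|k _]; last exact: (ucb_scale _ (us k)).
  by apply: eq_bigr => k _; rewrite (quadZ hI)//; exact: us.
rewrite (quad_sum hI) => [|k _]; last exact: (ucb_scale _ (ucb_param hI (u k))).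
by apply: eq_bigr => k _; rewrite (quadZ hI)//; exact: (ucb_param hI (u k)).
Qed.

Definition zonal_sum n (b : nat -> R) : {poly R} := \sum_(k < n) b k *: P k.

(** The square for convolution, not the pointwise one; see [zonal_sum_square]. *)
Definition zonal_square n (b : nat -> R) : {poly R} :=
  \sum_(k < n) (b k ^+ 2 * zonal_norm k) *: P k.

Lemma zonal_sum_square n b x y : Sp x -> Sp y ->
  I (fun z => (zonal_sum n b).[dot x z] * (zonal_sum n b).[dot z y]) =
  (zonal_square n b).[dot x y].
Proof.
move=> Sx Sy.
have u k l : ucb Sp (fun z => (P k).[dot x z] * (P l).[dot z y]).
  by apply: ucb_mul; [exact: ucb_zonal_l|exact: ucb_zonal_r].
transitivity (I (fun z => \sum_(k < n) \sum_(l < n) (b k * b l) * ((P k).[dot x z] * (P l).[dot z y]))).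
  congr I; apply/funext => z; rewrite /zonal_sum !horner_sum mulr_suml.
  apply: eq_bigr => k _; rewrite mulr_sumr; apply: eq_bigr => l _.
  by rewrite !hornerZ mulrACA.
rewrite (quad_sum hI) => [|k _]; last by apply: ucb_sum => l _; exact/ucb_scale/u.
rewrite /zonal_square horner_sum; apply: eq_bigr => k _.
rewrite (quad_sum hI) => [|l _]; last exact/ucb_scale/u.
rewrite (bigD1 k)//= big1 => [|l lk].
  rewrite (quadZ hI) ?u// (zonal_convolution hm hI elam lam0 invI)//.
  rewrite (zonal_gram_const lam hm invI k k Sy north_sphere) [RHS]hornerZ addr0.
  by rewrite -expr2 [_ * zonal_gram _ _ _ _ _]mulrC mulrA.
rewrite (quadZ hI) ?u// (zonal_convolution hm hI elam lam0 invI)//.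
by rewrite (zonal_orthogonal hm hI elam lam0 invI Sy) ?mulr0// eq_sym.
Qed.

Lemma zonal_trace_square n b :
  zonal_trace (zonal_square n b) = \sum_(k < n) b k ^+ 2 * degree_trace k.
Proof.
rewrite /zonal_square (zonal_trace_sum n (fun k => b k ^+ 2 * zonal_norm k)).
by apply: eq_bigr => k _; rewrite -mulrA.
Qed.

(* Integrating [K(x, y) r(x, z) r(y, z)] over [x] and [y] first gives a
   nonnegative function of [z]. *)
Lemma form_kernel_ge0 (r : E * E -> R) : ucb (Sp `*` Sp) r ->
  0 <= I (fun x => I (fun y => K x y * I (fun z => r (x, z) * r (y, z)))).
Proof.
move=> ur.
have ua : ucb ((Sp `*` Sp) `*` Sp) (fun v : (E * E) * E => r (v.1.1, v.2)).
  apply: ucb_sphere_valued2 ur; last exact: sphere_valued_snd.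
  exact: sphere_valued_fst (sphere_valued_fst (@sphere_valued_id R m)).
have ub : ucb ((Sp `*` Sp) `*` Sp) (fun v : (E * E) * E => r (v.1.2, v.2)).
  apply: ucb_sphere_valued2 ur; last exact: sphere_valued_snd.
  exact: sphere_valued_fst (@sphere_valued_snd R m _ Sp).
have uk : ucb ((Sp `*` Sp) `*` Sp) (fun v : (E * E) * E => K v.1.1 v.1.2).
  apply: (ucb_sphere_valued2 (a := fun v : (E * E) * E => v.1.1) (b := fun v : (E * E) * E =>
    v.1.2) _ _ uK).
    exact: sphere_valued_fst (sphere_valued_fst (@sphere_valued_id R m)).
  exact: sphere_valued_fst (@sphere_valued_snd R m _ Sp).
have uT := ucb_mul uk (ucb_mul ua ub).
have us x y : Sp x -> Sp y -> ucb Sp (fun z => r (x, z) * r (y, z)).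
  by move=> Sx Sy; apply: ucb_mul; exact: ucb_section ur _.
have -> : I (fun x => I (fun y => K x y * I (fun z => r (x, z) * r (y, z)))) =
   I (fun x => I (fun y => I (fun z => K x y * (r (x, z) * r (y, z))))).
  apply: (quad_ext hI).
    apply: (ucb_param hI (F := fun v : E * E => K v.1 v.2 * I (fun z => r (v.1, z) * r (v.2, z)))).
    by apply: ucb_mul => //; exact: (ucb_param hI (ucb_mul ua ub)).
  move=> x Sx; apply: (quad_ext hI).
    apply: ucb_mul; first exact: ucb_kernel_r.
    exact: (ucb_section (ucb_param hI (ucb_mul ua ub)) Sx).
  by move=> y Sy; rewrite (quadZ hI)//; exact: us.
rewrite -(quad_triple hI uT); apply: (quad_ge0 hI) => //.
  exact: (ucb_param hI (ucb_triple hI uT)).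
move=> z Sz; apply: (kernel_form_ge0 hI w0 uK symK pdK (h := fun x => r (x, z))).
exact: (ucb_section (ucb_swap ur) Sz).
Qed.

(** [zonal_norm k] times P_k is the convolution square of P_k, so [form_kernel_ge0] applies. *)
Lemma degree_trace_ge0 k : 0 <= degree_trace k.
Proof.
have ur : ucb (Sp `*` Sp) (fun v : E * E => (P k).[dot v.1 v.2]) by exact/ucb_horner/ucb_dot12.
have -> : degree_trace k = I (fun x => I (fun y => K x y * I (fun z =>
    (P k).[dot x z] * (P k).[dot y z]))); last exact: (form_kernel_ge0 ur).
have uP := ucb_zonal_trace (P k).
rewrite /degree_trace /zonal_trace -(quadZ hI); last exact: (ucb_param hI uP).
apply: (quad_ext hI); first exact: (ucb_scale _ (ucb_param hI uP)).
move=> x Sx; rewrite -(quadZ hI); last exact: (ucb_section uP Sx).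
apply: (quad_ext hI); first exact: (ucb_scale _ (ucb_section uP Sx)).
move=> y Sy /=; rewrite mulrCA; congr (_ * _).
have := zonal_convolution hm hI elam lam0 invI k k Sx Sy.
rewrite (zonal_gram_const lam hm invI k k Sy north_sphere) -/(zonal_norm k) mulrC => <-.
by congr I; apply/funext => z; rewrite (dotC y).
Qed.

Definition zonal_filter n (b : nat -> R) g x : R := \sum_(k < n) b k * band I lam k g x.

Lemma ucb_zonal_filter n b g : ucb Sp g -> ucb Sp (zonal_filter n b g).
Proof. by move=> ug; apply: ucb_sum => k _; apply: ucb_scale; exact: (ucb_band lam hI k ug). Qed.

Lemma zonal_filterE n b g x : Sp x -> ucb Sp g ->
  zonal_filter n b g x = I (fun z => (zonal_sum n b).[dot x z] * g z).
Proof.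
move=> Sx ug; have u k : ucb Sp (fun z => (P k).[dot z x] * g z).
  by apply: ucb_mul => //; exact: ucb_zonal_r.
transitivity (I (fun z => \sum_(k < n) b k * ((P k).[dot z x] * g z))).
  rewrite (quad_sum hI) => [|k _]; last exact: ucb_scale.
  by apply: eq_bigr => k _; rewrite (quadZ hI).
congr I; apply/funext => z; rewrite /zonal_sum horner_sum mulr_suml.
by apply: eq_bigr => k _; rewrite [X in _ = X * _]hornerZ -mulrA (dotC z).
Qed.

(* The difference of the two sides is the trace of the form of [K] on the
   functions [x |-> r (x, z)], where [r] is the part of the kernel of the filter
   orthogonal to the [g i]. *)
Lemma filtered_trace_le n b N (g : 'I_N -> E -> R) : (forall i, ucb Sp (g i)) ->
  (forall i j, I (fun z => g i z * g j z) = (i == j)%:R) ->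
  \sum_i kernel_form I K (zonal_filter n b (g i)) <=
  \sum_(k < n) b k ^+ 2 * degree_trace k.
Proof.
move=> ug og.
pose A i := zonal_filter n b (g i); have uA i : ucb Sp (A i) by exact: ucb_zonal_filter.
pose S := zonal_sum n b.
pose r (v : E * E) := S.[dot v.1 v.2] - \sum_i A i v.1 * g i v.2.
have ur : ucb (Sp `*` Sp) r.
  apply: ucb_sub; first exact/ucb_horner/ucb_dot12.
  by apply: ucb_sum => i _; apply: ucb_mul; [exact: ucb_fst|exact: ucb_snd].
have := form_kernel_ge0 ur; rewrite -zonal_trace_square.
have key x y : Sp x -> Sp y -> I (fun z => r (x, z) * r (y, z)) =
    (zonal_square n b).[dot x y] - \sum_i A i x * A i y.
  move=> Sx Sy.
  have uS u : Sp u -> ucb Sp (fun z => S.[dot u z]) by move=> Su; exact: ucb_zonal_l.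
  have uG u : ucb Sp (fun z => \sum_i A i u * g i z).
    by apply: ucb_sum => i _; exact: ucb_scale.
  have IG u v : Sp u -> I (fun z => S.[dot u z] * \sum_i A i v * g i z) = \sum_i A i u * A i v.
    move=> Su.
    transitivity (I (fun z => \sum_i A i v * (S.[dot u z] * g i z))).
      congr I; apply/funext => z; rewrite mulr_sumr; apply: eq_bigr => i _.
      by rewrite mulrCA.
    rewrite (quad_sum hI) => [|i _]; last by apply/ucb_scale/ucb_mul => //; exact: uS.
    apply: eq_bigr => i _; rewrite (quadZ hI); last by apply: ucb_mul => //; exact: uS.
    by rewrite -zonal_filterE// mulrC.
  have GG : I (fun z => (\sum_i A i x * g i z) * (\sum_i A i y * g i z)) = \sum_i A i x * A i y.
    transitivity (I (fun z => \sum_i \sum_j (A i x * A j y) * (g i z * g j z))).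
      congr I; apply/funext => z; rewrite mulr_suml; apply: eq_bigr => i _.
      by rewrite mulr_sumr; apply: eq_bigr => j _; rewrite mulrACA.
    have ugg i j : ucb Sp (fun z => g i z * g j z) by exact: ucb_mul.
    rewrite (quad_sum hI) => [|i _]; last by apply: ucb_sum => j _; exact: ucb_scale.
    apply: eq_bigr => i _; rewrite (quad_sum hI) => [|j _]; last exact: ucb_scale.
    rewrite (bigD1 i)//= big1 => [|j ji]; last by rewrite (quadZ hI)// og eq_sym (negbTE ji) mulr0.
    by rewrite (quadZ hI)// og eqxx mulr1 addr0.
  transitivity (I (fun z => (S.[dot x z] * S.[dot z y] - S.[dot x z] * \sum_i A i y * g i z)
     - (S.[dot y z] * \sum_i A i x * g i z
        - (\sum_i A i x * g i z) * (\sum_i A i y * g i z)))).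
    congr I; apply/funext => z; rewrite /r /= (dotC z y).
    by move: (S.[_]) (S.[_]) (\sum_i _) (\sum_i _) => s1 s2 s3 s4; ring.
  have u1 : ucb Sp (fun z => S.[dot x z] * S.[dot z y]).
    by apply: ucb_mul; [exact: uS|exact: ucb_zonal_r].
  have u2 : ucb Sp (fun z => S.[dot x z] * \sum_i A i y * g i z) by apply: ucb_mul => //; exact: uS.
  have u3 : ucb Sp (fun z => S.[dot y z] * \sum_i A i x * g i z) by apply: ucb_mul => //; exact: uS.
  have u4 : ucb Sp (fun z => (\sum_i A i x * g i z) * (\sum_i A i y * g i z)) by exact: ucb_mul.
  rewrite (quadB hI (ucb_sub u1 u2) (ucb_sub u3 u4)) (quadB hI u1 u2) (quadB hI u3 u4).
  rewrite zonal_sum_square// !IG// GG.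
  have -> : \sum_i A i y * A i x = \sum_i A i x * A i y by apply: eq_bigr => i _; rewrite mulrC.
  by rewrite subrr subr0.
pose T := zonal_square n b.
have uT := ucb_zonal_trace T.
have uAA i : ucb (Sp `*` Sp) (fun v : E * E => K v.1 v.2 * (A i v.1 * A i v.2)) by exact: ucb_form2.
suff -> : I (fun x => I (fun y => K x y * I (fun z => r (x, z) * r (y, z)))) =
    zonal_trace T - \sum_i kernel_form I K (A i) by rewrite subr_ge0.
have ukf i : ucb Sp (fun x => I (fun y => K x y * (A i x * A i y))) by exact: (ucb_param hI (uAA i)).
rewrite /zonal_trace /kernel_form -(quad_sum hI)// -(quadB hI); last 2 first.
- exact: (ucb_param hI uT).
- exact: ucb_sum.
apply/esym/(quad_ext hI); first by apply: ucb_sub; [exact: (ucb_param hI uT)|exact: ucb_sum].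
move=> x Sx.
have us i : ucb Sp (fun y => K x y * (A i x * A i y)) by exact: (ucb_section (uAA i) Sx).
have uTs : ucb Sp (fun y => K x y * T.[dot x y]) by exact: (ucb_section uT Sx).
rewrite -(quad_sum hI)// -(quadB hI)//; last exact: ucb_sum.
apply: (quad_ext hI); first by apply: ucb_sub => //; exact: ucb_sum.
by move=> y Sy; rewrite key// mulrBr mulr_sumr.
Qed.

End KernelSpectrum.

Section PolyBounds.
Variable R : realType.

Lemma poly_bounded (p : {poly R}) : exists2 C, 0 <= C & forall s, -1 <= s <= 1 -> `|p.[s]| <= C.
Proof.
exists (\sum_(i < size p) `|p`_i|); first exact: sumr_ge0.
move=> s hs; rewrite horner_coef (le_trans (ler_norm_sum _ _ _))//.
apply: ler_sum => i _; rewrite normrM ler_piMr// normrX exprn_ile1//.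
by rewrite ler_norml.
Qed.

Lemma poly_at1_lower (p : {poly R}) : p.[1] = 1 ->
  exists2 C, 0 <= C & forall s, -1 <= s <= 1 -> 1 - C * (1 - s) <= p.[s].
Proof.
move=> p1; have : root (p - 1%:P) 1 by rewrite /root hornerD hornerN hornerC p1 subrr.
move=> /factor_theorem[q hq]; have [C C0 hC] := poly_bounded q.
exists C => // s hs; have := congr1 (fun r : {poly R} => r.[s]) hq.
rewrite hornerD hornerN hornerC hornerM hornerXsubC => e.
have := hC s hs; rewrite ler_norml => /andP[_ qC].
have s1 : 0 <= 1 - s by move: hs => /andP[_]; rewrite subr_ge0.
have := ler_wpM2r s1 qC; lra.
Qed.

End PolyBounds.

(** * The Hoelder condition in terms of traces *)

Section HoelderSpectrum.
Variables (R : realType) (m : nat).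
Local Notation E := (E R m).
Local Notation Sp := (@sphere R m : set E).
Variables (I : (E -> R) -> R) (w lam : R) (K : E -> E -> R).
Hypotheses (hm : (2 <= m)%N) (hI : quadratic_limit true I w) (w0 : 0 < w)
  (I1 : I (fun=> 1) = w) (elam : 2 * lam + 1 = m%:R) (lam0 : 0 < lam)
  (invI : forall O : 'M[R]_(m.+1), rotation O -> forall f, ucb Sp f ->
     I (fun z => f (act O z)) = I f)
  (uK : ucb (Sp `*` Sp) (fun v : E * E => K v.1 v.2)).
Local Notation P := (geg_poly lam).
Local Notation north := (delta_mx 0 0 : E).

Lemma zonal_square_ge0 n b (s : R) : -1 <= s <= 1 ->
  (forall s, -1 <= s <= 1 -> 0 <= (zonal_sum lam n b).[s]) ->
  0 <= (zonal_square I lam n b).[s].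
Proof.
move=> hs b0; have Sn := @north_sphere R m.
have [x Sx <-] := sphere_dot_surj hm Sn hs.
rewrite -(zonal_sum_square hm hI elam lam0 invI n b Sx Sn).
apply: (quad_ge0 hI) => //.
  by apply: ucb_mul; [exact: ucb_zonal_l|exact: ucb_zonal_r].
by move=> z Sz; rewrite mulr_ge0// b0//; exact: sphere_dot.
Qed.

Lemma zonal_square_int n b x : Sp x ->
  (forall y, Sp y -> I (fun z => (zonal_sum lam n b).[dot z y]) = 1) ->
  I (fun y => (zonal_square I lam n b).[dot x y]) = 1.
Proof.
move=> Sx b1; set S := zonal_sum lam n b in b1 *.
have uF : ucb (Sp `*` Sp) (fun v : E * E => S.[dot x v.2] * S.[dot v.2 v.1]).
  apply: ucb_mul; last exact/ucb_horner/ucb_dot2.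
  by apply: (@ucb_snd _ _ (fun y => S.[dot x y])); exact: ucb_zonal_l.
transitivity (I (fun y => I (fun z => S.[dot x z] * S.[dot z y]))).
  apply: (quad_ext hI) => [|y Sy]; first exact: ucb_zonal_l.
  by rewrite (zonal_sum_square hm hI elam lam0 invI).
rewrite (quad_fubini hI hI uF) /=.
rewrite -[RHS](b1 x Sx); apply: (quad_ext hI).
  exact: (ucb_param hI (ucb_swap uF)).
move=> z Sz; rewrite (quadZ hI); last exact: ucb_zonal_l.
rewrite [I _](_ : _ = 1) ?mulr1 ?(dotC z)// -(b1 z Sz).
by congr I; apply/funext => y; rewrite dotC.
Qed.

Variables (posJ : bool) (J : (E -> R) -> R) (MJ : R) (xi : E) (rot : E -> 'M[R]_(m.+1)).
Variables (B : E -> R) (MB tau : R).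
Hypotheses (hJ : quadratic_limit posJ J MJ) (Sxi : Sp xi) (invJ : fixing_invariant J xi)
  (hrot : forall y, Sp y -> rotation (rot y) /\ act (rot y) y = xi)
  (MB0 : 0 <= MB) (tau0 : 0 <= tau) (B0 : forall x, Sp x -> 0 <= B x)
  (hB : forall f C, ucb Sp f -> 0 <= C -> (forall x, Sp x -> `|f x| <= B x * C) ->
    `|I f| <= MB * C * w)
  (hK : forall x y, Sp x -> Sp y -> `|zonal_conv w J rot (K x) y - K x y| <= B x * tau).
Local Notation mu := (zonal_multiplier w lam J xi).

(** Convolution acts on the degrees of K(x, .) through the multipliers, so the sum is the integral
    over x and y of (K(x, .) * mu - K(x, .))(y) F(x . y), with F the combination of the P_k. The
    inner integral is at most B(x) tau S0. The majorant [H] stays free because single degrees and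
    convolution squares call for different ones. *)
Lemma hoelder_spectrum n (f : nat -> R) (H : {poly R}) S0 : 0 <= S0 ->
  (forall s, -1 <= s <= 1 -> `|(\sum_(k < n) f k *: P k).[s]| <= H.[s]) ->
  (forall x, Sp x -> I (fun y => H.[dot x y]) <= S0) ->
  `|\sum_(k < n) f k * ((mu k - 1) * zonal_trace I K (P k))| <= MB * (tau * S0) * w.
Proof.
move=> S00 FH HS; pose F := \sum_(k < n) f k *: P k.
have uP k := @ucb_zonal_trace R m K uK (P k).
pose u k x := I (fun y => K x y * (P k).[dot x y]).
have uu k : ucb Sp (u k) by exact: (ucb_param hI (uP k)).
have -> : \sum_(k < n) f k * ((mu k - 1) * zonal_trace I K (P k)) =
    I (fun x => \sum_(k < n) f k * ((mu k - 1) * u k x)).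
  rewrite (quad_sum hI) => [|k _]; last exact/ucb_scale/ucb_scale.
  apply: eq_bigr => k _; rewrite (quadZ hI); last exact: ucb_scale.
  by rewrite (quadZ hI).
apply: hB => [||x Sx]; [by apply: ucb_sum => k _; exact/ucb_scale/ucb_scale|exact: mulr_ge0|].
have uKx := ucb_kernel_r uK Sx.
have uT := ucb_zonal_conv hm hI w0 I1 elam lam0 invI hJ Sxi invJ hrot uKx.
set T := zonal_conv w J rot (K x) in uT.
have uPk k : ucb Sp (fun y => (P k).[dot x y]) by exact: ucb_zonal_l.
have -> : \sum_(k < n) f k * ((mu k - 1) * u k x) = I (fun y => (T y - K x y) * F.[dot x y]).
  transitivity (I (fun y => \sum_(k < n) f k * (T y * (P k).[dot x y] - K x y * (P k).[dot x y]))).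
    rewrite (quad_sum hI) => [|k _]; last by apply/ucb_scale/ucb_sub; exact: ucb_mul.
    apply: eq_bigr => k _; rewrite (quadZ hI); last by apply: ucb_sub; exact: ucb_mul.
    congr (_ * _); rewrite (quadB hI); [|exact: ucb_mul|exact: ucb_mul].
    rewrite (zonal_conv_multiplier hm hI w0 I1 elam lam0 invI hJ Sxi invJ hrot k uKx Sx).
    by rewrite mulrBl mul1r.
  congr I; apply/funext => y; rewrite /F horner_sum mulr_sumr.
  apply: eq_bigr => k _; rewrite [X in _ = _ * X]hornerZ.
  by rewrite -mulrBl mulrCA.
have uH : ucb Sp (fun y => H.[dot x y]) by exact: ucb_zonal_l.
apply: (le_trans (quad_norm_le hI (g := fun y => B x * tau * H.[dot x y]) isT _ _ _)).
- by apply: ucb_mul; [exact: ucb_sub|exact: ucb_zonal_l].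
- exact: ucb_scale.
- move=> y Sy; rewrite normrM; apply: ler_pM => //; first exact: hK.
  exact/FH/sphere_dot.
rewrite (quadZ hI)// -mulrA ler_wpM2l ?B0// ler_wpM2l//; exact: HS.
Qed.

End HoelderSpectrum.

(** * Decay of the spectral tail *)

Section SpectralTail.
Variable R : realType.
Implicit Types (t : R).

Lemma sin_le_id t : 0 <= t -> sin t <= t.
Proof.
move=> t0; rewrite -subr_le0 -[leRHS](_ : (fun x => sin x - x) 0 = 0); last first.
  by rewrite sin0 subr0.
apply: (@is_derive_ge _ (fun x => sin x - x) (fun x => cos x - 1)) => //.
Qed.

Lemma one_sub_cos_le t : 0 <= t -> 1 - cos t <= t ^+ 2.
Proof.
move=> t0; have e : 1 - cos t = 2 * sin (t / 2) ^+ 2.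
  have t2 : (t / 2) *+ 2 = t by rewrite -mulr_natr divfK.
  by have := cos_mulr2n (t / 2); rewrite t2 => ->; rewrite sin2cos2; ring.
have s0 : `|sin (t / 2)| <= t / 2.
  have t2 : 0 <= t / 2 by rewrite divr_ge0.
  rewrite ler_norml (sin_le_id t2) andbT.
  rewrite -subr_ge0 opprK.
  have -> : 0 = (fun x : R => sin x + x) 0 by rewrite sin0 addr0.
  rewrite -lerN2.
  apply: (@is_derive_ge _ (fun x => - (sin x + x)) (fun x => - (cos x + 1))) => //.
rewrite e -real_normK ?num_real//.
have := ler_pM (normr_ge0 _) (normr_ge0 _) s0 s0; rewrite -!expr2.
have := sqr_ge0 t; rewrite !expr2; lra.
Qed.

Variables (rho : R) (hrho : 0 < rho <= 2).

Lemma powR_small (e : R) : 0 < e -> exists2 d, 0 < d & forall t, 0 < t <= d -> t `^ rho <= e.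
Proof.
move: hrho => /andP[r0 _] e0; exists (e `^ rho^-1); first exact: powR_gt0.
move=> t /andP[t0 td]; rewrite -[leRHS](_ : (e `^ rho^-1) `^ rho = e); last first.
  by rewrite -powRrM mulVf ?powRr1 ?ltW// gt_eqF.
by apply: ge0_ler_powR => //; rewrite ?nnegrE ?ltW// powR_gt0.
Qed.

Lemma sqr_le_powR t : 0 < t <= 1 -> t ^+ 2 <= t `^ rho.
Proof.
move: hrho => /andP[r0 r2] /andP[t0 t1].
have h : 0 < t <= 1 by rewrite t0.
by rewrite -powR_mulrn ?(ltW t0)//; exact: (ger_powR h r2).
Qed.

Section Tail.
Variables (beta gamma : R) (c : nat -> R) (alpha : nat -> nat) (v : R -> R) (N' : nat).
Hypotheses (hbeta : 2 * beta = N'.+1%:R) (alphaP : forall k, (k <= alpha k)%N)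
  (hv : forall t, 0 < t < pi -> 0 < v t).

Let X t := (sin t) `^ gamma / v t.
Let G t k := geg beta (alpha k) (cos t).
Let mult t k := c k / v t * geg beta (alpha k) (cos t) * (sin t) `^ gamma.

Lemma multE t k : mult t k = c k * X t * G t k.
Proof. by rewrite /mult /X /G; ring. Qed.

Lemma gegE t k : G t k = (geg_poly (N'.+1%:R / 2) (alpha k)).[cos t].
Proof. by rewrite horner_geg_poly -hbeta mulrC mulKf. Qed.

Lemma tail_X_gt0 t : 0 < t < pi -> 0 < X t.
Proof. by move=> ht; rewrite divr_gt0 ?hv// powR_gt0// sin_gt0_pi. Qed.

Lemma small_lt_pi t : 0 < t <= 1 -> 0 < t < pi.
Proof.
by move=> /andP[t0 t1]; rewrite t0 (le_lt_trans t1)// (lt_le_trans _ (pi_ge2 R))// ltr1n.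
Qed.

Lemma tail_G_le1 t k : 0 < t <= 1 -> `|G t k| <= 1.
Proof.
move=> /andP[t0 t1]; rewrite gegE geg_poly_le1// ltW//= ler_pdivlMr//.
by rewrite (le_trans _ (pi_ge2 R))// ler_piMl.
Qed.

Lemma tail_G_lower k : exists2 C, 0 <= C & forall t, 0 < t -> 1 - C * t ^+ 2 <= G t k.
Proof.
have [C C0 hC] := poly_at1_lower (geg_poly_half1 R N' (alpha k)).
exists C => // t t0; rewrite gegE; apply: le_trans (hC _ _); last first.
  by rewrite cos_geN1 cos_le1.
by rewrite lerD2l lerN2 ler_wpM2l// one_sub_cos_le// ltW.
Qed.

Variables (q : nat -> R).
Hypotheses (q0 : forall k, 0 <= q k)
  (hq : forall k, exists2 C, 0 <= C & forall t, 0 < t < pi ->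
     `|(mult t k - 1) * q k| <= C * t `^ rho).

(** Dividing by [q k] leaves mult t k = 1 + O(t^rho). As G t k = 1 + O(t^2) and rho <= 2, the
    remaining factor [c k * X t] tends to 1 at the same rate. *)
Lemma active_normalization k : 0 < q k -> exists2 D, 0 <= D &
  exists2 d, 0 < d <= 1 & forall t, 0 < t <= d -> `|c k * X t - 1| <= D * t `^ rho.
Proof.
move=> qk; have [C C0 hC] := hq k; have [E E0 hE] := tail_G_lower k.
have E1 : 0 < 2 * (E + 1) by rewrite mulr_gt0// ltr_wpDl.
exists (2 * (C / q k + E)); first by rewrite mulr_ge0// addr_ge0// divr_ge0.
exists (Num.min 1 (1 / (2 * (E + 1)))).
  by rewrite lt_min ltr01 divr_gt0//= ge_min lexx.
move=> t /andP[t0]; rewrite le_min => /andP[t1 tE].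
have t01 : 0 < t <= 1 by rewrite t0.
have ht := small_lt_pi t01.
have G1 := hE t t0; have := tail_G_le1 k t01; rewrite ler_norml => /andP[_ G2].
have tt := sqr_le_powR t01.
have ET : E * t ^+ 2 <= 2^-1.
  have h1 : E * t ^+ 2 <= (E + 1) * t.
    apply: ler_pM => //; [by rewrite sqr_ge0|by rewrite lerDl|].
    by rewrite expr2 ler_piMr// ltW.
  apply: (le_trans h1); move: tE; rewrite ler_pdivlMr// => h2.
  by rewrite -(ler_pM2l (ltr0Sn R 1)) mulfV ?pnatr_eq0// mulrA mulrC.
have Gh : 2^-1 <= G t k by lra.
have := hC t ht; rewrite normrM (ger0_norm (q0 k)) -ler_pdivlMr// => hm.
have hm' : `|mult t k - 1| <= C / q k * t `^ rho by rewrite mulrAC.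
rewrite multE in hm'; move: hm' G1 G2 Gh tt ET.
move: (c k * X t) (G t k) (t `^ rho) (t ^+ 2) (C / q k) => x g r s D hD G1 G2 Gh rs Es.
have Es2 : E * s <= E * r by rewrite ler_wpM2l.
have h1 : `|x * g - g| <= D * r + E * r.
  move: hD; rewrite !ler_norml => /andP[hD1 hD2]; apply/andP; split; lra.
have h2 : `|x - 1| * 2^-1 <= `|x - 1| * g by rewrite ler_wpM2l.
have h3 : `|x - 1| * g = `|x * g - g|.
  have g0 : 0 <= g by lra.
  by rewrite -[X in _ * X](ger0_norm g0) -normrM mulrBl mul1r.
lra.
Qed.

(** [X] does not depend on the degree, and both [c k * X t] and [c l * X t] tend to 1 as t tends to
    0. *)
Lemma active_constant k l : 0 < q k -> 0 < q l -> c k = c l.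
Proof.
move=> qk ql; have [D1 D10 [d1 /andP[d10 _] h1]] := active_normalization qk.
have [D2 D20 [d2 /andP[d20 d21] h2]] := active_normalization ql.
have [d3 d30 h3] := powR_small (divr_gt0 (ltr01 : 0 < (1 : R)) (ltr_wpDl (mulr_ge0 (ler0n _ 2) D20)
  (ltr01 : 0 < (1 : R)))).
apply: (@eq_of_dist_le _ _ _ (2 * `|c l| * (D1 + D2))) => e e0.
have [d4 d40 h4] := powR_small e0.
pose t := Num.min (Num.min d1 d2) (Num.min d3 d4).
have t0 : 0 < t by rewrite !lt_min d10 d20 d30 d40.
have {}h1 : `|c k * X t - 1| <= D1 * t `^ rho by apply: h1; rewrite t0 !ge_min lexx.
have {}h2 : `|c l * X t - 1| <= D2 * t `^ rho by apply: h2; rewrite t0 !ge_min lexx orbT.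
have {}h3 : t `^ rho <= 1 / (2 * D2 + 1) by apply: h3; rewrite t0 !ge_min lexx !orbT.
have {}h4 : t `^ rho <= e by apply: h4; rewrite t0 !ge_min lexx !orbT.
have X0 : 0 < X t.
  apply/tail_X_gt0/small_lt_pi; rewrite t0 (le_trans _ d21)//.
  by rewrite !ge_min lexx orbT.
have D2r : D2 * t `^ rho <= 2^-1.
  move: h3; rewrite ler_pdivlMr; last by rewrite ltr_wpDl// mulr_ge0.
  have := powR_ge0 t rho; lra.
have cl : 2^-1 <= `|c l| * X t.
  rewrite -(ger0_norm (ltW X0)) -normrM.
  have cn := ler_norm (c l * X t); apply: le_trans cn.
  by move: h2; rewrite ler_norml => /andP[h2' _]; lra.
have dX : `|c k - c l| * X t <= (D1 + D2) * e.
  rewrite -[X t in leLHS](ger0_norm (ltW X0)) -normrM.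
  have := ler_normB (c k * X t - 1) (c l * X t - 1).
  have D1e := ler_wpM2l D10 h4; have D2e := ler_wpM2l D20 h4.
  rewrite (_ : _ - 1 - _ = (c k - c l) * X t); last by ring.
  lra.
have cX : `|c k - c l| * (X t)^-1 ^+ 0 <= 2 * `|c l| * (`|c k - c l| * X t).
  rewrite expr0 mulr1; have := ler_wpM2l (normr_ge0 (c k - c l)) cl; lra.
rewrite expr0 mulr1 in cX; apply: (le_trans cX).
by rewrite -[leRHS]mulrA ler_wpM2l// mulr_ge0.
Qed.

(** At an angle t = L / N the multipliers are at most 1/2 beyond N and at most 1 + D t^rho
    everywhere, so the weights 1 - mult + D t^rho are nonnegative and at least 1/2 on the tail. The
    set [A] of admissible coefficients makes [C'] and [N0] uniform in the degree of the approximate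
    identity. *)
Lemma spectral_tail (C : R) (A : set (nat * (nat -> R))) : 0 <= C ->
  (forall n a, A (n, a) -> forall t, 0 < t < pi ->
     `|\sum_(k < n) a k ^+ 2 * ((mult t k - 1) * q k)| <= C * t `^ rho) ->
  (forall n a, A (n, a) -> \sum_(k < n) a k ^+ 2 * q k <= C) ->
  exists (C' : R) N0, 0 <= C' /\ forall N, (N0 <= N)%N -> forall n a, A (n, a) ->
    \sum_(k < n | (N < k)%N) a k ^+ 2 * q k <= C' * N%:R `^ (- rho).
Proof.
move=> C0 hA1 hA2.
have [[k0 qk0]|noq] := pselect (exists k, 0 < q k); last first.
  have qz k : q k = 0.
    apply/eqP; rewrite eq_le q0 andbT leNgt; apply/negP => qk.
    by apply: noq; exists k.
  exists 0, 0%N; split=> // N _ n a _.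
  by rewrite mul0r big1// => k _; rewrite qz mulr0.
have [D D0 [d /andP[d0 d1] hD]] := active_normalization qk0.
have [l [t0 [t00 t01 hl]]] := geg_poly_small R N'.
have [d2 d20 hd2] := powR_small (divr_gt0 (ltr01 : 0 < (1 : R)) (ltr_wpDl D0 (ltr01 : 0 < (1 : R)))).
(* The successor keeps the angle L / N positive even if [l] is zero. *)
pose L : R := l.+1%:R; have L0 : 0 < L by rewrite ltr0n.
pose tm := Num.min d (Num.min t0 d2); have tm0 : 0 < tm by rewrite !lt_min d0 t00 d20.
exists (2 * (C + D * C) * L `^ rho), (Num.truncn (L / tm)).+1; split.
  by rewrite !mulr_ge0 ?addr_ge0 ?powR_ge0// mulr_ge0.
move=> N hN n a Aa.
have N0 : 0 < N%:R :> R by rewrite ltr0n (leq_trans _ hN).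
pose t := L / N%:R; have tp : 0 < t by rewrite divr_gt0.
have ttm : t <= tm.
  rewrite ler_pdivrMr// mulrC -ler_pdivrMr//.
  apply: (le_trans (ltW (truncnS_gt _))); by rewrite ler_nat.
have td : 0 < t <= d by rewrite tp (le_trans ttm)// ge_min lexx.
have tt0 : 0 < t <= t0 by rewrite tp (le_trans ttm)// !ge_min lexx orbT.
have td2 : 0 < t <= d2 by rewrite tp (le_trans ttm)// !ge_min lexx !orbT.
have t1 : 0 < t <= 1 by rewrite tp; move/andP: td => [_ h]; rewrite (le_trans h).
have tpi := small_lt_pi t1.
have X0 := tail_X_gt0 tpi.
have {}hD := hD t td; have {}hd2 := hd2 t td2.
have Dr : D * t `^ rho <= 1.
  move: hd2; rewrite ler_pdivlMr; last by rewrite ltr_wpDl.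
  have := powR_ge0 t rho; lra.
have th : c k0 * X t <= 1 + D * t `^ rho by move: hD; rewrite ler_norml => /andP[]; lra.
have th0 : 0 <= c k0 * X t by move: hD; rewrite ler_norml => /andP[]; lra.
have up k : 0 < q k -> mult t k <= 1 + D * t `^ rho.
  move=> qk; rewrite multE (active_constant qk qk0); apply: le_trans th.
  by rewrite ler_piMr// (le_trans (ler_norm _))// tail_G_le1.
have far k : 0 < q k -> (N < k)%N -> mult t k <= 2^-1.
  move=> qk Nk; rewrite multE (active_constant qk qk0).
  have Gk : `|G t k| <= 4^-1.
    rewrite gegE; apply: hl => //.
    apply: (le_trans (_ : _ <= N%:R * t)).
      by rewrite /t mulrC divfK ?gt_eqF// ler_nat.
    by rewrite ler_pM2r// ler_nat (leq_trans (ltnW Nk)).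
  have g1 : G t k <= 4^-1 by rewrite (le_trans (ler_norm _)).
  apply: (le_trans (_ : _ <= c k0 * X t * 4^-1)); first by rewrite ler_wpM2l.
  lra.
have a0 k : 0 <= a k ^+ 2 by exact: sqr_ge0.
pose r := t `^ rho; have r0 : 0 <= r by exact: powR_ge0.
(* Degrees with [q k = 0] contribute nothing, so bounds on the multiplier are needed only where
   [c k = c k0]. *)
have term k : a k ^+ 2 * q k * (if (N < k)%N then 2^-1 else 0) <=
    - (a k ^+ 2 * ((mult t k - 1) * q k)) + D * r * (a k ^+ 2 * q k).
  have Dr0 : 0 <= D * r by exact: mulr_ge0.
  have [qk|qk] := ltP 0 (q k); last first.
    have -> : q k = 0 by apply/eqP; rewrite eq_le qk q0.
    by rewrite !mulr0 mul0r oppr0 addr0.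
  have aq : 0 <= a k ^+ 2 * q k by rewrite mulr_ge0// ltW.
  rewrite (_ : - _ + _ = a k ^+ 2 * q k * (1 - mult t k + D * r)); last by ring.
  apply: ler_wpM2l => //; case: ifPn => Nk.
    have := far k qk Nk; lra.
  have := up k qk; rewrite -/r; lra.
have sum1 : \sum_(k < n | (N < k)%N) a k ^+ 2 * q k =
    2 * \sum_(k < n) a k ^+ 2 * q k * (if (N < k)%N then 2^-1 else 0).
  rewrite mulr_sumr big_mkcond; apply: eq_bigr => k _.
  by case: ifP => _; rewrite ?mulr0// [RHS]mulrC divfK ?pnatr_eq0.
rewrite sum1.
have sum2 : \sum_(k < n) a k ^+ 2 * q k * (if (N < k)%N then 2^-1 else 0) <= C * r + D * r * C.
  apply: le_trans (_ : _ <= \sum_(k < n) (- (a k ^+ 2 * ((mult t k - 1) * q k)) + D * r * (a k ^+ 2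
    * q k))) _.
    by apply: ler_sum => k _; exact: term.
  rewrite big_split /= sumrN -mulr_sumr; apply: lerD.
    by have := hA1 n a Aa t tpi; rewrite ler_norml => /andP[]; rewrite -/r; lra.
  by rewrite ler_wpM2l ?mulr_ge0//; exact: hA2.
have rE : r = L `^ rho * N%:R `^ (- rho).
  rewrite /r /t powRM ?invr_ge0 ?(ltW L0) ?(ltW N0)//; congr (_ * _).
  by rewrite powRN -[in LHS]powR_inv1 ?ltW// -powRrM mulN1r powRN.
rewrite -mulrA -rE.
have -> : 2 * (C + D * C) * r = 2 * (C * r + D * r * C) by ring.
by rewrite ler_pM2l.
Qed.

End Tail.
End SpectralTail.

(** * Approximation by greedy projection *)

Section SphereMonomials.
Variables (R : realType) (m : nat).
Local Notation E := (E R m).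
Local Notation Sp := (@sphere R m : set E).
Variables (I : (E -> R) -> R) (w : R).
Hypothesis hI : quadratic_limit true I w.
Implicit Types (s : seq 'I_m.+1) (x z : E) (g : E -> R).

(** Words instead of exponent vectors: multiplication by a coordinate is a [cons], which suits the
    expansion of powers of [dot z x]. *)
Definition word_monomial s z : R := \prod_(i <- s) z 0 i.

Lemma ucb_word_monomial s : ucb Sp (word_monomial s).
Proof.
elim: s => [|i s ih].
  by apply: (ucb_eq _ (ucb_cst Sp 1)) => x _; rewrite /word_monomial big_nil.
by apply: (ucb_eq _ (ucb_mul (ucb_coord R i) ih)) => x _; rewrite /word_monomial big_cons.
Qed.

Lemma word_monomial_count s z :
  word_monomial s z = \prod_(i < m.+1) z 0 i ^+ count_mem i s.
Proof.
elim: s => [|j s ih]; first by rewrite /word_monomial big_nil big1.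
rewrite /word_monomial big_cons -/(word_monomial s z) ih /=.
under [RHS]eq_bigr do rewrite exprD.
rewrite big_split /=; congr (_ * _).
rewrite (bigD1 j)//= eqxx expr1 big1 ?mulr1// => i ij.
by rewrite eq_sym (negbTE ij).
Qed.

(* On the sphere the square of the last coordinate is a polynomial in the other
   ones, so exponents 0 and 1 of the last coordinate are enough. *)
Definition reduced_monomial N (p : {ffun 'I_m -> 'I_N.+1} * bool) z : R :=
  (\prod_(i < m) z 0 (widen_ord (leqnSn m) i) ^+ p.1 i) * z 0 ord_max ^+ p.2.

Lemma ucb_reduced_monomial N p : ucb Sp (@reduced_monomial N p).
Proof.
apply: ucb_mul; last exact/ucb_exp/ucb_coord.
rewrite /index_enum; elim: (Finite.enum _) => [|i r ih].
  by apply: (ucb_eq _ (ucb_cst Sp 1)) => x _; rewrite big_nil.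
by apply: (ucb_eq _ (ucb_mul (ucb_exp (p.1 i) (ucb_coord R _)) ih)) => x _; rewrite big_cons.
Qed.

Lemma card_reduced_monomial N :
  #|{: {ffun 'I_m -> 'I_N.+1} * bool}| = (N.+1 ^ m * 2)%N.
Proof. by rewrite card_prod card_ffun !card_ord card_bool. Qed.

Variables (N : nat) (g : E -> R).
Hypotheses (ug : ucb Sp g)
  (orth : forall p, I (fun z => g z * @reduced_monomial N p z) = 0).

Lemma reduced_word s : (size s <= N)%N -> (count_mem ord_max s <= 1)%N ->
  exists p, word_monomial s = @reduced_monomial N p.
Proof.
move=> sN s1.
have cN i : (count_mem i s < N.+1)%N by rewrite ltnS (leq_trans _ sN)// count_size.
exists ([ffun i => Ordinal (cN (widen_ord (leqnSn m) i))], (0 < count_mem ord_max s)%N).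
apply/funext => z; rewrite word_monomial_count big_ord_recr /reduced_monomial /=.
congr (_ * _); first by apply: eq_bigr => i _; rewrite ffunE.
by congr (_ ^+ _); case: (count_mem _ s) s1 => [|[]].
Qed.

(** Induction on the number of occurrences of the last coordinate: two of them are exchanged for 1
    minus the other squares, which lowers this number by two and does not raise the degree. *)
Lemma orth_word s : (size s <= N)%N -> I (fun z => g z * word_monomial s z) = 0.
Proof.
move: {2}(count_mem _ s) (leqnn (count_mem ord_max s)) => c.
elim/ltn_ind: c s => c ih s sc sN.
have [s1|s2] := leqP (count_mem ord_max s) 1.
  by have [p ->] := reduced_word sN s1; exact: orth.
have m1 : ord_max \in s by rewrite -has_pred1 has_count (leq_trans _ s2).
pose s' := rem ord_max s.
have ps : perm_eq s (ord_max :: s') := perm_to_rem m1.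
have cs : count_mem ord_max s = (count_mem ord_max s').+1 by rewrite (permP ps) /= eqxx.
have m2 : ord_max \in s' by rewrite -has_pred1 has_count -ltnS -cs.
pose u := rem ord_max s'.
have ps' : perm_eq s' (ord_max :: u) := perm_to_rem m2.
have cs' : count_mem ord_max s' = (count_mem ord_max u).+1 by rewrite (permP ps') /= eqxx.
have su : size s = (size u).+2 by rewrite (perm_size ps) /= (perm_size ps').
have cu : (count_mem ord_max u).+2 = count_mem ord_max s by rewrite cs cs'.
have ew z : word_monomial s z = z 0 ord_max * (z 0 ord_max * word_monomial u z).
  rewrite /word_monomial (perm_big _ ps) big_cons; congr (_ * _).
  by rewrite (perm_big _ ps') big_cons.
have cw i v z : word_monomial (i :: v) z = z 0 i * word_monomial v z.
  by rewrite /word_monomial big_cons.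
have ugw v : ucb Sp (fun z => g z * word_monomial v z).
  by apply: ucb_mul => //; exact: ucb_word_monomial.
pose wi (i : 'I_m) := widen_ord (leqnSn m) i.
have eF z : Sp z -> g z * word_monomial s z =
    g z * word_monomial u z - \sum_(i < m) g z * word_monomial [:: wi i, wi i & u] z.
  move=> Sz; have : dot z z = 1 by exact: Sz.
  rewrite /dot big_ord_recr /= => Sz'.
  have e2 : z 0 ord_max * z 0 ord_max = 1 - \sum_(i < m) z 0 (wi i) * z 0 (wi i).
    by rewrite -Sz' [X in X - _]addrC addrK.
  rewrite ew [z 0 ord_max * (_ * _)]mulrA e2 mulrBl mul1r mulrBr; congr (_ - _).
  rewrite mulr_suml mulr_sumr; apply: eq_bigr => i _.
  by rewrite !cw [z 0 (wi i) * (_ * _)]mulrA.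
rewrite (quad_ext hI (ugw s) eF) (quadB hI) //; last by apply: ucb_sum => i _; exact: ugw.
rewrite (quad_sum hI); last by move=> i _; exact: ugw.
have lt0 v : (count_mem ord_max v <= count_mem ord_max u)%N -> (size v <= N)%N ->
    I (fun z => g z * word_monomial v z) = 0.
  move=> vu vN; apply: (ih (count_mem ord_max u)) => //.
  by rewrite (leq_trans _ sc)// -cu.
rewrite (lt0 u) ?leqnn//; last by rewrite (leq_trans _ sN)// su ltnW.
rewrite big1 ?subr0// => i _; apply: lt0; last by rewrite /= -su.
have /negbTE wn : wi i != ord_max by rewrite -val_eqE /= neq_ltn ltn_ord.
by rewrite /= wn.
Qed.

(** The word [s] collects the coordinates that are released when the factors of the power are
    expanded one at a time. *)
Lemma orth_dot_exp x s k : (size s + k <= N)%N ->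
  I (fun z => g z * word_monomial s z * dot z x ^+ k) = 0.
Proof.
elim: k s => [|k ih] s sk.
  rewrite -[RHS](@orth_word s) ?(leq_trans _ sk) ?leq_addr//.
  by congr I; apply/funext => z; rewrite expr0 mulr1.
have ud : ucb Sp (fun z => dot z x).
  by apply: ucb_sum => i _; apply: ucb_mul; [exact: ucb_coord|exact: ucb_cst].
have uF v : ucb Sp (fun z => g z * word_monomial v z * dot z x ^+ k).
  apply: ucb_mul; last exact: ucb_exp.
  by apply: ucb_mul => //; exact: ucb_word_monomial.
transitivity (I (fun z => \sum_(i < m.+1)
    x 0 i * (g z * word_monomial (i :: s) z * dot z x ^+ k))).
  congr I; apply/funext => z.
  rewrite exprS {1}/dot mulr_suml mulr_sumr; apply: eq_bigr => i _.
  rewrite /word_monomial big_cons -/(word_monomial s z).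
  by move: (dot z x ^+ k) (word_monomial s z) (g z) (x 0 i) (z 0 i) => *; ring.
rewrite (quad_sum hI); last by move=> i _; exact/ucb_scale/uF.
rewrite big1// => i _; rewrite (quadZ hI) ?ih ?mulr0 ?addSnnS//.
Qed.

Lemma orth_zonal (p : {poly R}) x : (size p <= N.+1)%N ->
  I (fun z => p.[dot z x] * g z) = 0.
Proof.
move=> pN.
have ud : ucb Sp (fun z => dot z x).
  by apply: ucb_sum => i _; apply: ucb_mul; [exact: ucb_coord|exact: ucb_cst].
transitivity (I (fun z => \sum_(i < size p) p`_i * (g z * word_monomial [::] z * dot z x ^+ i))).
  congr I; apply/funext => z; rewrite horner_coef mulr_suml; apply: eq_bigr => i _.
  by rewrite /word_monomial big_nil mulr1 -mulrA [g z * _]mulrC.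
have uF i : ucb Sp (fun z => g z * word_monomial [::] z * dot z x ^+ i).
  apply: ucb_mul; last exact: ucb_exp.
  by apply: ucb_mul => //; exact: ucb_word_monomial.
rewrite (quad_sum hI); last by move=> i _; exact/ucb_scale/uF.
rewrite big1// => i _; rewrite (quadZ hI) ?orth_dot_exp ?mulr0//=.
by rewrite add0n -ltnS (leq_trans _ pN).
Qed.

End SphereMonomials.

(** * Gram-Schmidt and greedy selection *)

Section GreedyProjection.
Variables (R : realType) (m : nat).
Local Notation E := (E R m).
Local Notation Sp := (@sphere R m : set E).
Variables (I : (E -> R) -> R) (w : R).
Hypothesis hI : quadratic_limit true I w.
Implicit Types (f g h : E -> R) (u v : nat -> E -> R) (n k : nat).

Definition inner f g : R := I (fun z => f z * g z).

Definition orthonormal n u : Prop :=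
  (forall i, (i < n)%N -> ucb Sp (u i)) /\
  (forall i j, (i < n)%N -> (j < n)%N -> inner (u i) (u j) = (i == j)%:R).

Definition residual n u f z : R := f z - \sum_(i < n) inner f (u i) * u i z.

Definition extend n u h i : E -> R :=
  if (i < n)%N then u i else fun z => (Num.sqrt (inner h h))^-1 * h z.

Lemma innerC f g : inner f g = inner g f.
Proof. by congr I; apply/funext => z; rewrite mulrC. Qed.

Lemma inner_ge0 f : ucb Sp f -> 0 <= inner f f.
Proof.
by move=> uf; apply: (quad_ge0 hI) => // [|x _]; [exact: ucb_mul|exact: sqr_ge0].
Qed.

Lemma innerZl a f g : ucb Sp f -> ucb Sp g -> inner (fun z => a * f z) g = a * inner f g.
Proof.
move=> uf ug; rewrite -(quadZ hI); last exact: ucb_mul.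
by congr I; apply/funext => z; rewrite mulrA.
Qed.

Lemma innerZr a f g : ucb Sp f -> ucb Sp g -> inner f (fun z => a * g z) = a * inner f g.
Proof. by move=> uf ug; rewrite innerC innerZl// innerC. Qed.

Lemma inner_norm0 f g : ucb Sp f -> ucb Sp g -> inner g g = 0 -> inner f g = 0.
Proof.
move=> uf ug g0; apply/eqP/negPn/negP => fg0.
have key t : 0 <= inner f f + 2 * t * inner f g.
  have := inner_ge0 (ucb_add uf (ucb_scale t ug)).
  suff -> : inner (fun x => f x + t * g x) (fun x => f x + t * g x) =
    inner f f + 2 * t * inner f g + t ^+ 2 * inner g g by rewrite g0 mulr0 addr0.
  have uff := ucb_mul uf uf; have ufg := ucb_mul uf ug; have ugg := ucb_mul ug ug.
  rewrite -(quadZ hI (2 * t) ufg) -(quadZ hI (t ^+ 2) ugg).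
  rewrite -(quadD hI uff (ucb_scale _ ufg)) -(quadD hI (ucb_add uff (ucb_scale _ ufg)) (ucb_scale _
    ugg)).
  by congr I; apply/funext => z; ring.
have := key (- (inner f f + 1) / (2 * inner f g)).
rewrite (_ : 2 * _ * _ = - (inner f f + 1)); first by lra.
by field.
Qed.

Section Family.
Variables (n : nat) (u : nat -> E -> R).
Hypothesis hu : orthonormal n u.

Lemma ucb_projection (c : nat -> R) : ucb Sp (fun z => \sum_(i < n) c i * u i z).
Proof. by apply: ucb_sum => i _; apply/ucb_scale; apply: hu.1. Qed.

Lemma ucb_residual f : ucb Sp f -> ucb Sp (residual n u f).
Proof. move=> uf; apply: ucb_sub => //; exact: (ucb_projection (fun i => inner f (u i))). Qed.

Lemma inner_projection f (c : nat -> R) : ucb Sp f ->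
  inner f (fun z => \sum_(i < n) c i * u i z) = \sum_(i < n) c i * inner f (u i).
Proof.
move=> uf.
transitivity (I (fun z => \sum_(i < n) c i * (f z * u i z))).
  congr I; apply/funext => z; rewrite mulr_sumr.
  by apply: eq_bigr => i _; rewrite mulrCA.
have ufu (i : 'I_n) : ucb Sp (fun z => f z * u i z) by apply: ucb_mul => //; exact: hu.1.
rewrite (quad_sum hI); last by move=> i _; exact: ucb_scale.
by apply: eq_bigr => i _; rewrite (quadZ hI).
Qed.

Lemma inner_residual f g : ucb Sp f -> ucb Sp g ->
  inner g (residual n u f) = inner g f - \sum_(i < n) inner f (u i) * inner g (u i).
Proof.
move=> uf ug; have uP := ucb_projection (fun i => inner f (u i)).
rewrite -(inner_projection (fun i => inner f (u i)))// -(quadB hI); try exact: ucb_mul.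
by congr I; apply/funext => z; rewrite /residual mulrBr.
Qed.

Lemma residual_orth f j : ucb Sp f -> (j < n)%N -> inner (u j) (residual n u f) = 0.
Proof.
move=> uf jn; rewrite inner_residual//; last exact: hu.1.
rewrite (bigD1 (Ordinal jn))//= hu.2// eqxx mulr1 big1 ?addr0.
  by rewrite innerC subrr.
move=> i ij; rewrite hu.2// (_ : (j == i) = false) ?mulr0//.
by rewrite eq_sym; exact: negbTE ij.
Qed.

Lemma inner_residual_self f : ucb Sp f ->
  inner f (residual n u f) = inner (residual n u f) (residual n u f).
Proof.
move=> uf; have ur := ucb_residual uf; have uP := ucb_projection (fun i => inner f (u i)).
have e : inner (residual n u f) (fun z => \sum_(i < n) inner f (u i) * u i z) = 0.
  rewrite (inner_projection (fun i => inner f (u i)) ur) big1// => i _.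
  by rewrite [X in _ * X]innerC residual_orth ?mulr0.
rewrite -[RHS]addr0 -[X in _ = _ + X]e innerC -(quadD hI (ucb_mul ur ur) (ucb_mul ur uP)).
by congr I; apply/funext => z; rewrite -mulrDr /residual subrK.
Qed.

Lemma orthonormal_extend h : ucb Sp h -> (forall j, (j < n)%N -> inner (u j) h = 0) ->
  0 < inner h h -> orthonormal n.+1 (extend n u h).
Proof.
move=> uh oh h0; have uh' a := ucb_scale a uh.
split=> [i|i j]; rewrite !ltnS /extend.
  by case: ltnP => // lin _; exact: hu.1.
case: (ltnP i n) => [lin _|nin i1]; case: (ltnP j n) => [ljn _|njn j1].
- exact: hu.2.
- rewrite innerZr// ?oh ?mulr0//; last exact: hu.1.
  by rewrite (_ : i == j = false)//; apply/eqP => ij; rewrite -ij leqNgt lin in njn.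
- rewrite innerZl// 1?innerC ?oh ?mulr0//; last exact: hu.1.
  by rewrite (_ : i == j = false)//; apply/eqP => ij; rewrite ij leqNgt ljn in nin.
have -> : i = j by apply/eqP; rewrite eqn_leq (leq_trans i1)// (leq_trans j1).
have s0 : Num.sqrt (inner h h) != 0 by rewrite gt_eqF ?sqrtr_gt0.
rewrite eqxx innerZl// innerZr// -[X in _ * (_ * X)](sqr_sqrtr (ltW h0)).
by move: (Num.sqrt _) s0 => s s0; rewrite expr2 mulKf ?mulVf.
Qed.

End Family.

(** Vectors with a null residual are dropped, hence [n' <= n]. The span is described by
    orthogonality to it, which is the form needed to kill the low bands. *)
Lemma gram_schmidt n v : (forall i, (i < n)%N -> ucb Sp (v i)) ->
  exists n' u, [/\ (n' <= n)%N, orthonormal n' u & forall f, ucb Sp f ->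
    (forall i, (i < n')%N -> inner f (u i) = 0) ->
    forall i, (i < n)%N -> inner f (v i) = 0].
Proof.
elim: n => [|n ih] hv; first by exists 0%N, v; split=> //; split.
have [|n' [u [n'n hu hf]]] := ih; first by move=> i lin; apply: hv; exact: ltnW.
have uv : ucb Sp (v n) by exact: hv.
have ur := ucb_residual hu uv.
have step f : ucb Sp f -> (forall i, (i < n')%N -> inner f (u i) = 0) ->
    inner f (residual n' u (v n)) = 0 -> inner f (v n) = 0.
  move=> uf fu; rewrite inner_residual// big1 ?subr0// => i _.
  by rewrite fu ?mulr0.
have [r0|rn0] := eqVneq (inner (residual n' u (v n)) (residual n' u (v n))) 0.
  exists n', u; split=> // [|f uf fu i]; first exact: leqW.
  rewrite ltnS leq_eqVlt => /orP[/eqP->|]; last exact: hf.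
  by apply: step => //; exact: inner_norm0.
have rp : 0 < inner (residual n' u (v n)) (residual n' u (v n)).
  by rewrite lt_neqAle eq_sym rn0 inner_ge0.
exists n'.+1, (extend n' u (residual n' u (v n))); split=> // [|f uf fu i].
  by apply: orthonormal_extend => // j jn; exact: residual_orth.
have fu' j : (j < n')%N -> inner f (u j) = 0.
  by move=> jn; have := fu j (ltnW jn); rewrite /extend jn.
rewrite ltnS leq_eqVlt => /orP[/eqP->|]; last exact: hf.
apply: step => //; have := fu n' (leqnn _); rewrite /extend ltnn innerZr//.
move/eqP; rewrite mulf_eq0 invr_eq0 sqrtr_eq0 => /orP[|/eqP//].
by rewrite leNgt rp.
Qed.

(* While some [f] in [S] is at distance more than [e] from the span, normalizing its
   residual gives a new vector with [Q > e^2]; the bound on the sum of the [Q]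
   values of the new vectors stops this after at most [n] steps. *)
Lemma greedy_projection (Q : (E -> R) -> R) (S : set (E -> R)) n0 u0 (T e : R) n :
  orthonormal n0 u0 ->
  (forall f, S f -> ucb Sp f) ->
  (forall f h, S f -> ucb Sp h -> inner f h ^+ 2 <= Q h) ->
  (forall a h, ucb Sp h -> Q (fun z => a * h z) = a ^+ 2 * Q h) ->
  (forall k u, (forall i, (i < n0)%N -> u i = u0 i) -> orthonormal (n0 + k) u ->
     \sum_(i < k) Q (u (n0 + i)%N) <= T) ->
  0 < e -> T < n%:R * e ^+ 2 ->
  exists k u, [/\ (k <= n)%N, orthonormal (n0 + k) u & forall f, S f ->
    inner (residual (n0 + k) u f) (residual (n0 + k) u f) <= e ^+ 2].
Proof.
move=> hu0 uS hQ QZ hT e0 Tn; apply: contrapT => no.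
suff : exists u, [/\ forall i, (i < n0)%N -> u i = u0 i, orthonormal (n0 + n) u &
    n%:R * e ^+ 2 <= \sum_(i < n) Q (u (n0 + i)%N)].
  move=> [u [eu hu le]]; have := hT n u eu hu; lra.
elim: {-2}n (leqnn n) => [_|k ih kn].
  by exists u0; rewrite addn0 big_ord0 mul0r.
have [|u [eu hu le]] := ih; first exact: ltnW.
have [f [Sf fe]] : exists f, S f /\
    e ^+ 2 < inner (residual (n0 + k) u f) (residual (n0 + k) u f).
  apply: contrapT => nf; apply: no; exists k, u; split=> //; first exact: ltnW.
  by move=> f Sf; rewrite leNgt; apply/negP => h; apply: nf; exists f.
have uf := uS f Sf; have ur := ucb_residual hu uf.
have rp : 0 < inner (residual (n0 + k) u f) (residual (n0 + k) u f).
  by apply: lt_trans fe; rewrite exprn_gt0.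
exists (extend (n0 + k) u (residual (n0 + k) u f)); split.
- by move=> i lin; rewrite /extend ltn_addr// eu.
- by rewrite addnS; apply: orthonormal_extend => // j jn; exact: residual_orth.
rewrite big_ord_recr /= mulrSr mulrDl mul1r; apply: lerD.
  rewrite (le_trans le)// le_eqVlt; apply/orP; left; apply/eqP.
  by apply: eq_bigr => i _; rewrite /extend ltn_add2l ltn_ord.
rewrite /extend ltnn QZ//.
(* For the residual r one has <f, r> = <r, r>, so the hypothesis on [Q] reads <r, r>^2 <= Q r, and
   after normalization the value of [Q] is at least <r, r> > e^2. *)
have := hQ f _ Sf ur; rewrite inner_residual_self// => hr.
rewrite exprVn (sqr_sqrtr (ltW rp)) mulrC ler_pdivlMr//.
apply: le_trans hr; rewrite expr2 ler_pM2r//; exact: ltW.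
Qed.

End GreedyProjection.

Lemma ler_addgt0_scale (R : realType) (x y D : R) : 0 <= D ->
  (forall e, 0 < e <= 1 -> x <= y + D * e) -> x <= y.
Proof.
move=> D0 h; apply/ler_addgt0Pr => e e0.
have D1 : 0 < D + 1 by rewrite ltr_wpDl.
pose t := Num.min 1 (e / (D + 1)).
have t0 : 0 < t <= 1 by rewrite lt_min ltr01 divr_gt0//= ge_min lexx.
apply: (le_trans (h t t0)); rewrite lerD2l.
apply: (le_trans (_ : _ <= (D + 1) * t)).
  by case/andP: t0 => t0 _; rewrite ler_wpM2r ?(ltW t0)// lerDl.
by rewrite mulrC -ler_pdivlMr// ge_min lexx orbT.
Qed.

(** * The reproducing kernel Hilbert space *)

Section ReproducingKernel.
Variables (R : realType) (m : nat).
Local Notation E := (E R m).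
Local Notation Sp := (@sphere R m : set E).
Variables (I : (E -> R) -> R) (w lam : R) (K : E -> E -> R).
Hypotheses (hm : (2 <= m)%N) (hI : quadratic_limit true I w) (w0 : 0 < w)
  (I1 : I (fun=> 1) = w) (elam : 2 * lam + 1 = m%:R) (lam0 : 0 < lam)
  (invI : forall O : 'M[R]_(m.+1), rotation O -> forall f, ucb Sp f ->
     I (fun z => f (act O z)) = I f)
  (uK : ucb (Sp `*` Sp) (fun v : E * E => K v.1 v.2))
  (symK : forall x y, Sp x -> Sp y -> K x y = K y x)
  (pdK : forall s : seq (R * E), (forall p, p \in s -> Sp p.2) -> 0 <= pre_norm2 K s).
Variables (CK : R) (hCK : forall x y, Sp x -> Sp y -> `|K x y| <= CK).
Implicit Types (s : seq (R * E)) (f g h : E -> R) (x y : E).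

Lemma kernel_bound_ge0 : 0 <= CK.
Proof. by have [x Sx] := sphere_nonempty R m; apply: le_trans (hCK Sx Sx). Qed.

(** The reproducing inequality f(y)^2 <= |f|^2 K(y, y), obtained by adding a point mass of variable
    weight at [y] to the combination [s]. *)
Lemma pre_eval_le s y : (forall p, p \in s -> Sp p.2) -> Sp y ->
  pre_eval K s y ^+ 2 <= pre_norm2 K s * CK.
Proof.
move=> hs Sy; have h1 (t : R) p : p \in [:: (t, y)] -> Sp p.2.
  by rewrite inE => /eqP->.
have n1 t : pre_norm2 K [:: (t, y)] = t ^+ 2 * K y y.
  by rewrite /pre_norm2 !big_seq1 expr2.
have Kyy : 0 <= K y y by have := pdK (h1 1); rewrite n1 expr1n mul1r.
apply: (le_trans (_ : _ <= pre_norm2 K s * K y y)); last first.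
  by rewrite ler_wpM2l ?pdK// (le_trans (ler_norm _))// hCK.
apply: quadratic_discriminant => // [|t]; first exact: pdK.
have ht p : p \in s ++ [:: (t, y)] -> Sp p.2 by rewrite mem_cat => /orP[/hs|/h1].
have := pdK ht; rewrite (pre_norm2_cat symK hs (h1 t)) n1.
suff -> : \sum_(p <- s) p.1 * (\sum_(q <- [:: (t, y)]) q.1 * K p.2 q.2) =
  t * pre_eval K s y by [].
rewrite /pre_eval mulr_sumr; apply: eq_bigr => p _.
by rewrite big_seq1 mulrCA.
Qed.

Lemma ucb_pre_eval s : (forall p, p \in s -> Sp p.2) -> ucb Sp (pre_eval K s).
Proof.
move=> hs; apply: (ucb_eq (f := fun y => \sum_(p <- s | p \in s) p.1 * K p.2 y)).
  by move=> y _; rewrite /pre_eval [RHS]big_seq.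
by apply: ucb_sum => p /hs Sp2; apply/ucb_scale/ucb_kernel_r.
Qed.

Lemma inner_pre_eval s h : (forall p, p \in s -> Sp p.2) -> ucb Sp h ->
  inner I (pre_eval K s) h = kernel_pair I K s h.
Proof.
move=> hs uh.
have u p : p \in s -> ucb Sp (fun y => K p.2 y * h y).
  by move=> /hs Sp2; apply: ucb_mul => //; exact: ucb_kernel_r.
transitivity (I (fun y => \sum_(p <- s | p \in s) p.1 * (K p.2 y * h y))).
  congr I; apply/funext => y; rewrite -big_seq /pre_eval mulr_suml.
  by apply: eq_bigr => p _; rewrite mulrA.
rewrite (quad_sum hI) => [|p /u up]; last exact: ucb_scale.
rewrite /kernel_pair [RHS]big_seq; apply: eq_bigr => p /u up.
by rewrite (quadZ hI).
Qed.

Lemma pre_eval_sub s s' y : pre_eval K (pre_sub s s') y = pre_eval K s y - pre_eval K s' y.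
Proof.
rewrite /pre_eval big_cat big_map /= -sumrN; congr (_ + _).
by apply: eq_bigr => p _; rewrite mulNr.
Qed.

(** By [pre_eval_le] a Cauchy sequence for the kernel norm is uniformly Cauchy, so the pointwise
    limits in [rkhs_norm_is] are uniform. *)
Lemma rkhs_approx f r : rkhs_norm_is K f r -> forall e, 0 < e ->
  exists s, [/\ forall p, p \in s -> Sp p.2,
    forall y, Sp y -> `|f y - pre_eval K s y| <= e &
    `|r - Num.sqrt (pre_norm2 K s)| <= e].
Proof.
move=> [g [hg [cauchy [cvgf cvgr]]]] e e0.
have K0 := kernel_bound_ge0.
have K1 : 0 < CK + 1 by rewrite ltr_wpDl.
have d0 : 0 < e ^+ 2 / (CK + 1) by rewrite divr_gt0// exprn_gt0.
have [N hN] := cauchy _ d0.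
have [N' _ hN'] := (cvgrPdist_lt _ _).1 cvgr e e0.
exists (g (maxn N N')); split; first exact: hg.
- move=> y Sy; apply/ler_addgt0Pr => d d1.
  have [N'' _ hN''] := (cvgrPdist_lt _ _).1 (cvgf y Sy) d d1.
  have h1 := hN'' (maxn N N'') (leq_maxr _ _).
  have h2 := hN (maxn N N'') (maxn N N') (leq_maxl _ _) (leq_maxl _ _).
  have hs p : p \in pre_sub (g (maxn N N'')) (g (maxn N N')) -> Sp p.2.
    by rewrite mem_cat => /orP[/hg//|/mapP[q /hg Sq ->]].
  have := pre_eval_le hs Sy; rewrite pre_eval_sub => h3.
  have h4 : `|pre_eval K (g (maxn N N'')) y - pre_eval K (g (maxn N N')) y| <= e.
    rewrite -(ler_pXn2r (ltn0Sn 1)) ?nnegrE ?(ltW e0)// real_normK ?num_real//.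
    apply: (le_trans h3); apply: (le_trans (_ : _ <= e ^+ 2 / (CK + 1) * CK)).
      by rewrite ler_wpM2r// ltW.
    by rewrite mulrAC ler_pdivrMr// ler_wpM2l ?sqr_ge0// lerDl.
  rewrite /= in h1; have := ler_normD (f y - pre_eval K (g (maxn N N'')) y)
    (pre_eval K (g (maxn N N'')) y - pre_eval K (g (maxn N N')) y).
  rewrite addrA subrK; lra.
- by apply: ltW; apply: hN'; exact: leq_maxr.
Qed.

Lemma rkhs_ucb f r : rkhs_norm_is K f r -> ucb Sp f.
Proof.
move=> fr; apply: ucb_unif_lim => e e0; have [s [hs hf _]] := rkhs_approx fr e0.
by exists (pre_eval K s) => //; exact: ucb_pre_eval.
Qed.

Lemma rkhs_pairing f h : rkhs_norm_is K f 1 -> ucb Sp h ->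
  inner I f h ^+ 2 <= kernel_form I K h.
Proof.
move=> f1 uh; have uf := rkhs_ucb f1.
have Q0 := kernel_form_ge0 hI w0 uK symK pdK uh.
have [C C0 hC] := ucb_bound uh.
rewrite -[leLHS]real_normK ?num_real// -[leRHS]sqr_sqrtr//.
rewrite ler_pXn2r ?nnegrE ?sqrtr_ge0//.
have D0 : 0 <= Num.sqrt (kernel_form I K h) + w * C.
  by rewrite addr_ge0 ?sqrtr_ge0// mulr_ge0// ltW.
apply: (ler_addgt0_scale D0) => e /andP[e0 e1].
have [s [hs hf hr]] := rkhs_approx f1 e0.
have us := ucb_pre_eval hs.
have h1 : `|inner I f h - inner I (pre_eval K s) h| <= w * (e * C).
  apply: (quad_dist hI); [by rewrite mulr_ge0// ltW|exact: ucb_mul|exact: ucb_mul|].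
  by move=> y Sy; rewrite -mulrBl normrM; apply: ler_pM => //; [exact: hf|exact: hC].
have h2 : `|inner I (pre_eval K s) h| <= (1 + e) * Num.sqrt (kernel_form I K h).
  rewrite inner_pre_eval// -sqrtr_sqr.
  apply: (le_trans (ler_wsqrtr (kernel_pair_le hI w0 uK symK pdK hs uh))).
  rewrite sqrtrM ?pdK// ler_wpM2r ?sqrtr_ge0//.
  by move: hr; rewrite ler_norml => /andP[]; lra.
have := ler_normD (inner I f h - inner I (pre_eval K s) h) (inner I (pre_eval K s) h).
rewrite subrK; lra.
Qed.

(** As the bands of [f] up to [N] vanish, deleting the corresponding coefficients of the approximate
    identity does not change the filtered function, which is uniformly close to [f]. *)
Lemma kernel_form_filter_cvg N f e : ucb Sp f -> 0 < e ->
  (forall k, (k <= N)%N -> forall x, Sp x -> band I lam k f x = 0) ->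
  exists M0, forall M, (M0 <= M)%N -> forall a,
    approx_kernel I M = zonal_sum lam M.+1 a ->
    kernel_form I K f <=
      kernel_form I K (zonal_filter I lam M.+1 (fun k => if (N < k)%N then a k else 0) f) + e.
Proof.
move=> uf e0 f0; have [C C0 hC] := ucb_bound uf.
have K0 := kernel_bound_ge0.
pose D := w * (w * (CK * (2 * C + 1))).
have D0 : 0 <= D by rewrite !mulr_ge0// ?(ltW w0)// addr_ge0// mulr_ge0// ltW.
have D1 : 0 < D + 1 by rewrite ltr_wpDl.
pose t := Num.min 1 (e / (D + 1)).
have t0 : 0 < t by rewrite lt_min ltr01 divr_gt0.
have Dt : D * t <= e.
  apply: (le_trans (_ : _ <= (D + 1) * t)); first by rewrite ler_wpM2r ?(ltW t0)// lerDl.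
  by rewrite mulrC -ler_pdivlMr// ge_min lexx orbT.
have [_ /(_ (t / 2) (divr_gt0 t0 (ltr0Sn _ _)))[d d0 hd]] := uf.
have [M0 hM0] := approx_kernel_cvg hm hI w0 I1 invI (ltW C0) d0 (divr_gt0 t0 (ltr0Sn R 1)).
exists M0 => M M0M a ea; have := hM0 M M0M f uf hC hd => hcvg.
set b := fun k => _; set g := zonal_filter I lam M.+1 b f.
have ug : ucb Sp g by exact: (ucb_zonal_filter lam hI _ _ uf).
have gf x : Sp x -> `|g x - f x| <= t.
  move=> Sx; have -> : g x = I (fun z => (approx_kernel I M).[dot z x] * f z).
    transitivity (zonal_filter I lam M.+1 a f x).
      apply: eq_bigr => k _; rewrite /b; case: ltnP => // kN.
      by rewrite f0// !mulr0.
    rewrite (zonal_filterE lam hI)// -ea.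
    by congr I; apply/funext => z; rewrite dotC.
  by apply: le_trans (hcvg x Sx) _; rewrite mulrC divfK.
have t1 : 0 <= t <= 1 by rewrite (ltW t0)/= ge_min lexx.
have := kernel_form_dist hI w0 uK (ltW C0) t1 ug uf hC gf hCK.
have -> : w * (w * (CK * ((2 * C + 1) * t))) = D * t by rewrite /D; ring.
rewrite ler_norml => /andP[+ _]; lra.
Qed.

(** Filtering costs at most e for each of the k forms, and the filtered forms are bounded by the
    tail of the trace; then e tends to 0. *)
Lemma band_limited_trace N T k (g : 'I_k -> E -> R) : (forall i, ucb Sp (g i)) ->
  (forall i j, I (fun z => g i z * g j z) = (i == j)%:R) ->
  (forall i l, (l <= N)%N -> forall x, Sp x -> band I lam l (g i) x = 0) ->
  (forall M a, approx_kernel I M = zonal_sum lam M.+1 a ->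
     \sum_(l < M.+1 | (N < l)%N) a l ^+ 2 * degree_trace I lam K l <= T) ->
  \sum_i kernel_form I K (g i) <= T.
Proof.
move=> ug og g0 hT; apply: (ler_addgt0_scale (ler0n _ k)) => e /andP[e0 _].
have [M0 hM0] := choice (fun i => kernel_form_filter_cvg (ug i) e0 (g0 i)).
pose M := (\max_i M0 i)%N.
have [a ea] := geg_poly_expansion lam0 (size_approx_kernel I M).
pose b := fun l => if (N < l)%N then a l else 0.
apply: (le_trans (_ : _ <= \sum_i (kernel_form I K (zonal_filter I lam M.+1 b (g i)) + e))).
  by apply: ler_sum => i _; apply: hM0 => //; exact: leq_bigmax.
rewrite big_split /= sumr_const card_ord -[e *+ k]mulr_natl lerD2r.
apply: (le_trans (filtered_trace_le hm hI w0 elam lam0 invI uK symK pdK M.+1 b ug og)).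
apply: le_trans (hT M a ea); rewrite [leRHS]big_mkcond; apply: ler_sum => l _.
by rewrite /b; case: ifP => // _; rewrite expr0n mul0r.
Qed.

End ReproducingKernel.

Section ApproximationRate.
Variables (R : realType) (m : nat).
Local Notation E := (E R m).
Local Notation Sp := (@sphere R m : set E).
Variables (I : (E -> R) -> R) (w lam : R) (K : E -> E -> R).
Hypotheses (hm : (2 <= m)%N) (hI : quadratic_limit true I w) (w0 : 0 < w)
  (I1 : I (fun=> 1) = w) (elam : 2 * lam + 1 = m%:R) (lam0 : 0 < lam)
  (invI : forall O : 'M[R]_(m.+1), rotation O -> forall f, ucb Sp f ->
     I (fun z => f (act O z)) = I f)
  (uK : ucb (Sp `*` Sp) (fun v : E * E => K v.1 v.2))
  (symK : forall x y, Sp x -> Sp y -> K x y = K y x)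
  (pdK : forall s : seq (R * E), (forall p, p \in s -> Sp p.2) -> 0 <= pre_norm2 K s).
Variables (CK : R) (hCK : forall x y, Sp x -> Sp y -> `|K x y| <= CK).

Lemma monomial_gram_schmidt N : exists n u, [/\ (n <= 2 * N.+1 ^ m)%N, orthonormal I n u &
  forall f, ucb Sp f -> (forall i, (i < n)%N -> inner I f (u i) = 0) ->
    forall l, (l <= N)%N -> forall x, Sp x -> band I lam l f x = 0].
Proof.
pose T : finType := ({ffun 'I_m -> 'I_N.+1} * bool)%type.
pose p0 : T := ([ffun=> ord0], false).
pose v i : E -> R := reduced_monomial (nth p0 (enum T) i).
have [i _|n [u [nT hu hf]]] := @gram_schmidt R m I w hI #|T| v.
  exact: ucb_reduced_monomial.
exists n, u; split=> //; first by rewrite mulnC -card_reduced_monomial.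
move=> f uf fu l lN x Sx; apply: (orth_zonal hI (N := N) uf); last by rewrite size_geg_poly.
move=> p; have pT : (enum_rank p < #|T|)%N := ltn_ord _.
have := hf f uf fu (enum_rank p) pT.
by rewrite /v nth_enum_rank.
Qed.

(** At most 2 (N+1)^m vectors span the polynomials of degree up to N on the sphere, and at most
    (N+1)^m greedy steps follow; hence the factor 3. *)
Lemma rkhs_approximation N (T e : R) :
  (forall M a, approx_kernel I M = zonal_sum lam M.+1 a ->
     \sum_(l < M.+1 | (N < l)%N) a l ^+ 2 * degree_trace I lam K l <= T) ->
  0 < e -> T < (N.+1 ^ m)%:R * e ^+ 2 ->
  exists k u, [/\ (k <= 3 * N.+1 ^ m)%N, orthonormal I k u & forall f, rkhs_norm_is K f 1 ->
    inner I (residual I k u f) (residual I k u f) <= e ^+ 2].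
Proof.
move=> hT e0 Te; have [n0 [u0 [n0N hu0 band0]]] := monomial_gram_schmidt N.
have [|||k [u [kN hu hr]]] := @greedy_projection R m I w hI (kernel_form I K)
    [set f | rkhs_norm_is K f 1] n0 u0 T e (N.+1 ^ m) hu0
    (fun f f1 => rkhs_ucb uK symK pdK hCK f1) _ _ _ e0 Te.
- by move=> f h f1 uh; exact: (rkhs_pairing hI w0 uK symK pdK hCK).
- by move=> a h uh; exact: (kernel_formZ hI uK).
- move=> k u eu hu.
  have lt0 (i : 'I_k) : (n0 + i < n0 + k)%N by rewrite ltn_add2l.
  apply: (band_limited_trace hm hI w0 I1 elam lam0 invI uK symK pdK hCK (N := N)
    (g := fun i : 'I_k => u (n0 + i)%N)) => //.
  + by move=> i; exact: hu.1.
  + by move=> i j; rewrite -[LHS]/(inner I _ _) hu.2// eqn_add2l.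
  move=> i l lN x Sx; apply: band0 => // [|j jn]; first exact: hu.1.
  rewrite -eu// hu.2// ?ltn_addr// gtn_eqF//; exact: (leq_trans jn (leq_addr _ _)).
exists (n0 + k)%N, u; split=> //.
by rewrite (leq_trans (leq_add n0N kN))//; move: (N.+1 ^ m)%N => j; lia.
Qed.

End ApproximationRate.

(** Since m >= 1 and N >= 1, one has n + 1 <= 3 (N+2)^m <= (3 (N+2))^m <= (9 N)^m, which is the
    origin of the 9. The exponent is that of the squared width. *)
Lemma width_rate (R : realType) m (rho : R) N n : (0 < m)%N -> 0 <= rho -> (1 <= N)%N ->
  (n < 3 * N.+2 ^ m)%N ->
  N%:R `^ (- rho) / N.+1%:R ^+ m <=
  9 `^ (m%:R + rho) * n.+1%:R `^ (- (1 + rho / m%:R)) :> R.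
Proof.
move=> m0 r0 N1 nN; have N0 : 0 < N%:R :> R by rewrite ltr0n.
have m0' : 0 < m%:R :> R by rewrite ltr0n.
have b1 : n.+1%:R <= (9 * N%:R) ^+ m :> R.
  rewrite -natrM -natrX ler_nat (leq_trans nN)//.
  have h1 : (3 * N.+2 ^ m <= 3 ^ m * N.+2 ^ m)%N.
    by rewrite leq_mul2r -{1}(expn1 3) leq_exp2l// m0 orbT.
  rewrite (leq_trans h1)// -expnMn leq_exp2r//; lia.
have a0 : 0 < (9 * N%:R : R) by rewrite mulr_gt0.
have b2 : n.+1%:R `^ (1 + rho / m%:R) <= 9 `^ (m%:R + rho) * N%:R `^ (m%:R + rho) :> R.
  rewrite -powRM ?(ltW N0)//.
  have -> : m%:R + rho = m%:R * (1 + rho / m%:R) by field; rewrite gt_eqF.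
  rewrite powRrM powR_mulrn ?(ltW a0)//.
  have r1 : 0 <= 1 + rho / m%:R by rewrite addr_ge0// divr_ge0// ltW.
  by rewrite ge0_ler_powR ?nnegrE ?exprn_ge0 ?(ltW a0).
have b3 : N%:R `^ (- rho) / N.+1%:R ^+ m <= (N%:R `^ (m%:R + rho))^-1 :> R.
  have -> : N%:R `^ (m%:R + rho) = N%:R ^+ m * N%:R `^ rho :> R.
    by rewrite powRD ?powR_mulrn ?(ltW N0)// (gt_eqF N0) implybT.
  rewrite powRN invfM mulrC ler_wpM2r ?invr_ge0 ?powR_ge0//.
  by rewrite lef_pV2 ?posrE ?exprn_gt0// lerXn2r ?nnegrE// ler_nat.
apply: (le_trans b3); rewrite powRN ler_pdivlMr ?powR_gt0// mulrC ler_pdivrMr ?powR_gt0//.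
Qed.

(** * Kolmogorov widths *)

Section KernelTail.
Variables (R : realType) (m : nat).
Local Notation E := (E R m).
Local Notation Sp := (@sphere R m : set E).
Variables (I : (E -> R) -> R) (w lam : R) (K : E -> E -> R).
Hypotheses (hm : (2 <= m)%N) (hI : quadratic_limit true I w) (w0 : 0 < w)
  (I1 : I (fun=> 1) = w) (elam : 2 * lam + 1 = m%:R) (lam0 : 0 < lam)
  (invI : forall O : 'M[R]_(m.+1), rotation O -> forall f, ucb Sp f ->
     I (fun z => f (act O z)) = I f)
  (uK : ucb (Sp `*` Sp) (fun v : E * E => K v.1 v.2))
  (symK : forall x y, Sp x -> Sp y -> K x y = K y x)
  (pdK : forall s : seq (R * E), (forall p, p \in s -> Sp p.2) -> 0 <= pre_norm2 K s).
Variables (CK : R) (hCK : forall x y, Sp x -> Sp y -> `|K x y| <= CK).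
Variables (J : R -> (E -> R) -> R) (MJ : R -> R) (xi : E) (rot : E -> 'M[R]_(m.+1)).
Variables (B : E -> R) (MB rho : R).
Hypotheses (hJ : forall t, 0 < t < pi -> quadratic_limit false (J t) (MJ t)) (Sxi : Sp xi)
  (invJ : forall t, 0 < t < pi -> fixing_invariant (J t) xi)
  (hrot : forall y, Sp y -> rotation (rot y) /\ act (rot y) y = xi)
  (MB0 : 0 <= MB) (B0 : forall x, Sp x -> 0 <= B x)
  (hB : forall f C, ucb Sp f -> 0 <= C -> (forall x, Sp x -> `|f x| <= B x * C) ->
    `|I f| <= MB * C * w)
  (hrho : 0 < rho <= 2)
  (hK : forall t, 0 < t < pi -> forall x y, Sp x -> Sp y ->
    `|zonal_conv w (J t) rot (K x) y - K x y| <= B x * t `^ rho).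
Variables (beta gamma : R) (c : nat -> R) (alpha : nat -> nat) (v : R -> R) (N' : nat).
Hypotheses (hbeta : 2 * beta = N'.+1%:R) (alphaP : forall k, (k <= alpha k)%N)
  (hv : forall t, 0 < t < pi -> 0 < v t)
  (hmult : forall t, 0 < t < pi -> forall k, zonal_multiplier w lam (J t) xi k =
     c k / v t * geg beta (alpha k) (cos t) * (sin t) `^ gamma).
Local Notation P := (geg_poly lam).
Local Notation q := (degree_trace I lam K).

Lemma multiplier_spectrum t n (f : nat -> R) (H : {poly R}) S0 : 0 < t < pi -> 0 <= S0 ->
  (forall s, -1 <= s <= 1 -> `|(\sum_(k < n) f k *: P k).[s]| <= H.[s]) ->
  (forall x, Sp x -> I (fun y => H.[dot x y]) <= S0) ->
  `|\sum_(k < n) f k * ((c k / v t * geg beta (alpha k) (cos t) * (sin t) `^ gamma - 1) *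
     zonal_trace I K (P k))| <= MB * S0 * w * t `^ rho.
Proof.
move=> ht S00 fH HS.
have := hoelder_spectrum hm hI w0 I1 elam lam0 invI uK (hJ ht) Sxi (invJ ht) hrot
  (powR_ge0 t rho) B0 hB (hK ht) S00 fH HS.
have -> : MB * (t `^ rho * S0) * w = MB * S0 * w * t `^ rho by ring.
by under eq_bigr do rewrite hmult//.
Qed.

(** The Hoelder estimate is used twice: on a single degree with a constant majorant, where the
    constant may depend on the degree and serves only to normalize; and on the convolution square of
    the approximate identity, which is its own majorant of integral 1, where the constant is uniform
    in [M]. *)
Lemma kernel_tail : exists (C' : R) N0, 0 <= C' /\ forall N, (N0 <= N)%N ->
  forall M a, approx_kernel I M = zonal_sum lam M.+1 a ->
  \sum_(k < M.+1 | (N < k)%N) a k ^+ 2 * q k <= C' * N%:R `^ (- rho).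
Proof.
have CK0 : 0 <= CK by exact: kernel_bound_ge0 hCK.
pose A : set (nat * (nat -> R)) := [set p | exists M, p.1 = M.+1 /\
  approx_kernel I M = zonal_sum lam M.+1 p.2].
have q0 k : 0 <= q k by exact: (degree_trace_ge0 hm hI w0 elam lam0 invI uK symK pdK).
have hq k : exists2 C, 0 <= C & forall t, 0 < t < pi ->
   `|(c k / v t * geg beta (alpha k) (cos t) * (sin t) `^ gamma - 1) * q k| <= C * t `^ rho.
  have [C C0 hC] := poly_bounded (P k).
  exists (`|zonal_norm I lam k| * (MB * (w * C) * w)).
    by rewrite !mulr_ge0// ltW.
  move=> t ht; pose f j : R := (j == k)%:R.
  have fk : \sum_(j < k.+1) f j *: P j = P k.
    rewrite big_ord_recr /= /f eqxx scale1r big1 ?add0r// => j _.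
    by rewrite ltn_eqF// scale0r.
  have := @multiplier_spectrum t k.+1 f C%:P (w * C) ht _ _ _.
  have fs (X : nat -> R) : \sum_(j < k.+1) f j * X j = X k.
    rewrite big_ord_recr /= /f eqxx mul1r big1 ?add0r// => j _.
    by rewrite ltn_eqF// mul0r.
  rewrite (fs (fun j => (c j / v t * geg beta (alpha j) (cos t) * (sin t) `^ gamma - 1) *
     zonal_trace I K (P j))) => h.
  rewrite /degree_trace [X in `|X|]mulrCA normrM -[leRHS]mulrA ler_wpM2l//; apply: h.
  - by rewrite mulr_ge0// ltW.
  - by move=> s hs; rewrite fk hornerC; exact: hC.
  move=> x Sx; rewrite (le_trans (ler_norm _))//.
  apply: (quad_bound hI) => // [|y Sy]; first exact: ucb_zonal_l.
  by rewrite hornerC ger0_norm.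
have sq0 M a s : approx_kernel I M = zonal_sum lam M.+1 a -> -1 <= s <= 1 ->
    0 <= (zonal_square I lam M.+1 a).[s].
  move=> ea hs; apply: (zonal_square_ge0 hm hI elam lam0 invI hs) => r hr.
  by rewrite -ea; exact: (approx_kernel_ge0 hm hI w0 I1 invI).
have sq1 M a x : approx_kernel I M = zonal_sum lam M.+1 a -> Sp x ->
    I (fun y => (zonal_square I lam M.+1 a).[dot x y]) = 1.
  move=> ea Sx; apply: (zonal_square_int hm hI elam lam0 invI Sx) => y Sy.
  by rewrite -ea; exact: (approx_kernel_int hm hI w0 I1 invI).
(* One constant for two bounds: [MB * w] from the Hoelder estimate, and [w * CK] for the whole
   trace, where [K] is integrated against a nonnegative zonal function of integral 1. *)
have C0 : 0 <= MB * w + w * CK by rewrite addr_ge0// mulr_ge0// ltW.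
have [] := @spectral_tail R rho hrho beta gamma c alpha v N' hbeta alphaP hv q q0 hq _ A C0.
- move=> n a [M [/= -> ea]] t ht.
  have := @multiplier_spectrum t M.+1 (fun k => a k ^+ 2 * zonal_norm I lam k)
    (zonal_square I lam M.+1 a) 1 ht ler01 _ _.
  rewrite mulr1 => h.
  apply: (le_trans (_ : _ <= MB * w * t `^ rho)); last first.
    by rewrite ler_wpM2r ?powR_ge0// lerDl mulr_ge0// ltW.
  have qE x y k : x * (y * q k) = x * zonal_norm I lam k * (y * zonal_trace I K (P k)).
    by rewrite /degree_trace; move: (zonal_norm _ _ _) (zonal_trace _ _ _) => *; ring.
  under eq_bigr do rewrite qE.
  apply: h => [s hs|x Sx]; first by rewrite ger0_norm// (sq0 _ _ _ ea hs).
  by rewrite (sq1 _ _ _ ea Sx).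
- move=> n a [M [/= -> ea]].
  rewrite -(zonal_trace_square lam hI uK M.+1 a).
  apply: (le_trans (_ : _ <= w * CK)); last by rewrite lerDr mulr_ge0// ltW.
  have uT := ucb_zonal_trace uK (zonal_square I lam M.+1 a).
  rewrite (le_trans (ler_norm _))//; apply: (quad_bound hI) => //.
    exact: (ucb_param hI uT).
  move=> x Sx; have us := ucb_zonal_l (zonal_square I lam M.+1 a) Sx.
  rewrite -[leRHS]mulr1 -(sq1 _ _ _ ea Sx) -(quadZ hI)//.
  apply: (quad_norm_le hI) => //; [exact: (ucb_section uT Sx)|exact: ucb_scale|].
  move=> y Sy; have := sq0 _ _ _ ea (sphere_dot Sx Sy) => s0.
  by rewrite normrM (ger0_norm s0) ler_wpM2r// hCK.
move=> C' [N0 [C'0 hN]]; exists C', N0; split=> // N N0N M a ea.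
by apply: (hN N N0N M.+1 a); exists M.
Qed.

End KernelTail.

Section KolmogorovWidth.
Variables (R : realType) (m : nat).
Local Notation E := (E R m).
Local Notation Sp := (@sphere R m : set E).
Variables (sigma : {measure set (SM R m) -> \bar R}) (fin : (sigma setT < +oo)%E).

Lemma L2norm_ucb (h : E -> R) : ucb Sp h ->
  L2norm sigma h = (Num.sqrt (inner (sphere_int sigma) h h))%:E.
Proof.
move=> uh; rewrite /L2norm /inner /sphere_int /RintS.
have uhh : ucb Sp (fun x => h x ^+ 2) by exact: ucb_exp.
have := integrable_fin_num (@sphere_measurable R m) (ucb_integrable fin uhh).
rewrite /comp; under [X in fine X]eq_integral do rewrite -expr2.
by case: (integral _ _ _).
Qed.

Lemma L2_ucb (h : E -> R) : ucb Sp h -> L2 sigma h.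
Proof. by move=> uh; split; [exact: ucb_measurable|rewrite L2norm_ucb// ltry]. Qed.

Lemma kolmogorov_width_le (S : set (E -> R)) k n u (e : R) : 0 <= e -> (k <= n)%N ->
  orthonormal (sphere_int sigma) k u -> (forall f, S f -> ucb Sp f) ->
  (forall f, S f -> inner (sphere_int sigma) (residual (sphere_int sigma) k u f)
     (residual (sphere_int sigma) k u f) <= e ^+ 2) ->
  (kolmogorov_width sigma S n <= e%:E)%E.
Proof.
(* Zero functions pad the orthonormal family to exactly [n] members. *)
move=> e0 kn hu uS hS; pose vs (i : 'I_n) : SM R m -> R := if (i < k)%N then u i else fun=> 0.
apply: ge_ereal_inf; exists (ereal_sup [set ereal_inf
    [set L2norm sigma (fun x => f x - span_fun vs a x) | a in [set: 'I_n -> R]] | f in S]).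
  exists vs => // i; apply: L2_ucb; rewrite /vs; case: ifP => [ik|_].
    by apply: hu.1.
  exact: ucb_cst.
apply: ge_ereal_sup => _ [f Sf <-]; apply: ge_ereal_inf.
exists (L2norm sigma (residual (sphere_int sigma) k u f)).
  exists (fun i : 'I_n => inner (sphere_int sigma) f (u i)) => //.
  congr L2norm; apply/funext => x; rewrite /residual /span_fun; congr (_ - _).
  rewrite (big_ord_widen n (fun i => inner (sphere_int sigma) f (u i) * u i x) kn) [RHS]big_mkcond /=.
  by apply: eq_bigr => i _; rewrite /vs; case: ifP; rewrite ?mulr0.
rewrite L2norm_ucb; last exact: (ucb_residual hu (uS f Sf)).
by rewrite lee_fin -(ger0_norm e0) -sqrtr_sqr ler_wsqrtr// hS.
Qed.

End KolmogorovWidth.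

Lemma leq_strict_mono (f : nat -> nat) : (forall i j, (i < j)%N -> (f i < f j)%N) ->
  forall k, (k <= f k)%N.
Proof. by move=> hf; elim=> // k ih; exact: leq_ltn_trans ih (hf _ _ (ltnSn k)). Qed.

Section SphereMeasure.
Variables (R : realType) (m : nat) (sigma : {measure set (SM R m) -> \bar R}).
Hypotheses (fin : (sigma setT < +oo)%E) (supp : sigma (~` @sphere R m) = 0%E).

Lemma sphere_full : sigma (@sphere R m) = sigma setT.
Proof.
have mS := @sphere_measurable R m.
by rewrite -(setUv (@sphere R m)) measureU0//; exact: measurableC.
Qed.

Lemma sphere_int1 : sphere_int sigma (fun=> 1) = fine (sigma setT).
Proof.
rewrite /sphere_int /RintS integral_cst; last exact: sphere_measurable.
by rewrite mul1e sphere_full.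
Qed.

Lemma sphere_int_rotation (Q : 'M[R]_(m.+1)) f : rotation Q ->
  (forall A : set (SM R m), measurable A -> sigma (act Q @^-1` A) = sigma A) ->
  ucb (@sphere R m : set (E R m)) f ->
  sphere_int sigma (fun z => f (act Q z)) = sphere_int sigma f.
Proof.
move=> hQ inv uf.
have z0 g : sphere_int (mzero : {measure set (SM R m) -> \bar R}) g = 0.
  by rewrite /sphere_int /RintS integral_measure_zero.
(* The invariance of a positive measure is the case of [sphere_int_act] in which the subtracted
   measure is zero. *)
have := @sphere_int_act R m sigma mzero Q f fin _ hQ _ uf.
rewrite !z0 !subr0; apply=> [|A mA]; first by rewrite /mzero ltry.
by rewrite inv.
Qed.

End SphereMeasure.

Lemma pre_norm2_ge0 (R : realType) m (K : E R m -> E R m -> R) (s : seq (R * E R m)) :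
  pos_def_kernel K -> (forall p, p \in s -> @sphere R m p.2) -> 0 <= pre_norm2 K s.
Proof.
move=> pd hs; have := pd (size s) (fun i => (tnth (in_tuple s) i).2)
  (fun i => (tnth (in_tuple s) i).1) (fun i => hs _ (mem_tnth i (in_tuple s))).
congr (0 <= _); rewrite /pre_norm2 [RHS]big_tnth; apply: eq_bigr => i _.
by rewrite [RHS]big_tnth.
Qed.

Lemma powR_sqrt_rate (R : realType) (x r : R) : Num.sqrt (x `^ (- (1 + r))) = x `^ (- (2^-1 + r / 2)).
Proof.
have -> : - (1 + r) = - (2^-1 + r / 2) * 2%:R by field.
by rewrite powRrM powR_mulrn ?powR_ge0// sqrtr_sqr ger0_norm ?powR_ge0.
Qed.

Lemma exists_degree m n N1 : (0 < m)%N -> (3 * N1.+1 ^ m <= n)%N ->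
  exists N, [/\ (N1 <= N)%N, (3 * N.+1 ^ m <= n)%N & (n < 3 * N.+2 ^ m)%N].
Proof.
move=> m0 h1; pose P N := (3 * N.+1 ^ m <= n)%N.
have bnd N : P N -> (N <= n)%N.
  move=> /(leq_trans _); apply; rewrite (leq_trans (leqnSn N))//.
  by rewrite -[N.+1 in leqLHS]expn1 (leq_trans (leq_pexp2l _ m0))// leq_pmull.
have [N PN maxN] := ex_maxnP (ex_intro P N1 h1) bnd.
exists N; split=> //; first exact: maxN.
by rewrite ltnNge; apply/negP => /maxN; rewrite ltnn.
Qed.

Theorem theorem4p3
  (R : realType) (m : nat) (hm : (2 <= m)%N)
  (* sigma: (a positive multiple of) the surface measure of S^m, i.e. a nonzero
     finite Borel measure concentrated on S^m and invariant under SO(m+1) *)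
  (sigma : {measure set (SM R m) -> \bar R})
  (hsig_fin : (sigma setT < +oo)%E) (hsig_pos : (0 < sigma setT)%E)
  (hsig_supp : sigma (~` @sphere R m) = 0%E)
  (hsig_inv : forall O : 'M[R]_(m.+1), rotation O ->
      forall A : set (SM R m), measurable A ->
      sigma (act O @^-1` A) = sigma A)
  (* the pole xi *)
  (xi : E R m) (hxi : @sphere R m xi)
  (* the family mu_t = mup t - mun t of finite signed Borel measures on S^m *)
  (mup mun : R -> {measure set (SM R m) -> \bar R})
  (hmu_fin : forall t, (mup t setT < +oo)%E /\ (mun t setT < +oo)%E)
  (hmu_supp : forall t, mup t (~` @sphere R m) = 0%E /\ mun t (~` @sphere R m) = 0%E)
  (* invariance under the rotations fixing xi *)
  (hmu_inv : forall t, 0 < t < pi -> forall O : 'M[R]_(m.+1), rotation O ->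
      act O xi = xi -> forall A : set (SM R m), measurable A ->
      fine (mup t (act O @^-1` A)) - fine (mun t (act O @^-1` A)) =
      fine (mup t A) - fine (mun t A))
  (* uniform boundedness *)
  (hmu_bd : exists M : R, forall t, 0 < t < pi ->
      (mup t setT + mun t setT <= M%:E)%E)
  (* the multipliers *)
  (c : nat -> R) (hc : forall k, c k != 0)
  (alpha : nat -> nat) (halpha : forall k1 k2, (k1 < k2)%N -> (alpha k1 < alpha k2)%N)
  (gamma beta : R) (hgamma : 0 < gamma)
  (hbeta : exists N : nat, 2 * beta = N%:R /\ gamma <= N%:R)
  (v : R -> R) (hv_pos : forall t, 0 < t < pi -> 0 < v t)
  (hv_asym : exists cm C1 C2 : R, 0 < C1 /\ 0 < C2 /\
      forall t, 0 < t < pi -> C1 * t `^ cm <= v t /\ v t <= C2 * t `^ cm)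
  (hmult : forall t, 0 < t < pi -> forall k : nat,
      (fine (sigma setT))^-1 *
        (RintS (mup t) (@sphere R m)
           (fun y => geg ((m%:R - 1) / 2) k (dot xi y)) -
         RintS (mun t) (@sphere R m)
           (fun y => geg ((m%:R - 1) / 2) k (dot xi y)))
      = c k / v t * geg beta (alpha k) (cos t) * (sin t) `^ gamma)
  (halpha_growth : forall l : nat, (0 < l)%N ->
      exists q : nat, (0 < q)%N /\ forall n : nat, (1 <= n)%N -> (l * n <= alpha (q * n))%N)
  (* the kernel *)
  (K : E R m -> E R m -> R)
  (hK_cont : {within [set p : E R m * E R m | @sphere R m p.1 /\ @sphere R m p.2],
               continuous (fun p : E R m * E R m => K p.1 p.2)})
  (hK_sym : forall x y, @sphere R m x -> @sphere R m y -> K x y = K y x)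
  (hK_pd : pos_def_kernel K)
  (* B : nonnegative element of L^infinity(S^m) *)
  (B : SM R m -> R) (hB_meas : measurable_fun (@sphere R m) B)
  (hB_nonneg : forall x, @sphere R m x -> 0 <= B x)
  (hB_ess : exists MB : R, \forall x \ae sigma, @sphere R m x -> B x <= MB)
  (rho : R) (hrho : 0 < rho <= 2)
  (* K is (mu_t, B, rho)-Hoelder; (K(x,.) * mu_t)(y) computed with a rotation
     O_y mapping y to xi *)
  (hK_hoelder : forall t, 0 < t < pi -> forall x y : E R m,
      @sphere R m x -> @sphere R m y ->
      forall O : 'M[R]_(m.+1), rotation O -> act O y = xi ->
      `| (fine (sigma setT))^-1 *
           (RintS (mup t) (@sphere R m) (fun z => K x (act O^T z)) -
            RintS (mun t) (@sphere R m) (fun z => K x (act O^T z)))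
         - K x y | <= B x * t `^ rho) :
  exists C : R, \forall n \near \oo,
    (kolmogorov_width sigma (rkhs_unit_sphere K) n <=
      (C * (n.+1%:R) `^ (- (2^-1 + rho / (2 * m%:R))))%:E)%E.
Proof.
have m0 : (0 < m)%N by exact: ltn_trans hm.
pose I : (E R m -> R) -> R := sphere_int sigma; pose w := fine (sigma setT).
pose lam : R := (m%:R - 1) / 2.
have w0 : 0 < w by rewrite fine_gt0// hsig_pos.
have hI : quadratic_limit true I w.
  by rewrite /w -(sphere_full hsig_supp); exact: sphere_int_quadratic.
have I1 : I (fun=> 1) = w := sphere_int1 hsig_supp.
have elam : 2 * lam + 1 = m%:R by rewrite /lam; field.
have lam0 : 0 < lam by rewrite divr_gt0// subr_gt0 ltr1n.
have invI Q : rotation Q -> forall f, ucb (@sphere R m : set (E R m)) f ->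
    I (fun z => f (act Q z)) = I f.
  by move=> hQ f uf; apply: sphere_int_rotation => //; exact: hsig_inv.
have uK : ucb ((@sphere R m : set (E R m)) `*` (@sphere R m : set (E R m)))
    (fun p : E R m * E R m => K p.1 p.2).
  by apply: compact_ucb hK_cont; apply: compact_setX; exact: sphere_compact.
have pdK s := @pre_norm2_ge0 R m K s hK_pd.
have [CK hCK] : exists CK, forall x y, @sphere R m x -> @sphere R m y -> `|K x y| <= CK.
  by have [[C hC] _] := uK; exists C => x y Sx Sy; exact: (hC (x, y)).
have [rot hrot] : exists rot : E R m -> 'M[R]_(m.+1), forall y, @sphere R m y ->
    rotation (rot y) /\ act (rot y) y = xi.
  have : forall y : E R m, exists Q : 'M[R]_(m.+1), @sphere R m y -> rotation Q /\ act Q y = xi.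
    move=> y; have [Sy|nSy] := pselect (@sphere R m y); last by exists 1%:M.
    by have [Q hQ e] := rotation_to hm Sy hxi; exists Q.
  by move=> h; have [rot hrot] := choice h; exists rot.
pose J t (f : E R m -> R) := sphere_int (mup t) f - sphere_int (mun t) f.
have hJ t : quadratic_limit false (J t)
    (fine (mup t (@sphere R m)) + fine (mun t (@sphere R m))).
  by have [f1 f2] := hmu_fin t; apply: quadratic_limit_sub; exact: sphere_int_quadratic.
have invJ t : 0 < t < pi -> fixing_invariant (J t) xi.
  move=> ht Q hQ Qxi f uf; have [f1 f2] := hmu_fin t.
  by apply: sphere_int_act => // A mA; exact: hmu_inv.
have [MB0 hMB0] := hB_ess.
have hB f C : ucb (@sphere R m : set (E R m)) f -> 0 <= C ->
    (forall x, @sphere R m x -> `|f x| <= B x * C) -> `|I f| <= `|MB0| * C * w.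
  move=> uf C0 fB; rewrite /w -(sphere_full hsig_supp).
  apply: sphere_int_ae_le => //; first by rewrite mulr_ge0.
  apply: filterS hMB0 => x hx Sx; apply: (le_trans (fB x Sx)).
  by rewrite ler_wpM2r// (le_trans (hx Sx))// ler_norm.
(* [2 * beta] cannot be zero, being at least [gamma > 0]; the oscillator estimates need a positive
   damping constant. *)
have [N' hbeta'] : exists N', 2 * beta = N'.+1%:R.
  have [[|N'] [e g]] := hbeta; last by exists N'.
  by have := lt_le_trans hgamma g; rewrite ltxx.
have hmult' t : 0 < t < pi -> forall k, zonal_multiplier w lam (J t) xi k =
    c k / v t * geg beta (alpha k) (cos t) * (sin t) `^ gamma.
  move=> ht k; rewrite -hmult// /zonal_multiplier /J /sphere_int.
  by under eq_fun do rewrite horner_geg_poly.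
have [C' [N0 [C'0 tail]]] := kernel_tail hm hI w0 I1 elam lam0 invI uK hK_sym pdK hCK
  (fun t _ => hJ t) hxi invJ hrot (normr_ge0 MB0) hB_nonneg hB hrho
  (fun t ht x y Sx Sy => hK_hoelder t ht x y Sx Sy (rot y) (hrot y Sy).1 (hrot y Sy).2)
  hbeta' (leq_strict_mono halpha) hv_pos hmult'.
have rho0 : 0 <= rho by case/andP: hrho => /ltW.
pose D : R := (C' + 1) * 9 `^ (m%:R + rho).
have D0 : 0 <= D by rewrite mulr_ge0 ?powR_ge0// addr_ge0.
(* From this index on, the degree N matched to [n] is at least [N0], as the tail bound requires, and
   at least 1, as the comparison of N with [n] requires. *)
exists (Num.sqrt D); exists (3 * (maxn N0 1).+1 ^ m)%N => // n /= hn.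
have [N [N1 Nn nN]] := exists_degree m0 hn.
move: N1; rewrite geq_max => /andP[N0N N1].
have Np : 0 < N%:R :> R by rewrite ltr0n.
have Nm0 : 0 < (N.+1 ^ m)%:R :> R by rewrite ltr0n expn_gt0.
(* The squared distance is chosen so that (N+1)^m greedy steps exceed the trace bound C' N^(-rho);
   adding 1 to [C'] makes the inequality strict even when [C'] is zero. *)
pose e2 : R := (C' + 1) * (N%:R `^ (- rho) / (N.+1 ^ m)%:R).
have C'1 : 0 < C' + 1 by rewrite ltr_wpDl.
have e20 : 0 < e2 by rewrite mulr_gt0// divr_gt0// powR_gt0.
have e0 : 0 < Num.sqrt e2 by rewrite sqrtr_gt0.
have [|k [u [kN hu hr]]] := @rkhs_approximation R m I w lam K hm hI w0 I1 elam lam0 invI uK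
    hK_sym pdK CK hCK N _ (Num.sqrt e2) (tail N N0N) e0.
  rewrite (sqr_sqrtr (ltW e20)) /e2 mulrCA [X in _ < _ * X]mulrC divfK ?gt_eqF//.
  by rewrite ltr_pM2r ?powR_gt0// ltrDl.
rewrite sqr_sqrtr in hr; last exact: ltW.
apply: (@kolmogorov_width_le R m sigma hsig_fin (rkhs_unit_sphere K) k n u) => //.
- exact: leq_trans kN Nn.
- by move=> f; exact: (rkhs_ucb uK hK_sym pdK hCK).
move=> f /hr /le_trans; apply.
rewrite (_ : rho / (2 * m%:R) = (rho / m%:R) / 2); last first.
  by rewrite invfM mulrA mulrAC.
rewrite -powR_sqrt_rate exprMn !sqr_sqrtr ?powR_ge0// -mulrA ler_wpM2l ?(ltW C'1)//.
by rewrite natrX; exact: width_rate.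
Qed.
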